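(* The $\mathcal{T}$-consistency problem for the tile set $\mathcal{T}=\{t_1,t_2\}$ consisting of two different types of $2\times 2$ squares, $t_1=t_2=\{(0,0),(0,1),(1,0),(1,1)\}$, is $\mathbb{NP}$-complete.
   Context: A tile is a finite subset of $\mathbb{Z}^2$ (here a hole-less polyomino) containing $(0,0)$, its center, which is its upper-left corner; coordinates are (row, column), rows numbered top to bottom and columns left to right. For $(i,j)\in\mathbb{Z}^2$, $(i,j)+t=\{(i+i',j+j'):(i',j')\in t\}$. Fix a finite list of tiles $\mathcal{T}=(t_1,\dots,t_h)$; the index $k$ is the type of $t_k$ (different types may have the same shape, and are then distinguished, like different colors). Tiles may only be translated, not rotated. A $\mathcal{T}$-tiling of the grid $G=\mathbb{Z}_n\times\mathbb{Z}_n=\{0,\dots,n-1\}^2$ is a finite set $T\subseteq \mathbb{Z}_n\times\mathbb{Z}_n\times\{1,\dots,h\}$ such that the sets $(i,j)+t_k$, $(i,j,k)\in T$, are pairwise disjoint and contained in $G$ (the tiling need not cover the whole grid). Its (center) projections are $r,c\in\mathbb{N}^{n\times h}$ with $r_{i,k}=|\{j:(i,j,k)\in T\}|$ and $c_{j,k}=|\{i:(i,j,k)\in T\}|$. The $\mathcal{T}$-consistency problem is: given $n$ and $r,c\in\mathbb{N}^{n\times h}$, decide whether there exists a $\mathcal{T}$-tiling of the $n\times n$ grid with projections $r,c$. *)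

(* Defs.v *)
From HB Require Import structures.
From mathcomp Require Import all_boot all_order all_algebra finmap.

Set Implicit Arguments.
Unset Strict Implicit.
Unset Printing Implicit Defensive.

Variant direction := ToLeft | Stay | ToRight.

(* The tape alphabet is the input alphabet {0,1}, a blank ([None]) and an
   arbitrary finite set of auxiliary symbols. *)
Definition symbol (aux : finType) : finType := option (bool + aux).

Definition blank {aux : finType} : symbol aux := None.

Definition bit {aux : finType} (b : bool) : symbol aux := Some (inl b).

Record machine := Machine {
  ntapes : nat; (* there are [ntapes.+1] tapes *)
  state : finType;
  aux : finType;
  start : state;
  halting : pred state;
  delta : state -> {ffun 'I_ntapes.+1 -> symbol aux} ->
          state * ('I_ntapes.+1 -> symbol aux * direction)
}.

(* A two-way infinite tape, blank almost everywhere: the cells to the left of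
   the head (nearest first), the scanned cell, and the cells to its right;
   everything beyond the two lists is blank. *)
Record tape (S : Type) := Tape {
  tape_left : seq S;
  scanned : S;
  tape_right : seq S
}.

Definition write_move {aux : finType} (a : symbol aux * direction)
    (t : tape (symbol aux)) : tape (symbol aux) :=
  let: Tape l _ r := t in
  match a.2 with
  | ToLeft => Tape (behead l) (head blank l) (a.1 :: r)
  | Stay => Tape l a.1 r
  | ToRight => Tape (a.1 :: l) (head blank r) (behead r)
  end.

Definition word_tape {aux : finType} (w : seq bool) : tape (symbol aux) :=
  let s := map bit w in Tape [::] (head blank s) (behead s).

Fixpoint leading_bits {aux : finType} (s : seq (symbol aux)) : seq bool :=
  if s is Some (inl b) :: s' then b :: leading_bits s' else [::].

Definition tape_word {aux : finType} (t : tape (symbol aux)) : seq bool :=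
  leading_bits (scanned t :: tape_right t).

Record config (M : machine) := Config {
  control : state M;
  tapes : 'I_(ntapes M).+1 -> tape (symbol (aux M))
}.

(* Halting configurations are fixed points. *)
Definition step (M : machine) (cf : config M) : config M :=
  if halting (control cf) then cf
  else let: (q, act) := delta (control cf) [ffun i => scanned (tapes cf i)] in
       Config q (fun i => write_move (act i) (tapes cf i)).

Definition init_config (M : machine) (w : seq bool) : config M :=
  Config (start M) (fun i => word_tape (if i == ord0 then w else [::])).

(* The input is on tape 0 and so is the output: it is read from the final head
   position rightwards, up to the first cell that does not contain a bit. *)
Definition outputs_within (M : machine) (w v : seq bool) (t : nat) : Prop :=
  let cf := iter t (@step M) (init_config M w) in
  halting (control cf) /\ tape_word (tapes cf ord0) = v.

Definition language := seq bool -> Prop.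

(* Every polynomial in n is bounded by n ^ k + k for some k. *)
Definition polytime (f : seq bool -> seq bool) : Prop :=
  exists (M : machine) (k : nat),
    forall w, outputs_within M w (f w) (size w ^ k + k).

Definition in_P (L : language) : Prop :=
  exists2 f : seq bool -> bool,
    polytime (fun w => [:: f w]) & forall w, L w <-> f w.

(* Self-delimiting copy of a word: each bit b becomes 1b, and a 0 ends it. *)
Definition delimit (w : seq bool) : seq bool :=
  flatten [seq [:: true; b] | b <- w] ++ [:: false].

Definition pair_word (x y : seq bool) : seq bool := delimit x ++ y.

Definition in_NP (L : language) : Prop :=
  exists (V : language) (k : nat),
    in_P V /\
    forall x, L x <->
      exists y, size y <= size x ^ k + k /\ V (pair_word x y).

Definition reduces (L L' : language) : Prop :=
  exists2 f : seq bool -> seq bool,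
    polytime f & forall x, L x <-> L' (f x).

Definition NP_hard (L : language) : Prop :=
  forall L', in_NP L' -> reduces L' L.

Definition NP_complete (L : language) : Prop := in_NP L /\ NP_hard L.

(* A decision problem with a binary encoding of its instances, as a language. *)
Definition language_of (I : Type) (enc : I -> seq bool) (P : I -> Prop) :
    language :=
  fun w => exists2 x, w = enc x & P x.

Local Open Scope fset_scope.

Definition cell : choiceType := (int * int)%type.

Definition tile := {fset cell}.

Definition translate (p : cell) (t : tile) : tile :=
  [fset ((p.1 + x.1)%R, (p.2 + x.2)%R) | x in t].

Definition in_grid (n : nat) (x : cell) : bool :=
  (0 <= x.1 < n%:Z)%R && (0 <= x.2 < n%:Z)%R.

Definition placed (h : nat) (ts : h.-tuple tile) (n : nat)
    (a : 'I_n * 'I_n * 'I_h) : tile :=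
  let: (i, j, k) := a in translate (Posz i, Posz j) (tnth ts k).

Definition is_tiling (h : nat) (ts : h.-tuple tile) (n : nat)
    (T : {set 'I_n * 'I_n * 'I_h}) : Prop :=
  (forall a, a \in T -> forall x, x \in placed ts a -> in_grid n x) /\
  (forall a b, a \in T -> b \in T -> a != b ->
     [disjoint placed ts a & placed ts b]).

Definition row_projection (h n : nat) (T : {set 'I_n * 'I_n * 'I_h}) :
    'M[nat]_(n, h) :=
  \matrix_(i < n, k < h) #|[set j : 'I_n | (i, j, k) \in T]|.

Definition col_projection (h n : nat) (T : {set 'I_n * 'I_n * 'I_h}) :
    'M[nat]_(n, h) :=
  \matrix_(j < n, k < h) #|[set i : 'I_n | (i, j, k) \in T]|.

Local Close Scope fset_scope.

Record instance (h : nat) := Instance {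
  grid_size : nat;
  row_sums : 'M[nat]_(grid_size, h);
  col_sums : 'M[nat]_(grid_size, h)
}.

Definition consistent (h : nat) (ts : h.-tuple tile) (I : instance h) : Prop :=
  exists T : {set 'I_(grid_size I) * 'I_(grid_size I) * 'I_h},
    [/\ is_tiling ts T,
        row_projection T = row_sums I
      & col_projection T = col_sums I].

(* Binary digits, least significant first; 0 has the single digit 0. *)
Definition binary (m : nat) : seq bool :=
  [seq odd (m %/ 2 ^ i) | i <- iota 0 (trunc_log 2 m).+1].

Definition encode_nat (m : nat) : seq bool := delimit (binary m).

Definition encode_matrix (m h : nat) (A : 'M[nat]_(m, h)) : seq bool :=
  flatten [seq encode_nat (A i k) | i <- enum 'I_m, k <- enum 'I_h].

Definition encode_instance (h : nat) (I : instance h) : seq bool :=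
  encode_nat (grid_size I) ++
  encode_matrix (row_sums I) ++ encode_matrix (col_sums I).

Definition consistency_problem (h : nat) (ts : h.-tuple tile) : language :=
  language_of (@encode_instance h) (consistent ts).

Definition square22 : tile :=
  [fset ((0, 0) : cell); ((0, 1) : cell); ((1, 0) : cell); ((1, 1) : cell)]%fset%R.

Definition two_squares : 2.-tuple tile := [tuple square22; square22].

Lemma delimit_inj (x y u v : seq bool) :
  delimit x ++ u = delimit y ++ v -> x = y /\ u = v.
Proof.
rewrite /delimit; elim: x y => [|a x IH] [|b y] //= [] //.
by move=> -> /IH [-> ->].
Qed.

Lemma binary_inj : injective binary.
Proof.
move=> m n; rewrite /binary => eq_mn.
have /(congr1 size) := eq_mn; rewrite !size_map !size_iota => -[eq_l].
have digit i : odd (m %/ 2 ^ i) = odd (n %/ 2 ^ i).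
  case: (ltnP i (trunc_log 2 m).+1) => [lt_i|ge_i].
    have := congr1 (fun s => nth false s i) eq_mn.
    by rewrite -eq_l !(nth_map 0) ?size_iota // !nth_iota // -eq_l.
  have small p : trunc_log 2 p < i -> p %/ 2 ^ i = 0.
    move=> lt_p; apply: divn_small.
    by apply: leq_trans (trunc_log_ltn p (isT : 1 < 2)) _; rewrite leq_exp2l.
  by rewrite !small // -eq_l.
elim/ltn_ind: m n digit {eq_mn eq_l} => m IH n digit.
case: (posnP m) => [m0|m_gt0].
  rewrite m0 in digit *; case: (posnP n) => [-> //|n_gt0].
  have := digit (trunc_log 2 n); rewrite div0n.
  have /andP[le_n lt_n] := trunc_log_bounds (isT : 1 < 2) n_gt0.
  suff -> : n %/ 2 ^ trunc_log 2 n = 1 by [].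
  apply/eqP; rewrite eqn_leq leq_divRL ?expn_gt0 // mul1n le_n andbT.
  by rewrite -ltnS ltn_divLR ?expn_gt0 // -expnS.
have dig0 := digit 0; rewrite !expn0 !divn1 in dig0.
rewrite -(odd_double_half m) -(odd_double_half n) dig0.
congr (_ + _.*2); apply: IH => [|i]; last first.
  by rewrite -!divn2 -!divnMA -expnS; apply: digit.
by rewrite -divn2 ltn_Pdiv.
Qed.

Lemma encode_matrix_inj (m h : nat) (A B : 'M[nat]_(m, h)) (u v : seq bool) :
  encode_matrix A ++ u = encode_matrix B ++ v -> A = B /\ u = v.
Proof.
have list_inj (P : seq ('I_m * 'I_h)) :
  flatten [seq encode_nat (A p.1 p.2) | p <- P] ++ u =
  flatten [seq encode_nat (B p.1 p.2) | p <- P] ++ v ->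
  {in P, forall p, A p.1 p.2 = B p.1 p.2} /\ u = v.
  elim: P => [|p P IH]; first by [].
  rewrite !map_cons -[flatten (_ :: _)]/(_ ++ flatten _)
    -[flatten (encode_nat (B _ _) :: _)]/(_ ++ flatten _) -!(catA (encode_nat _)).
  move=> /delimit_inj[/binary_inj eq_p /IH[eq_P ->]]; split=> // q.
  by rewrite inE => /predU1P[->|/eq_P].
have pairs (C : 'M[nat]_(m, h)) : encode_matrix C =
    flatten [seq encode_nat (C p.1 p.2)
            | p <- [seq (i, k) | i <- enum 'I_m, k <- enum 'I_h]].
  by rewrite map_allpairs.
rewrite !pairs => /list_inj[eqAB ->]; split=> //; apply/matrixP=> i k.
by apply: (eqAB (i, k)); apply/allpairsP; exists (i, k); rewrite !mem_enum.
Qed.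

Lemma encode_instance_inj (h : nat) : injective (@encode_instance h).
Proof.
move=> [m r c] [n r' c'] /delimit_inj[/binary_inj /= eq_mn].
case: n / eq_mn r' c' => r' c' /encode_matrix_inj[<-].
by rewrite -[encode_matrix c]cats0 -[encode_matrix c']cats0 => /encode_matrix_inj[<-].
Qed.

(* Main.v *)
(** Membership in NP: a certificate lists the bits of a tiling, and the verifier
    recomputes the instance from it.

    Hardness.  If all the sums of odd rows and columns vanish, the squares sit at
    even positions and never interact, so an instance is a matrix problem with
    two kinds of atoms, A and B.  A CNF with m clauses over v variables becomes a
    staircase of m+1 row blocks R_q and column blocks C_q with 2v lines each, one
    line (a rail) per literal, separated by pairs of rows E_q and of columns F_q.
    The sums are tight across the block cuts: below the staircase every entry is
    A, above it every entry is B, and the blocks on the staircase are triangular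
    up to a correction by one unit per rail.  These corrections carry a set of true
    literals from block to block; the sums of partial suffixes only let it change
    in one direction, and the second row of E_q forces it to meet clause q.  Hence
    a consistent matrix yields assignments that change monotonically along the
    clauses and satisfy clause q at time q, and an assignment satisfying all the
    clauses yields a matrix.

    This monotone relaxation of satisfiability suffices for a Cook-Levin tableau
    written with Horn clauses ordered by time: facts that were once derived stay
    true, the initial clauses guess the certificate, and the last clause asks that
    the output is not 0.  Tapes are centred at their heads, so that all the
    clauses of a step are instances of finitely many templates.

    Polynomial time is obtained by compiling a small first-order language with
    bounded iteration over words to multitape machines. *)
From HB Require Import structures.
From mathcomp Require Import all_boot all_order all_algebra finmap zify.
From Stdlib Require Import FunctionalExtensionality.
Require Import Defs.

Set Implicit Arguments.
Unset Strict Implicit.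
Unset Printing Implicit Defensive.

(** * Stack programs as Turing machines *)

(** The obstacle is equality: projections compare a block with the next one only through
    inequalities between suffix sums, so two consecutive assignments cannot be forced to agree. Each
    variable therefore gets two neighbouring rails, an even one for the positive and an odd one for
    the negative literal, which share one unit. The first block puts all units on odd rails, the
    last one on even rails. These two ends pin the suffix sums that start at even rails, so a unit
    never leaves its pair; the sums that start at odd rails keep a margin of one, through which a
    unit may pass once, from odd to even. A clause is read by counting: the second row of E_q holds
    one B more than there are rails outside the clause, so some B meets a literal of the clause. On
    the logical side, surplus facts are harmless. The Horn clauses force the facts of a real run to
    hold, and whatever else has switched on can only hurt the last clause, which is negative. The
    reduction computes with numbers in unary, which is affordable because all dimensions of the
    tableau are polynomial in the length of the input; only the final output is written in
    binary. *)

Definition store := nat -> seq bool.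

Definition upd (e : store) (r : nat) (s : seq bool) : store :=
  fun i => if i == r then s else e i.

Inductive prog :=
| Skip
| Push (r : nat) (b : bool)
| Pop (r : nat)
| Seq (p q : prog)
| IfTop (r : nat) (p0 p1 p2 : prog)
| While (r : nat) (p : prog).

(** The costs are those of the compiled machine, so that [run_go] is an exact simulation: a test is
    one transition, and a push is two, because the head first moves left onto a fresh cell. *)
Inductive run : prog -> store -> store -> nat -> Prop :=
| run_skip e : run Skip e e 1
| run_push r b e : run (Push r b) e (upd e r (b :: e r)) 2
| run_pop r e : run (Pop r) e (upd e r (behead (e r))) 1
| run_seq p q e1 e2 e3 t1 t2 :
    run p e1 e2 t1 -> run q e2 e3 t2 -> run (Seq p q) e1 e3 (t1 + t2)
| run_if0 r p0 p1 p2 e e' t :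
    e r = [::] -> run p0 e e' t -> run (IfTop r p0 p1 p2) e e' t.+1
| run_if1 r p0 p1 p2 e e' t s :
    e r = true :: s -> run p1 e e' t -> run (IfTop r p0 p1 p2) e e' t.+1
| run_if2 r p0 p1 p2 e e' t s :
    e r = false :: s -> run p2 e e' t -> run (IfTop r p0 p1 p2) e e' t.+1
| run_while0 r p e : e r = [::] -> run (While r p) e e 1
| run_whileS r p e1 e2 e3 t1 t2 :
    e1 r != [::] -> run p e1 e2 t1 -> run (While r p) e2 e3 t2 ->
    run (While r p) e1 e3 (t1 + t2).+1.

Notation sym := (symbol void).

(** Program points; they become the finite control. The [None] of [IfTop] and [While] is the test
    itself. *)
Fixpoint pos (p : prog) : finType :=
  match p with
  | Skip => unit
  | Push _ _ => bool
  | Pop _ => unit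
  | Seq p q => (pos p + pos q)%type
  | IfTop _ p0 p1 p2 => option (pos p0 + (pos p1 + pos p2))%type
  | While _ p => option (pos p)
  end.

Fixpoint entry (p : prog) : pos p :=
  match p return pos p with
  | Skip => tt
  | Push _ _ => true
  | Pop _ => tt
  | Seq p q => inl (entry p)
  | IfTop _ _ _ _ => None
  | While _ _ => None
  end.

Definition action := (nat * (sym * direction))%type.

(** A next point [None] means that control leaves the program, so programs compose by redirecting
    this exit. Each transition acts on one tape. [Pop] erases the scanned cell before moving right,
    so nothing is left behind to the left of a head. *)
Fixpoint nxt (p : prog) : pos p -> (nat -> sym) -> option (pos p) * action :=
  match p return pos p -> (nat -> sym) -> option (pos p) * action with
  | Skip => fun _ s => (None, (0, (s 0, Stay)))
  | Push r b => fun q s =>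
      if q then (Some false, (r, (s r, ToLeft))) else (None, (r, (bit b, Stay)))
  | Pop r => fun _ s =>
      (None, (r, if s r is None then (None, Stay) else (None, ToRight)))
  | Seq p p' => fun q s =>
      match q with
      | inl q => let: (o, a) := nxt q s in
                 (Some (if o is Some q' then inl q' else inr (entry p')), a)
      | inr q => let: (o, a) := nxt q s in (omap inr o, a)
      end
  | IfTop r p0 p1 p2 => fun q s =>
      match q with
      | None => (Some (Some (match s r with
                       | Some (inl true) => inr (inl (entry p1))
                       | Some (inl false) => inr (inr (entry p2))
                       | _ => inl (entry p0) end)), (r, (s r, Stay)))
      | Some (inl q) => let: (o, a) := nxt q s in
                        (omap (fun q => Some (inl q)) o, a)
      | Some (inr (inl q)) => let: (o, a) := nxt q s in
                        (omap (fun q => Some (inr (inl q))) o, a)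
      | Some (inr (inr q)) => let: (o, a) := nxt q s in
                        (omap (fun q => Some (inr (inr q))) o, a)
      end
  | While r p => fun q s =>
      match q with
      | None => (if s r is None then None else Some (Some (entry p)),
                 (r, (s r, Stay)))
      | Some q => let: (o, a) := nxt q s in
                  (Some (if o is Some q' then Some q' else None), a)
      end
  end.

Fixpoint max_reg (p : prog) : nat :=
  match p with
  | Skip => 0
  | Push r _ | Pop r => r
  | Seq p q => maxn (max_reg p) (max_reg q)
  | IfTop r p0 p1 p2 =>
      maxn r (maxn (max_reg p0) (maxn (max_reg p1) (max_reg p2)))
  | While r p => maxn r (max_reg p)
  end.

Definition act_on (k : nat) (s : {ffun 'I_k.+1 -> sym}) (a : action) :
    'I_k.+1 -> sym * direction :=
  fun i => if nat_of_ord i == a.1 then a.2 else (s i, Stay).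

Definition prog_machine (p : prog) : machine :=
  @Machine (max_reg p) (option (pos p)) void (Some (entry p))
    (fun q => q == None)
    (fun q s => if q is Some q' then
                  let: (o, a) := nxt q' (fun r => s (inord r)) in (o, act_on s a)
                else (None, fun i => (s i, Stay))).

Definition tapes_of (k : nat) := 'I_k.+1 -> tape sym.

Definition scan (k : nat) (tp : tapes_of k) : {ffun 'I_k.+1 -> sym} :=
  [ffun i => scanned (tp i)].

Definition apply_act (k : nat) (tp : tapes_of k) (a : action) : tapes_of k :=
  fun i => write_move (act_on (scan tp) a i) (tp i).

Inductive go (k : nat) (p : prog) : pos p -> tapes_of k -> nat -> tapes_of k -> Prop :=
| go_last q tp a :
    nxt q (fun r => scan tp (inord r)) = (None, a) -> go q tp 1 (apply_act tp a)
| go_step q tp q' a t tp' :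
    nxt q (fun r => scan tp (inord r)) = (Some q', a) ->
    go q' (apply_act tp a) t tp' -> go q tp t.+1 tp'.

(** The top of the stack is under the head. Visited blanks are stored explicitly, hence the
    paddings. The blank left side guarantees that a push moves onto an empty cell. *)
Definition tape_stack (t : tape sym) (s : seq bool) : Prop :=
  (exists i, tape_left t = nseq i None) /\
  (exists i, scanned t :: tape_right t = map bit s ++ nseq i None).

Definition represents (k : nat) (tp : tapes_of k) (e : store) : Prop :=
  forall i : 'I_k.+1, tape_stack (tp i) (e i).

Lemma scan_top k (tp : tapes_of k) e r : represents tp e -> r <= k ->
  scan tp (inord r) = head blank (map bit (e r)).
Proof.
move=> rep ler; rewrite /scan ffunE.
have [_ [i]] := rep (inord r); rewrite inordK //.
by case: (e r) => [|b s] /=; case: i => [|i] //= [->].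
Qed.

Lemma write_same (t : tape sym) : write_move (scanned t, Stay) t = t.
Proof. by case: t. Qed.

Lemma apply_act_other k (tp : tapes_of k) a (i : 'I_k.+1) :
  i <> a.1 :> nat -> apply_act tp a i = tp i.
Proof. by rewrite /apply_act /act_on => /eqP/negPf->; rewrite ffunE write_same. Qed.

Lemma apply_act_same k (tp : tapes_of k) a (i : 'I_k.+1) :
  i = a.1 :> nat -> apply_act tp a i = write_move a.2 (tp i).
Proof. by rewrite /apply_act /act_on => ->; rewrite eqxx. Qed.

Lemma apply_represents k (tp : tapes_of k) e r a s : represents tp e ->
  (forall t, tape_stack t (e r) -> tape_stack (write_move (a (scanned t)) t) s) ->
  r <= k -> represents (apply_act tp (r, a (scan tp (inord r)))) (upd e r s).
Proof.
move=> rep Ha ler i; rewrite /apply_act /act_on /upd /=.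
case: eqP => [eqi|_]; last by rewrite ffunE write_same; apply: rep.
have -> : inord r = i by apply: val_inj; rewrite /= inordK // eqi.
by rewrite /scan ffunE; apply: Ha; rewrite -eqi; apply: rep.
Qed.

Lemma upd_same e r : upd e r (e r) = e.
Proof. by apply: functional_extensionality => i; rewrite /upd; case: eqP => // ->. Qed.

Lemma stay_represents k (tp : tapes_of k) e r : represents tp e -> r <= k ->
  represents (apply_act tp (r, (scan tp (inord r), Stay))) e.
Proof.
move=> rep ler; rewrite -[X in represents _ X](upd_same e r).
by apply: (apply_represents (a := fun x => (x, Stay))) => // t; rewrite write_same.
Qed.

Lemma go_seqr k p q (x : pos q) (tp tp' : tapes_of k) t :
  go x tp t tp' -> go (p := Seq p q) (inr x) tp t tp'.
Proof.
elim=> {x tp t tp'} [x tp a E|x tp x' a t tp' E _ IH].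
  by apply: go_last; rewrite /= E.
by apply: go_step IH; rewrite /= E.
Qed.

Lemma go_seq k p q (x : pos p) (tp tp' tp'' : tapes_of k) t1 t2 :
  go x tp t1 tp' -> go (entry q) tp' t2 tp'' ->
  go (p := Seq p q) (inl x) tp (t1 + t2) tp''.
Proof.
move=> H1 H2; elim: H1 H2 => {x tp t1 tp'} [x tp a E|x tp x' a t tp' E _ IH] H2.
  apply: (@go_step _ (Seq p q) _ _ (inr (entry q)) a); first by rewrite /= E.
  exact: go_seqr.
by rewrite addSn; apply: go_step; [rewrite /= E | apply: IH].
Qed.

Lemma go_if0 k r p0 p1 p2 (x : pos p0) (tp tp' : tapes_of k) t :
  go x tp t tp' -> go (p := IfTop r p0 p1 p2) (Some (inl x)) tp t tp'.
Proof.
elim=> {x tp t tp'} [x tp a E|x tp x' a t tp' E _ IH].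
  by apply: go_last; rewrite /= E.
by apply: go_step IH; rewrite /= E.
Qed.

Lemma go_if1 k r p0 p1 p2 (x : pos p1) (tp tp' : tapes_of k) t :
  go x tp t tp' -> go (p := IfTop r p0 p1 p2) (Some (inr (inl x))) tp t tp'.
Proof.
elim=> {x tp t tp'} [x tp a E|x tp x' a t tp' E _ IH].
  by apply: go_last; rewrite /= E.
by apply: go_step IH; rewrite /= E.
Qed.

Lemma go_if2 k r p0 p1 p2 (x : pos p2) (tp tp' : tapes_of k) t :
  go x tp t tp' -> go (p := IfTop r p0 p1 p2) (Some (inr (inr x))) tp t tp'.
Proof.
elim=> {x tp t tp'} [x tp a E|x tp x' a t tp' E _ IH].
  by apply: go_last; rewrite /= E.
by apply: go_step IH; rewrite /= E.
Qed.

Lemma go_while k r p (x : pos p) (tp tp' tp'' : tapes_of k) t1 t2 :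
  go x tp t1 tp' -> go (p := While r p) None tp' t2 tp'' ->
  go (p := While r p) (Some x) tp (t1 + t2) tp''.
Proof.
move=> H1 H2; elim: H1 H2 => {x tp t1 tp'} [x tp a E|x tp x' a t tp' E _ IH] H2.
  by apply: (@go_step _ (While r p) _ _ None a); first by rewrite /= E.
by rewrite addSn; apply: go_step; [rewrite /= E | apply: IH].
Qed.

(** An inequality on [max_reg p], and not an equality, lets the induction run subprograms on the
    tapes of the whole program. *)
Lemma run_go k p e e' t : run p e e' t -> max_reg p <= k ->
  forall tp : tapes_of k, represents tp e ->
  exists2 tp', go (entry p) tp t tp' & represents tp' e'.
Proof.
elim=> {p e e' t} [e|r b e|r e|p q e1 e2 e3 t1 t2 _ IH1 _ IH2
  |r p0 p1 p2 e e' t E _ IH|r p0 p1 p2 e e' t s E _ IH|r p0 p1 p2 e e' t s E _ IH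
  |r p e E|r p e1 e2 e3 t1 t2 E _ IH1 _ IH2] /= lek tp rep.
- by eexists; [apply: go_last | apply: stay_represents].
- eexists.
    apply: go_step => //=; apply: go_last => //=.
  move=> i; rewrite /upd; case: eqP => [eqi|nei]; last first.
    by rewrite !apply_act_other //; apply: rep.
  rewrite !apply_act_same //=.
  have -> : inord r = i by apply: val_inj; rewrite /= inordK // eqi.
  rewrite ffunE; have := rep i; rewrite eqi.
  case: (tp i) => l x y [[il /= ->] [ir /= Er]].
  split; first by exists il.-1; case: (il).
  by exists ir; rewrite /= Er.
- eexists; first by apply: go_last.
  apply: (apply_represents (a := fun x => if x is None then (None, Stay) else (None, ToRight))) => //.
  case=> l x y [[il /= ->] [ir /= Er]].
  case: (e r) Er => [|b s] /= Er.
    case: ir Er => [//|ir] /= [-> ->]; split; first by exists il.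
    by exists ir.+1.
  case: Er => -> -> /=; split; first by exists il.+1.
  case: s => [|c s] /=; last by exists ir.
  by case: ir => [|ir]; [exists 1 | exists ir.+1].
- move: lek; rewrite geq_max => /andP[le1 le2].
  have [tp1 G1 R1] := IH1 le1 _ rep; have [tp2 G2 R2] := IH2 le2 _ R1.
  exists tp2 => //; apply: go_seq G1 G2.
- move: lek; rewrite !geq_max => /andP[ler /andP[le0 _]].
  have [|tp1 G1 R1] := IH le0 (apply_act tp (r, (scan tp (inord r), Stay))).
    exact: stay_represents.
  exists tp1 => //; apply: go_step => //=.
  by rewrite (scan_top rep ler) E /=; apply: go_if0; rewrite (scan_top rep ler) E in G1.
- move: lek; rewrite !geq_max => /and4P[ler _ le1 _].
  have [|tp1 G1 R1] := IH le1 (apply_act tp (r, (scan tp (inord r), Stay))).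
    exact: stay_represents.
  exists tp1 => //; apply: go_step => //=.
  by rewrite (scan_top rep ler) E /=; apply: go_if1; rewrite (scan_top rep ler) E in G1.
- move: lek; rewrite !geq_max => /and4P[ler _ _ le2].
  have [|tp1 G1 R1] := IH le2 (apply_act tp (r, (scan tp (inord r), Stay))).
    exact: stay_represents.
  exists tp1 => //; apply: go_step => //=.
  by rewrite (scan_top rep ler) E /=; apply: go_if2; rewrite (scan_top rep ler) E in G1.
- move: lek; rewrite !geq_max => /andP[ler _].
  eexists; last exact: stay_represents rep ler.
  by apply: go_last; rewrite /= (scan_top rep ler) E.
- have lek' := lek; move: lek; rewrite !geq_max => /andP[ler lep].
  have [|tp1 G1 R1] := IH1 lep (apply_act tp (r, (scan tp (inord r), Stay))).
    exact: stay_represents.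
  have [tp2 G2 R2] := IH2 lek' _ R1; exists tp2 => //.
  apply: go_step => //=; last first.
    by apply: go_while G2; eassumption.
  by rewrite (scan_top rep ler); case: (e1 r) E.
Qed.

Lemma go_steps p (x : pos p) (tp tp' : tapes_of (max_reg p)) t : go x tp t tp' ->
  iter t (@step (prog_machine p)) (@Config (prog_machine p) (Some x) tp) =
  @Config (prog_machine p) None tp'.
Proof.
elim=> {x tp t tp'} [x tp a E|x tp x' a t tp' E _ IH].
  by rewrite /= /step /= E.
by rewrite iterSr -IH /step /= E.
Qed.

Lemma iter_halting (M : machine) (cf : config M) t : halting (control cf) ->
  iter t (@step M) cf = cf.
Proof. by move=> H; elim: t => [//|t IH] /=; rewrite IH /step H. Qed.

Lemma leading_bits_stack (s : seq bool) i :
  leading_bits (map bit s ++ nseq i (None : sym)) = s.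
Proof. by elim: s => [|b s IH] /=; [case: i | rewrite IH]. Qed.

Lemma run_outputs p w e t T :
  run p (fun r => if r == 0 then w else [::]) e t -> t <= T ->
  outputs_within (prog_machine p) w (e 0) T.
Proof.
move=> R leT.
have rep0 : represents (tapes (init_config (prog_machine p) w))
    (fun r => if r == 0 then w else [::]).
  move=> i; rewrite /init_config /= -(inj_eq val_inj) /= /word_tape /tape_stack /=.
  split; first by exists 0.
  by case: (nat_of_ord i == 0); [case: w {R} => [|b w]; [exists 1 | exists 0; rewrite cats0] | exists 1].
have [tp' G R'] := run_go R (leqnn _) rep0.
have E := go_steps G.
rewrite /outputs_within -(subnK leT) iterD.
have -> : init_config (prog_machine p) w =
  @Config (prog_machine p) (Some (entry p)) (tapes (init_config (prog_machine p) w)) by [].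
rewrite E iter_halting //=; split=> //.
have [_ [i Ei]] := R' ord0.
change (leading_bits (scanned (tp' ord0) :: tape_right (tp' ord0)) = e 0).
by rewrite Ei leading_bits_stack.
Qed.

(** * Polynomial-time expressions *)

Definition runs_within (p : prog) (e e' : store) (T : nat) : Prop :=
  exists2 t, run p e e' t & t <= T.

Lemma rw_seq p q e1 e2 e3 t1 t2 T :
  runs_within p e1 e2 t1 -> runs_within q e2 e3 t2 -> t1 + t2 <= T ->
  runs_within (Seq p q) e1 e3 T.
Proof.
move=> [t Ht le1] [t' Ht' le2] leT; exists (t + t'); first exact: run_seq Ht Ht'.
by apply: leq_trans leT; apply: leq_add.
Qed.

Lemma rw_whileS r p e1 e2 e3 t1 t2 T : e1 r != [::] ->
  runs_within p e1 e2 t1 -> runs_within (While r p) e2 e3 t2 -> (t1 + t2).+1 <= T ->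
  runs_within (While r p) e1 e3 T.
Proof.
move=> ne [t Ht le1] [t' Ht' le2] leT.
exists (t + t').+1; first exact: run_whileS ne Ht Ht'.
by apply: leq_trans leT; rewrite ltnS; apply: leq_add.
Qed.

Lemma rw_le p e e' T T' : runs_within p e e' T -> T <= T' -> runs_within p e e' T'.
Proof. by move=> [t Ht le1] le2; exists t => //; apply: leq_trans le2. Qed.

Lemma rw_eq p e e1 e2 T : runs_within p e e1 T -> e1 = e2 -> runs_within p e e2 T.
Proof. by move=> H <-. Qed.

Lemma rw_pop r e : runs_within (Pop r) e (upd e r (behead (e r))) 1.
Proof. by exists 1 => //; apply: run_pop. Qed.

Lemma rw_push r b e : runs_within (Push r b) e (upd e r (b :: e r)) 2.
Proof. by exists 2 => //; apply: run_push. Qed.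

Lemma upd_id (e : store) r s : e r = s -> e = upd e r s.
Proof. by move=> <-; rewrite upd_same. Qed.

Ltac upd_cases :=
  rewrite /upd;
  repeat match goal with
  | |- context [@eq_op _ ?a ?b] =>
      let H := fresh "Hr" in
      case: (@eqP _ a b) => H; try (exfalso; lia); rewrite ?H
  end.

Ltac upd_ext :=
  let i := fresh "i" in
  apply: functional_extensionality => i; upd_cases => //=.

(** * Linear-time operations on stacks *)

Definition clear r := While r (Pop r).

Lemma rw_clear r e : runs_within (clear r) e (upd e r [::]) (2 * size (e r) + 1).
Proof.
move Es: (e r) => s; elim: s e Es => [|b s IH] e Es.
  by exists 1 => //; rewrite -(upd_id Es); apply: run_while0.
apply: rw_whileS; first by rewrite Es.
- exact: rw_pop.
- apply: rw_eq; first by apply: IH; rewrite /upd eqxx Es.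
  by upd_ext.
- rewrite /=; lia.
Qed.

Lemma rw_clear_eq r e e' T :
  e' = upd e r [::] -> 2 * size (e r) + 1 <= T -> runs_within (clear r) e e' T.
Proof. by move=> -> le; apply: rw_le le; apply: rw_clear. Qed.

(** The continuation [p] receives the moved bit, which [fork_stack] uses to duplicate it. *)
Definition move_top a p b2 :=
  IfTop a Skip (Seq (Pop a) (Seq (Push b2 true) (p true)))
    (Seq (Pop a) (Seq (Push b2 false) (p false))).

Definition move_stack a b := While a (move_top a (fun _ => Skip) b).

Definition fork_stack a b c := While a (move_top a (fun x => Push c x) b).

Lemma rw_move_top a p b e x s T e' : e a = x :: s ->
  runs_within (p x) (upd (upd e a s) b (x :: upd e a s b)) e' T ->
  runs_within (move_top a p b) e e' (T + 4).
Proof.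
move=> Ea [t Ht leT]; exists (1 + (2 + t)).+1; last by lia.
have Hp : run (Pop a) e (upd e a s) 1 by have := run_pop a e; rewrite Ea.
by case: x Ea Ht => Ea Ht; [apply: run_if1 Ea _ | apply: run_if2 Ea _];
  apply: run_seq Hp _; apply: run_seq Ht; apply: run_push.
Qed.

Lemma rw_move a b e e' T : a <> b ->
  e' = upd (upd e b (catrev (e a) (e b))) a [::] ->
  6 * size (e a) + 1 <= T -> runs_within (move_stack a b) e e' T.
Proof.
move=> ab -> leT; apply: rw_le leT; move Es: (e a) => s.
elim: s e Es => [|x s IH] e Es.
  exists 1 => //; rewrite (_ : upd _ a _ = e); first exact: run_while0.
  by upd_ext; congruence.
apply: rw_whileS; first by rewrite Es.
- apply: (rw_move_top (T := 1) Es); exists 1 => //; exact: run_skip.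
- apply: rw_eq; first by apply: IH; upd_cases.
  by upd_ext.
- rewrite /=; lia.
Qed.

Lemma rw_fork a b c e e' T : a <> b -> a <> c -> b <> c ->
  e' = upd (upd (upd e b (catrev (e a) (e b))) c (catrev (e a) (e c))) a [::] ->
  7 * size (e a) + 1 <= T -> runs_within (fork_stack a b c) e e' T.
Proof.
move=> ab ac bc -> leT; apply: rw_le leT; move Es: (e a) => s.
elim: s e Es => [|x s IH] e Es.
  exists 1 => //; rewrite (_ : upd _ a _ = e); first exact: run_while0.
  by upd_ext; congruence.
apply: rw_whileS; first by rewrite Es.
- apply: (rw_move_top (T := 2) Es); exact: rw_push.
- apply: rw_eq; first by apply: IH; upd_cases.
  by upd_ext.
- rewrite /=; lia.
Qed.

(** Moving a stack reverses it, so a copy passes through [t] and is reversed twice. *)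
Definition copy_stack a b t := Seq (move_stack a t) (fork_stack t a b).

Lemma catrev2 (T : Type) (s u : seq T) : catrev (catrev s [::]) u = s ++ u.
Proof. by rewrite !catrevE cats0 revK. Qed.

Lemma size_catrev (T : Type) (s u : seq T) : size (catrev s u) = size s + size u.
Proof. by rewrite catrevE size_cat size_rev. Qed.

Lemma rw_copy a b t e e' T : a <> b -> a <> t -> b <> t -> e t = [::] ->
  e' = upd e b (e a ++ e b) ->
  13 * size (e a) + 2 <= T -> runs_within (copy_stack a b t) e e' T.
Proof.
move=> ab a_t bt Et -> leT.
apply: rw_seq; first by apply: (rw_move a_t (erefl _) (leqnn _)).
  apply: rw_fork; try congruence; last exact: leqnn.
  by upd_ext; rewrite ?Et ?catrev2 ?cats0 //.
upd_cases; rewrite Et size_catrev /=; lia.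
Qed.

Definition transfer a t b := Seq (move_stack a t) (move_stack t b).

Lemma rw_transfer a t b e e' T : a <> b -> a <> t -> t <> b -> e t = [::] ->
  e' = upd (upd e b (e a ++ e b)) a [::] ->
  12 * size (e a) + 2 <= T -> runs_within (transfer a t b) e e' T.
Proof.
move=> ab a_t bt Et -> leT.
apply: rw_seq; first by apply: (rw_move a_t (erefl _) (leqnn _)).
  apply: rw_move; try congruence; last exact: leqnn.
  by upd_ext; rewrite ?Et ?catrev2 ?cats0 //.
upd_cases; rewrite Et size_catrev /=; lia.
Qed.

Definition drop_stack c s := While c (Seq (Pop c) (Pop s)).

Lemma rw_drop c s e e' T : c <> s ->
  e' = upd (upd e s (drop (size (e c)) (e s))) c [::] ->
  3 * size (e c) + 1 <= T -> runs_within (drop_stack c s) e e' T.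
Proof.
move=> cs -> leT; apply: rw_le leT; move Es: (e c) => u.
elim: u e Es => [|x u IH] e Es.
  exists 1 => //; rewrite (_ : upd _ c _ = e); first exact: run_while0.
  by upd_ext; rewrite ?drop0 //; congruence.
apply: rw_whileS; first by rewrite Es.
- apply: rw_seq (leqnn _); exact: rw_pop.
- apply: rw_eq; first by apply: IH; upd_cases; rewrite Es.
  by upd_ext; case: (e s).
- rewrite /=; lia.
Qed.

(** The stack [c] is a unary counter. This operation cuts the accumulator of a [Fold] to the length
    of its initial value. *)
Definition clip_stack c s t := While c (Seq (Pop c) (move_top s (fun _ => Skip) t)).

Lemma rw_clip c s t e e' T : c <> s -> c <> t -> s <> t ->
  e' = upd (upd (upd e t (catrev (take (size (e c)) (e s)) (e t)))
         s (drop (size (e c)) (e s))) c [::] ->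
  7 * size (e c) + 1 <= T -> runs_within (clip_stack c s t) e e' T.
Proof.
move=> cs ct st -> leT; apply: rw_le leT; move Es: (e c) => u.
elim: u e Es => [|x u IH] e Es.
  exists 1 => //; rewrite (_ : upd _ c _ = e); first exact: run_while0.
  by upd_ext; rewrite ?drop0 ?take0 //; congruence.
case Ev: (e s) => [|y v].
  apply: rw_whileS; first by rewrite Es.
  - apply: rw_seq; first exact: rw_pop.
      by exists 2 => //; apply: run_if0; [upd_cases | apply: run_skip].
    exact: leqnn.
  - apply: rw_eq; first by apply: IH; upd_cases; rewrite Es.
    by upd_ext; rewrite ?Ev.
  - rewrite /=; lia.
apply: rw_whileS; first by rewrite Es.
- apply: rw_seq; first exact: rw_pop.
    apply: (rw_move_top (x := y) (s := v) (T := 1)); first by upd_cases.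
    by exists 1 => //; apply: run_skip.
  exact: leqnn.
- apply: rw_eq; first by apply: IH; upd_cases; rewrite Es.
  by upd_ext.
- rewrite /=; lia.
Qed.

(** * The expression language and its compiler *)

Inductive expr :=
| Var (i : nat)
| Nil
| Cons (b : bool) (e : expr)
| Tail (e : expr)
| Case (e e0 e1 e2 : expr)
| Cat (e1 e2 : expr)
| Drop (e1 e2 : expr)
| Let (e1 e2 : expr)
| Call (f a b c : expr)
| FlatMap (e1 e2 : expr)
| Fold (e1 e0 e2 : expr).

Fixpoint flatmap_suffixes (F : seq bool -> seq bool -> seq bool)
    (v p : seq bool) : seq bool :=
  if v is x :: v' then F v p ++ flatmap_suffixes F v' (x :: p) else [::].

(** In [eval] the function [F] cuts each new accumulator to the length of the initial one. Without
    the cut, an iteration could double a word in every round and leave polynomial time.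
    [flatmap_suffixes] needs no cut, since its body does not see the output produced so far. *)
Fixpoint fold_suffixes (F : seq bool -> seq bool -> seq bool)
    (v a : seq bool) : seq bool :=
  if v is x :: v' then fold_suffixes F v' (F v a) else a.

(* Variables are de Bruijn levels; [Call] evaluates a function body in the
   environment made of its three arguments only; the two variables bound by
   [FlatMap] are the current suffix and the reversed prefix before it. *)
Fixpoint eval (env : seq (seq bool)) (x : expr) : seq bool :=
  match x with
  | Var i => nth [::] env i
  | Nil => [::]
  | Cons b e => b :: eval env e
  | Tail e => behead (eval env e)
  | Case e e0 e1 e2 =>
      match eval env e with
      | [::] => eval env e0
      | true :: _ => eval env e1
      | false :: _ => eval env e2
      end
  | Cat e1 e2 => eval env e1 ++ eval env e2
  | Drop e1 e2 => drop (size (eval env e1)) (eval env e2)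
  | Let e1 e2 => eval (rcons env (eval env e1)) e2
  | Call f a b c => eval [:: eval env a; eval env b; eval env c] f
  | FlatMap e1 e2 =>
      flatmap_suffixes (fun s p => eval (env ++ [:: s; p]) e2) (eval env e1) [::]
  | Fold e1 e0 e2 =>
      let a0 := eval env e0 in
      fold_suffixes (fun s a => take (size a0) (eval (env ++ [:: s; a]) e2))
        (eval env e1) a0
  end.

(** The variables live in the registers [vs], all below [d]. The value is left in register [d]; the
    registers from [d] on are scratch space, empty before, and empty again afterwards except for
    [d]. [Fold] evaluates [e0] twice, once as the accumulator and once as a length to be kept. *)
Fixpoint comp (x : expr) (vs : seq nat) (d : nat) : prog :=
  match x with
  | Var i => if i < size vs then copy_stack (nth 0 vs i) d d.+1 else Skip
  | Nil => Skip
  | Cons b e => Seq (comp e vs d) (Push d b)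
  | Tail e => Seq (comp e vs d) (Pop d)
  | Case e e0 e1 e2 =>
      Seq (comp e vs d)
        (IfTop d (comp e0 vs d) (Seq (clear d) (comp e1 vs d))
           (Seq (clear d) (comp e2 vs d)))
  | Cat e1 e2 =>
      Seq (comp e2 vs d) (Seq (comp e1 vs d.+1) (transfer d.+1 d.+2 d))
  | Drop e1 e2 =>
      Seq (comp e2 vs d) (Seq (comp e1 vs d.+1) (drop_stack d.+1 d))
  | Let e1 e2 =>
      Seq (comp e1 vs d)
        (Seq (comp e2 (rcons vs d) d.+1)
           (Seq (clear d) (transfer d.+1 d.+2 d)))
  | Call f a b c =>
      Seq (comp a vs d.+1) (Seq (comp b vs d.+2) (Seq (comp c vs d.+3)
        (Seq (comp f [:: d.+1; d.+2; d.+3] d.+4)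
          (Seq (clear d.+1) (Seq (clear d.+2) (Seq (clear d.+3)
            (transfer d.+4 d.+1 d)))))))
  | FlatMap e1 e2 =>
      Seq (comp e1 vs d.+1)
        (Seq (While d.+1
               (Seq (comp e2 (vs ++ [:: d.+1; d.+2]) d.+4)
                  (Seq (move_stack d.+4 d.+3)
                     (move_top d.+1 (fun _ => Skip) d.+2))))
           (Seq (clear d.+2) (move_stack d.+3 d)))
  | Fold e1 e0 e2 =>
      Seq (comp e1 vs d.+1) (Seq (comp e0 vs d.+2) (Seq (comp e0 vs d.+3)
        (Seq (While d.+1
               (Seq (comp e2 (vs ++ [:: d.+1; d.+3]) d.+4)
                 (Seq (clear d.+3) (Seq (copy_stack d.+2 (4 + d.+1) (5 + d.+1))
                   (Seq (clip_stack (4 + d.+1) d.+4 (5 + d.+1))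
                     (Seq (clear d.+4) (Seq (move_stack (5 + d.+1) d.+3)
                       (Pop d.+1))))))))
           (Seq (clear d.+2) (transfer d.+3 d.+4 d)))))
  end.

(** The base is at least 2, so sums and constants are absorbed by the exponent. Composition needs no
    monotone [f], because the bounding power is monotone. *)
Definition poly_bounded (f : nat -> nat) : Prop :=
  exists k, forall N, f N <= (N + 2) ^ k.

Lemma poly_const c : poly_bounded (fun _ => c).
Proof.
exists c => N; elim: c => [//|c IH]; rewrite expnS.
have : 0 < (N + 2) ^ c by rewrite expn_gt0 addn2.
move: (_ ^ _) IH => X; nia.
Qed.

Lemma poly_id : poly_bounded (fun N => N).
Proof. by exists 1 => N; rewrite expn1 leq_addr. Qed.

Lemma poly_add f g : poly_bounded f -> poly_bounded g ->
  poly_bounded (fun N => f N + g N).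
Proof.
move=> [k Hk] [l Hl]; exists (k + l).+1 => N.
apply: leq_trans (leq_add (Hk N) (Hl N)) _; rewrite expnS.
have le1 : (N + 2) ^ k <= (N + 2) ^ (k + l) by rewrite leq_pexp2l ?leq_addr //; lia.
have le2 : (N + 2) ^ l <= (N + 2) ^ (k + l) by rewrite leq_pexp2l ?leq_addl //; lia.
apply: leq_trans (leq_add le1 le2) _; rewrite addnn -mul2n leq_mul2r; lia.
Qed.

Lemma poly_mul f g : poly_bounded f -> poly_bounded g ->
  poly_bounded (fun N => f N * g N).
Proof.
by move=> [k Hk] [l Hl]; exists (k + l) => N; rewrite expnD; apply: leq_mul.
Qed.

Lemma poly_comp f g : poly_bounded f -> poly_bounded g ->
  poly_bounded (fun N => f (g N)).
Proof.
move=> [k Hk] /(fun Hg => poly_add Hg (poly_const 2)) [l Hl].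
exists (l * k) => N; apply: leq_trans (Hk _) _; rewrite expnM.
by case: k {Hk} => // k; rewrite leq_exp2r.
Qed.

Ltac poly := repeat first
  [ apply: poly_add | apply: poly_mul | apply: poly_const | apply: poly_id
  | assumption | apply: poly_comp ].

(** One function bounds both the running time and the length of the value. It must do so for every
    [N], so that a body can be run with the larger bound that covers its freshly bound variables. *)
Definition comp_spec (x : expr) (f : nat -> nat) : Prop :=
  forall vs d (e : store) N, all (fun r => r < d) vs ->
    (forall r, d <= r -> e r = [::]) ->
    (forall r, r \in vs -> size (e r) <= N) ->
    runs_within (comp x vs d) e (upd e d (eval (map e vs) x)) (f N) /\
    size (eval (map e vs) x) <= f N.

(** Serves to evaluate a subexpression above registers that already hold intermediate results. *)
Lemma comp_spec_at x f vs d d' (e e' : store) N : comp_spec x f ->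
  all (fun r => r < d) vs -> d <= d' ->
  (forall r, d' <= r -> e' r = [::]) -> (forall r, r < d -> e' r = e r) ->
  (forall r, r \in vs -> size (e r) <= N) ->
  runs_within (comp x vs d') e' (upd e' d' (eval (map e vs) x)) (f N) /\
  size (eval (map e vs) x) <= f N.
Proof.
move=> spec lt_vs led emp same bnd.
have Em : map e' vs = map e vs.
  by apply/eq_in_map => r /(allP lt_vs) /same.
rewrite -Em; apply: spec => //.
  by apply: sub_all lt_vs => r /leq_trans; apply.
by move=> r rin; rewrite same ?bnd // (allP lt_vs).
Qed.

Lemma comp_var i : comp_spec (Var i) (fun N => 13 * N + 2).
Proof.
move=> vs d e N lt_vs emp bnd /=; case: ltnP => ltis.
  have rin := mem_nth 0 ltis; have := allP lt_vs _ rin => /= ltr.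
  rewrite (nth_map 0) //; set r := nth 0 vs i in rin ltr *.
  have le := bnd _ rin; split; last by lia.
  apply: rw_copy; try lia; first exact: emp.
  by rewrite [e d]emp // cats0.
rewrite nth_default ?size_map //; split; last by rewrite /=; lia.
by exists 1; [rewrite -(upd_id (emp _ (leqnn d))); apply: run_skip | lia].
Qed.

Lemma comp_nil : comp_spec Nil (fun=> 1).
Proof.
move=> vs d e N lt_vs emp bnd /=; split=> //.
by exists 1; [rewrite -(upd_id (emp _ (leqnn d))); apply: run_skip | lia].
Qed.

Lemma comp_cons b x f : comp_spec x f -> comp_spec (Cons b x) (fun N => f N + 2).
Proof.
move=> sx vs d e N lt_vs emp bnd /=.
have [R S] := sx _ _ _ _ lt_vs emp bnd; split; last by lia.
apply: rw_seq R _ (leqnn _); apply: rw_eq; first exact: rw_push.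
by upd_ext.
Qed.

Lemma comp_tail x f : comp_spec x f -> comp_spec (Tail x) (fun N => f N + 1).
Proof.
move=> sx vs d e N lt_vs emp bnd /=.
have [R S] := sx _ _ _ _ lt_vs emp bnd; split; last by rewrite size_behead; lia.
apply: rw_seq R _ (leqnn _); apply: rw_eq; first exact: rw_pop.
by upd_ext.
Qed.

Ltac emp_tac emp :=
  let r := fresh "r" in let Hr := fresh "Hr" in
  move=> r Hr; upd_cases; rewrite ?emp //; lia.

Lemma comp_case x x0 x1 x2 f f0 f1 f2 :
  comp_spec x f -> comp_spec x0 f0 -> comp_spec x1 f1 -> comp_spec x2 f2 ->
  comp_spec (Case x x0 x1 x2) (fun N => f N * 3 + f0 N + f1 N + f2 N + 3).
Proof.
move=> s s0 s1 s2 vs d e N lt_vs emp bnd /=.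
have [R S] := s _ _ _ _ lt_vs emp bnd.
case Ev: (eval (map e vs) x) R S => [|[] v] R S.
- have [R0 S0] := s0 _ _ _ _ lt_vs emp bnd; split; last by lia.
  apply: (rw_seq (t2 := f0 N + 1)) R _ _; last by lia.
  rewrite -(upd_id (emp _ (leqnn d))); case: R0 => t Ht le.
  by exists t.+1; [apply: run_if0 Ht; rewrite emp | lia].
- have [R1 S1] := s1 _ _ _ _ lt_vs emp bnd; split; last by lia.
  apply: (rw_seq (t2 := 2 * f N + 2 + f1 N)) R _ _; last by lia.
  have [t Ht le] : runs_within (Seq (clear d) (comp x1 vs d))
    (upd e d (true :: v)) (upd e d (eval (map e vs) x1)) (2 * f N + 1 + f1 N).
    apply: (rw_seq (t1 := 2 * f N + 1) (t2 := f1 N)) R1 _ => //.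
    apply: rw_clear_eq; last by upd_cases; lia.
    by upd_ext; rewrite ?emp.
  by exists t.+1; [apply: (@run_if1 _ _ _ _ _ _ _ v _ Ht); rewrite /upd eqxx | lia].
- have [R1 S1] := s2 _ _ _ _ lt_vs emp bnd; split; last by lia.
  apply: (rw_seq (t2 := 2 * f N + 2 + f2 N)) R _ _; last by lia.
  have [t Ht le] : runs_within (Seq (clear d) (comp x2 vs d))
    (upd e d (false :: v)) (upd e d (eval (map e vs) x2)) (2 * f N + 1 + f2 N).
    apply: (rw_seq (t1 := 2 * f N + 1) (t2 := f2 N)) R1 _ => //.
    apply: rw_clear_eq; last by upd_cases; lia.
    by upd_ext; rewrite ?emp.
  by exists t.+1; [apply: (@run_if2 _ _ _ _ _ _ _ v _ Ht); rewrite /upd eqxx | lia].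
Qed.

Lemma comp_cat x1 x2 f1 f2 : comp_spec x1 f1 -> comp_spec x2 f2 ->
  comp_spec (Cat x1 x2) (fun N => f1 N * 13 + f2 N + 2).
Proof.
move=> s1 s2 vs d e N lt_vs emp bnd /=.
have [R2 S2] := s2 _ _ _ _ lt_vs emp bnd.
have [||R1 S1] := @comp_spec_at _ _ vs d d.+1 e
  (upd e d (eval (map e vs) x2)) N s1 lt_vs (leqnSn d) _ _ bnd.
- by emp_tac emp.
- by move=> r Hr; upd_cases.
split; last by rewrite size_cat; lia.
apply: rw_seq R2 _ _; last first.
  apply: leq_trans (_ : f2 N + (f1 N + (12 * f1 N + 2)) <= _); [exact: leqnn | lia].
apply: rw_seq R1 _ (leqnn _); apply: rw_transfer; try lia.
- by upd_cases; apply: emp; lia.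
- by upd_ext; rewrite emp.
- by upd_cases; lia.
Qed.

Lemma comp_drop x1 x2 f1 f2 : comp_spec x1 f1 -> comp_spec x2 f2 ->
  comp_spec (Drop x1 x2) (fun N => f1 N * 4 + f2 N + 1).
Proof.
move=> s1 s2 vs d e N lt_vs emp bnd /=.
have [R2 S2] := s2 _ _ _ _ lt_vs emp bnd.
have [||R1 S1] := @comp_spec_at _ _ vs d d.+1 e
  (upd e d (eval (map e vs) x2)) N s1 lt_vs (leqnSn d) _ _ bnd.
- by emp_tac emp.
- by move=> r Hr; upd_cases.
split; last by rewrite size_drop; lia.
apply: rw_seq R2 _ _; last first.
  apply: leq_trans (_ : f2 N + (f1 N + (3 * f1 N + 1)) <= _); [exact: leqnn | lia].
apply: rw_seq R1 _ (leqnn _); apply: rw_drop; try lia.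
- by upd_ext; rewrite emp.
- by upd_cases; lia.
Qed.

Lemma map_upd_fresh vs d (e : store) r s : all (fun r => r < d) vs -> d <= r ->
  map (upd e r s) vs = map e vs.
Proof.
move=> lt_vs le; apply/eq_in_map => i /(allP lt_vs) /= lti.
by rewrite /upd; case: eqP => //; lia.
Qed.

Lemma comp_let x1 x2 f1 f2 : comp_spec x1 f1 -> comp_spec x2 f2 ->
  comp_spec (Let x1 x2) (fun N => f1 N * 3 + f2 (N + f1 N) * 13 + 3).
Proof.
move=> s1 s2 vs d e N lt_vs emp bnd /=.
have [R1 S1] := s1 _ _ _ _ lt_vs emp bnd.
set v1 := eval (map e vs) x1 in R1 S1 *.
have Em : map (upd e d v1) (rcons vs d) = rcons (map e vs) v1.
  by rewrite map_rcons (map_upd_fresh _ _ lt_vs) // /upd eqxx.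
have [|||R2 S2] := s2 (rcons vs d) d.+1 (upd e d v1) (N + f1 N).
- by rewrite all_rcons ltnSn; apply: sub_all lt_vs => r; lia.
- by emp_tac emp.
- move=> r; rewrite mem_rcons inE => /predU1P[->|rin].
    by rewrite /upd eqxx; lia.
  have := allP lt_vs _ rin => /= ltr; upd_cases.
  by apply: leq_trans (bnd _ rin) _; lia.
rewrite Em in R2 S2; set v2 := eval _ x2 in R2 S2 *.
split; last by lia.
apply: (rw_seq R1 _ (t2 := 2 * f1 N + 13 * f2 (N + f1 N) + 3)); last by lia.
apply: (rw_seq R2 _ (t2 := 2 * f1 N + 12 * f2 (N + f1 N) + 3)); last by lia.
apply: (rw_seq (t1 := 2 * f1 N + 1) (t2 := 12 * f2 (N + f1 N) + 2)); last by lia.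
- by apply: (rw_clear_eq (erefl _)); upd_cases; lia.
apply: rw_transfer; try lia.
- by upd_cases; apply: emp; lia.
- by upd_ext; rewrite ?cats0 ?emp.
- by upd_cases; lia.
Qed.

Lemma comp_call x a b c f fa fb fc :
  comp_spec x f -> comp_spec a fa -> comp_spec b fb -> comp_spec c fc ->
  comp_spec (Call x a b c) (fun N =>
     3 * (fa N + fb N + fc N) + 13 * f (fa N + fb N + fc N) + 5).
Proof.
move=> s sa sb sc vs d e N lt_vs emp bnd /=.
have [||Ra Sa] := @comp_spec_at _ _ vs d d.+1 e e N sa lt_vs (leqnSn d) _ _ bnd.
- by move=> r Hr; apply: emp; lia.
- by [].
set va := eval _ a in Ra Sa *.
have [|||Rb Sb] := @comp_spec_at _ _ vs d d.+2 e (upd e d.+1 va) N sb lt_vs _ _ _ bnd.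
- lia.
- by emp_tac emp.
- by move=> r Hr; upd_cases.
set vb := eval _ b in Rb Sb *.
have [|||Rc Sc] := @comp_spec_at _ _ vs d d.+3 e (upd (upd e d.+1 va) d.+2 vb)
  N sc lt_vs _ _ _ bnd.
- lia.
- by emp_tac emp.
- by move=> r Hr; upd_cases.
set vc := eval _ c in Rc Sc *.
set M := fa N + fb N + fc N.
have [|||R S] := s [:: d.+1; d.+2; d.+3] d.+4
   (upd (upd (upd e d.+1 va) d.+2 vb) d.+3 vc) M.
- by rewrite /= !ltnS; lia.
- by emp_tac emp.
- by move=> r; rewrite !inE => /or3P[] /eqP->; upd_cases; rewrite /M; lia.
have Em : map (upd (upd (upd e d.+1 va) d.+2 vb) d.+3 vc) [:: d.+1; d.+2; d.+3]
   = [:: va; vb; vc].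
  by rewrite /=; upd_cases.
rewrite Em in R S; set v := eval _ x in R S *.
split; last by lia.
apply: (rw_seq Ra _ (t2 := 3 * M - fa N + 13 * f M + 5)); last by rewrite -/M /M; lia.
apply: (rw_seq Rb _ (t2 := 2 * M + fc N + 13 * f M + 5)); last by rewrite /M; lia.
apply: (rw_seq Rc _ (t2 := 2 * M + 13 * f M + 5)); last by lia.
apply: (rw_seq R _ (t2 := 2 * M + 12 * f M + 5)); last by lia.
apply: (rw_seq (t1 := 2 * fa N + 1) (t2 := 2 * (fb N + fc N) + 12 * f M + 4));
  last by rewrite /M; lia.
  by apply: (rw_clear_eq (erefl _)); upd_cases; lia.
apply: (rw_seq (t1 := 2 * fb N + 1) (t2 := 2 * fc N + 12 * f M + 3)); last by lia.
  by apply: (rw_clear_eq (erefl _)); upd_cases; lia.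
apply: (rw_seq (t1 := 2 * fc N + 1) (t2 := 12 * f M + 2)); last by lia.
  by apply: (rw_clear_eq (erefl _)); upd_cases; lia.
apply: rw_transfer; try lia.
- by upd_cases.
- by upd_ext; rewrite ?(emp d) ?cats0 ?emp //; lia.
- by upd_cases; lia.
Qed.

Lemma map_cat2 vs d (e e' : store) r1 r2 : all (fun r => r < d) vs ->
  (forall r, r < d -> e' r = e r) ->
  map e' (vs ++ [:: r1; r2]) = map e vs ++ [:: e' r1; e' r2].
Proof.
move=> lt_vs same; rewrite map_cat /=; congr (_ ++ _).
by apply/eq_in_map => r /(allP lt_vs) /same.
Qed.

(** The loop invariant: [d.+1], [d.+2] and [d.+3] hold the current suffix, the reversed prefix and
    the reversed output. The lengths of suffix and prefix have a constant sum, which one [M] bounds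
    throughout. *)
Lemma flatmap_loop x f vs d (e : store) N M : comp_spec x f ->
  all (fun r => r < d) vs -> (forall r, r \in vs -> size (e r) <= N) ->
  forall v p a (e' : store), (forall r, r < d -> e' r = e r) ->
  e' d.+1 = v -> e' d.+2 = p -> e' d.+3 = a ->
  (forall r, d.+4 <= r -> e' r = [::]) -> size v + size p <= M ->
  let F := fun s p => eval (map e vs ++ [:: s; p]) x in
  runs_within (While d.+1 (Seq (comp x (vs ++ [:: d.+1; d.+2]) d.+4)
        (Seq (move_stack d.+4 d.+3) (move_top d.+1 (fun _ => Skip) d.+2)))) e'
    (upd (upd (upd e' d.+1 [::]) d.+2 (catrev v p))
       d.+3 (catrev (flatmap_suffixes F v p) a))
    (size v * (7 * f (N + M) + 8) + 1) /\
  size (flatmap_suffixes F v p) <= size v * f (N + M).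
Proof.
move=> sx lt_vs bnd; elim=> [|y v IH] p a e' same Ev Ep Ea emp leM F /=.
  split=> //; exists 1 => //; rewrite (_ : upd _ _ _ = e'); first exact: run_while0.
  by upd_ext.
have [|||R S] := sx (vs ++ [:: d.+1; d.+2]) d.+4 e' (N + M).
- rewrite all_cat /= andbT; apply/andP; split; last by lia.
  by apply: sub_all lt_vs => r; lia.
- exact: emp.
- move=> r; rewrite mem_cat !inE => /or3P[rin|/eqP->|/eqP->].
  + by rewrite same ?(allP lt_vs) //; apply: leq_trans (bnd _ rin) _; lia.
  + by rewrite Ev; move: leM; rewrite /=; lia.
  + by rewrite Ep; move: leM; rewrite /=; lia.
rewrite (map_cat2 _ _ lt_vs same) Ev Ep in R S.
set u := eval _ x in R S; have Eu : F (y :: v) p = u by [].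
set e1 := upd (upd (upd e' d.+1 v) d.+2 (y :: p)) d.+3 (catrev u a).
have [|||||| IHr IHs] := IH (y :: p) (catrev u a) e1.
- by move=> r Hr; rewrite /e1; upd_cases; apply: same.
- by rewrite /e1; upd_cases.
- by rewrite /e1; upd_cases.
- by rewrite /e1; upd_cases.
- by move=> r Hr; rewrite /e1; upd_cases; apply: emp.
- by move: leM; rewrite /=; lia.
split; last by rewrite size_cat Eu mulSn; apply: leq_add.
apply: (rw_whileS (t1 := 7 * f (N + M) + 7)); first by rewrite Ev.
- apply: (rw_seq R _ (t2 := 6 * f (N + M) + 1 + 6)); last by lia.
  apply: (rw_seq (t1 := 6 * f (N + M) + 1) (t2 := 5)); last by lia.
    apply: (@rw_move d.+4 d.+3); [lia | by [] | by upd_cases; lia].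
  apply: (rw_move_top (x := y) (s := v) (T := 1)); first by upd_cases.
  exists 1 => //; rewrite (_ : upd _ d.+2 _ = e1); first exact: run_skip.
  by rewrite /e1; upd_ext; rewrite ?Ea ?Ep // emp.
- apply: rw_eq; first exact: IHr.
  by rewrite Eu catrev_catl /e1; upd_ext.
- by rewrite mulSn; lia.
Qed.

Lemma comp_flatmap x1 x2 f1 f2 : comp_spec x1 f1 -> comp_spec x2 f2 ->
  comp_spec (FlatMap x1 x2) (fun N =>
    f1 N * (14 * f2 (N + f1 N) + 20) + 10 + f1 N).
Proof.
move=> s1 s2 vs d e N lt_vs emp bnd /=.
have [||R1 S1] := @comp_spec_at _ _ vs d d.+1 e e N s1 lt_vs (leqnSn d) _ _ bnd.
- by move=> r Hr; apply: emp; lia.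
- by [].
set v := eval _ x1 in R1 S1 *.
have [|||||| R2 S2] := @flatmap_loop x2 f2 vs d e N (f1 N) s2 lt_vs bnd v [::] [::]
  (upd e d.+1 v).
- by move=> r Hr; upd_cases.
- by upd_cases.
- by upd_cases; apply: emp; lia.
- by upd_cases; apply: emp; lia.
- by emp_tac emp.
- by rewrite addn0.
set u := flatmap_suffixes _ _ _ in R2 S2 *.
set B := f2 (N + f1 N) in R2 S2 *.
have leu : size u <= f1 N * B by apply: leq_trans S2 _; rewrite leq_mul2r S1 orbT.
have let2 : size v * (7 * B + 8) + 1 <= f1 N * (7 * B + 8) + 1.
  by rewrite leq_add2r leq_mul2r S1 orbT.
split; last by nia.
apply: (rw_seq R1 _ (t2 := f1 N * (7 * B + 8) + 1 + (2 * f1 N + 1 + (6 * (f1 N * B) + 1)))).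
  apply: (rw_seq (rw_le R2 let2) _ (t2 := 2 * f1 N + 1 + (6 * (f1 N * B) + 1))); last by [].
  apply: (rw_seq (t1 := 2 * f1 N + 1) (t2 := 6 * (f1 N * B) + 1)); last by [].
    by apply: (rw_clear_eq (erefl _)); upd_cases; rewrite size_catrev addn0; lia.
  apply: rw_move; first by lia.
  - upd_ext; rewrite ?catrev2 ?(emp d) ?cats0 ?emp //; lia.
  - by upd_cases; rewrite size_catrev addn0; lia.
nia.
Qed.

(** Clipping maintains [size a <= size b], so every round runs the body on words of length at most
    [N]. Register [d.+2] keeps [b] for its length only. *)
Lemma fold_loop x f vs d (e : store) N b : comp_spec x f ->
  all (fun r => r < d) vs -> (forall r, r \in vs -> size (e r) <= N) ->
  forall v a (e' : store), (forall r, r < d -> e' r = e r) ->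
  e' d.+1 = v -> e' d.+2 = b -> e' d.+3 = a ->
  (forall r, d.+4 <= r -> e' r = [::]) -> size v <= N -> size b <= N ->
  size a <= size b ->
  let F := fun s a => take (size b) (eval (map e vs ++ [:: s; a]) x) in
  runs_within (While d.+1 (Seq (comp x (vs ++ [:: d.+1; d.+3]) d.+4)
                 (Seq (clear d.+3) (Seq (copy_stack d.+2 (4 + d.+1) (5 + d.+1))
                   (Seq (clip_stack (4 + d.+1) d.+4 (5 + d.+1))
                     (Seq (clear d.+4) (Seq (move_stack (5 + d.+1) d.+3)
                       (Pop d.+1)))))))) e'
    (upd (upd e' d.+1 [::]) d.+3 (fold_suffixes F v a))
    (size v * (3 * f N + 28 * N + 10) + 1) /\
  size (fold_suffixes F v a) <= size b.
Proof.
move=> sx lt_vs bnd; elim=> [|y v IH] a e' same Ev Eb Ea emp lev leb lea F /=.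
  split=> //; exists 1 => //; rewrite (_ : upd _ _ _ = e'); first exact: run_while0.
  by upd_ext.
have [|||R S] := sx (vs ++ [:: d.+1; d.+3]) d.+4 e' N.
- rewrite all_cat /= andbT; apply/andP; split; last by lia.
  by apply: sub_all lt_vs => r; lia.
- exact: emp.
- move=> r; rewrite mem_cat !inE => /or3P[rin|/eqP->|/eqP->].
  + by rewrite same ?(allP lt_vs) //; apply: bnd.
  + by rewrite Ev.
  + by rewrite Ea; lia.
rewrite (map_cat2 _ _ lt_vs same) Ev Ea in R S.
set u := eval _ x in R S; have Eu : F (y :: v) a = take (size b) u by [].
have letk : size (take (size b) u) <= size b by rewrite size_take; case: ltnP; lia.
set e1 := upd (upd e' d.+1 v) d.+3 (take (size b) u).
have [|||||||| IHr IHs] := IH (take (size b) u) e1.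
- by move=> r Hr; rewrite /e1; upd_cases; apply: same.
- by rewrite /e1; upd_cases.
- by rewrite /e1; upd_cases.
- by rewrite /e1; upd_cases.
- by move=> r Hr; rewrite /e1; upd_cases; apply: emp.
- by move: lev; rewrite /=; lia.
- by [].
- by [].
split; last by rewrite Eu.
(* 28 = 2 + 13 + 7 + 6 for clearing, copying, clipping and moving; 3 = 1 + 2 for running the body
   and clearing what is left of its value. *)
apply: (rw_whileS (e2 := e1) (t1 := 3 * f N + 28 * N + 9)); first by rewrite Ev.
- apply: (rw_seq R _ (t2 := 2 * N + 1 + (13 * N + 2 + (7 * N + 1 + (2 * f N + 1 + (6 * N + 1 + 1)))))); last by lia.
  apply: (rw_seq (t1 := 2 * N + 1)); last exact: leqnn.
    by apply: (rw_clear_eq (erefl _)); upd_cases; rewrite ?Ea; lia.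
  apply: (rw_seq (t1 := 13 * N + 2)); last exact: leqnn.
    apply: (@rw_copy d.+2 (4 + d.+1) (5 + d.+1)); try lia.
    + by upd_cases; apply: emp; lia.
    + by [].
    + by upd_cases; rewrite Eb; lia.
  apply: (rw_seq (t1 := 7 * N + 1)); last exact: leqnn.
    apply: (@rw_clip (4 + d.+1) d.+4 (5 + d.+1)); try lia.
    + by [].
    + by upd_cases; rewrite Eb emp ?cats0; lia.
  apply: (rw_seq (t1 := 2 * f N + 1)); last exact: leqnn.
    by apply: (rw_clear_eq (erefl _)); upd_cases; rewrite size_drop; lia.
  have E45 : e' (4 + d.+1) = [::] by apply: emp; lia.
  have E5 : e' (5 + d.+1) = [::] by apply: emp; lia.
  apply: (rw_seq (t1 := 6 * N + 1)); last exact: leqnn.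
    apply: (@rw_move (5 + d.+1) d.+3); [lia | by [] |].
    by upd_cases; rewrite size_catrev Eb E45 cats0 E5 addn0; lia.
  apply: rw_eq; first exact: rw_pop.
  rewrite /e1; upd_ext; rewrite ?Ev ?Ea ?Ep ?Eb ?E45 ?E5 ?cats0 ?catrev2 ?cats0 //; rewrite emp //; lia.
- apply: rw_eq; first exact: IHr.
  by rewrite Eu /e1; upd_ext.
- by rewrite mulSn; lia.
Qed.

Lemma comp_fold x1 x0 x2 f1 f0 f2 :
  comp_spec x1 f1 -> comp_spec x0 f0 -> comp_spec x2 f2 ->
  comp_spec (Fold x1 x0 x2) (fun N => let M := N + f1 N + f0 N in
    f1 N * (3 * f2 M + 28 * M + 10) + f1 N + 17 * f0 N + 10).
Proof.
move=> s1 s0 s2 vs d e N lt_vs emp bnd /=.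
set M := N + f1 N + f0 N.
have [||R1 S1] := @comp_spec_at _ _ vs d d.+1 e e N s1 lt_vs (leqnSn d) _ _ bnd.
- by move=> r Hr; apply: emp; lia.
- by [].
set v := eval _ x1 in R1 S1 *.
have [|||R2 S2] := @comp_spec_at _ _ vs d d.+2 e (upd e d.+1 v) N s0 lt_vs _ _ _ bnd.
- lia.
- by emp_tac emp.
- by move=> r Hr; upd_cases.
set b := eval _ x0 in R2 S2 *.
have [|||R3 _] := @comp_spec_at _ _ vs d d.+3 e (upd (upd e d.+1 v) d.+2 b) N s0 lt_vs _ _ _ bnd.
- lia.
- by emp_tac emp.
- by move=> r Hr; upd_cases.
rewrite -/b in R3.
have bnd' r : r \in vs -> size (e r) <= M.
  by move=> /bnd; rewrite /M; lia.
have [||||||||R4 S4] := @fold_loop x2 f2 vs d e M b s2 lt_vs bnd' v b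
  (upd (upd (upd e d.+1 v) d.+2 b) d.+3 b).
- by move=> r Hr; upd_cases.
- by upd_cases.
- by upd_cases.
- by upd_cases.
- by emp_tac emp.
- by rewrite /M; lia.
- by rewrite /M; lia.
- by [].
set u := fold_suffixes _ _ _ in R4 S4 *.
set B := 3 * f2 M + 28 * M + 10 in R4 *.
have let2 : size v * B + 1 <= f1 N * B + 1 by rewrite leq_add2r leq_mul2r S1 orbT.
split; last by lia.
apply: (rw_seq R1 _ (t2 := f0 N + (f0 N + (f1 N * B + 1 + (2 * f0 N + 1 + (12 * f0 N + 2)))))); last by lia.
apply: (rw_seq R2 _); last exact: leqnn.
apply: (rw_seq R3 _); last exact: leqnn.
apply: (rw_seq (rw_le R4 let2) _); last exact: leqnn.
apply: (rw_seq (t1 := 2 * f0 N + 1)); last exact: leqnn.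
  by apply: (rw_clear_eq (erefl _)); upd_cases; lia.
apply: rw_transfer; try lia.
- by upd_cases; apply: emp; lia.
- upd_ext; rewrite ?(emp d) ?cats0 ?emp //; lia.
- by upd_cases; lia.
Qed.

Lemma comp_spec_poly x : exists2 f, poly_bounded f & comp_spec x f.
Proof.
elim: x => [i||b x [f pf sf]|x [f pf sf]
  |x [f pf sf] x0 [f0 p0 s0] x1 [f1 p1 s1] x2 [f2 p2 s2]
  |x1 [f1 p1 s1] x2 [f2 p2 s2]|x1 [f1 p1 s1] x2 [f2 p2 s2]
  |x1 [f1 p1 s1] x2 [f2 p2 s2]
  |x [f pf sf] x0 [f0 p0 s0] x1 [f1 p1 s1] x2 [f2 p2 s2]
  |x1 [f1 p1 s1] x2 [f2 p2 s2]|x1 [f1 p1 s1] x0 [f0 p0 s0] x2 [f2 p2 s2]].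
- eexists; last exact: comp_var. by poly.
- eexists; last exact: comp_nil. by poly.
- eexists; last exact: comp_cons sf. by poly.
- eexists; last exact: comp_tail sf. by poly.
- eexists; last exact: comp_case sf s0 s1 s2. by poly.
- eexists; last exact: comp_cat s1 s2. by poly.
- eexists; last exact: comp_drop s1 s2. by poly.
- eexists; last exact: comp_let s1 s2.
  have pg := poly_comp p2 (poly_add poly_id p1). by poly.
- eexists; last exact: comp_call sf s0 s1 s2.
  have pg := poly_comp pf (poly_add (poly_add p0 p1) p2). by poly.
- eexists; last exact: comp_flatmap s1 s2.
  have pg := poly_comp p2 (poly_add poly_id p1). by poly.
- eexists; last exact: comp_fold s1 s0 s2.
  have pg := poly_comp p2 (poly_add (poly_add poly_id p1) p0). by poly.
Qed.

Theorem expr_polytime x : polytime (fun w => eval [:: w] x).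
Proof.
have [g [l Hl] sg] := comp_spec_poly x.
pose p := Seq (comp x [:: 0] 1) (Seq (clear 0) (transfer 1 2 0)).
have pT : poly_bounded (fun N => g N + (2 * N + 1 + (12 * g N + 2))).
  have pg : poly_bounded g by exists l.
  by poly.
have [c Hc] := pT.
(* For [N >= 2] one has [N + 2 <= N ^ 2], so the exponent [2 * c] suffices; for smaller [N] the
   additive [3 ^ c] does. *)
exists (prog_machine p), (2 * c + 3 ^ c) => w.
pose e0 : store := fun r => if r == 0 then w else [::].
have [|||R S] := sg [:: 0] 1 e0 (size w).
- by [].
- by move=> [|r].
- by move=> r; rewrite inE => /eqP->.
rewrite /= in R S; set v := eval _ x in R S *.
have [t Ht let_] : runs_within p e0 (upd e0 0 v) (g (size w) + (2 * size w + 1 + (12 * g (size w) + 2))).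
  apply: rw_seq R _ (leqnn _).
  apply: (rw_seq (t1 := 2 * size w + 1)); last exact: leqnn.
    by apply: (rw_clear_eq (erefl _)).
  apply: rw_transfer => //; first by upd_ext; rewrite ?cats0.
  by upd_cases; lia.
have := @run_outputs p w (upd e0 0 v) t (size w ^ (2 * c + 3 ^ c) + (2 * c + 3 ^ c)) Ht.
apply; apply: leq_trans let_ _; apply: leq_trans (Hc _) _.
case: (ltnP (size w) 2) => le2.
  apply: (@leq_trans (3 ^ c)); last by lia.
  by case: (c) => // c'; rewrite leq_exp2r //; lia.
apply: (@leq_trans (size w ^ (2 * c))).
  rewrite expnM; case: (c) => // c'; rewrite leq_exp2r //.
  by rewrite -mulnn; nia.
apply: leq_trans (leq_addr _ _); rewrite leq_pexp2l //; lia.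
Qed.

(** * Squares at even positions *)

Lemma mem_square22 (x : cell) : (x \in square22) =
  ((x.1 == 0%R) || (x.1 == 1%R)) && ((x.2 == 0%R) || (x.2 == 1%R)).
Proof.
case: x => a b; rewrite /square22 !inE !xpair_eqE /=.
by case: (a == 0%R); case: (a == 1%R); case: (b == 0%R); case: (b == 1%R).
Qed.

Lemma mem_placed n (i j : 'I_n) (k : 'I_2) (x : cell) :
  reflect (exists a b : bool, x = (Posz (i + a), Posz (j + b)))
    (x \in placed two_squares (i, j, k)).
Proof.
have -> : placed two_squares (i, j, k) = translate (Posz i, Posz j) square22.
  by case: k => [[|[|k]] Hk].
rewrite /translate; apply: (iffP (imfsetP _ _ _ _)) => [[y /= yin ->]|[a [b ->]]].
  move: yin; rewrite mem_square22 => /andP[/orP[]/eqP-> /orP[]/eqP->];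
    [exists false, false|exists false, true|exists true, false|exists true, true];
    by rewrite ?PoszD.
exists (Posz a, Posz b); first by rewrite mem_square22; case: a; case: b.
by rewrite !PoszD.
Qed.

(** Disjointness of two squares in terms of their corners: some coordinate differs by at least
    two. *)
Definition far (i j i' j' : nat) : bool :=
  [|| i.+1 < i', i'.+1 < i, j.+1 < j' | j'.+1 < j].

Lemma tilingP n (T : {set 'I_n * 'I_n * 'I_2}) : is_tiling two_squares T <->
  (forall i j k, (i, j, k) \in T -> i.+1 < n /\ j.+1 < n) /\
  (forall i j k i' j' k', (i, j, k) \in T -> (i', j', k') \in T ->
     (i, j, k) != (i', j', k') -> far i j i' j').
Proof.
split=> [[Tin Tdis]|[Tin Tfar]]; split.
- move=> i j k ijk.
  have := Tin _ ijk (Posz (i + true), Posz (j + true)).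
  case: mem_placed => [_ /(_ isT)|[]]; last by exists true, true.
  by rewrite /in_grid /=; lia.
- move=> i j k i' j' k' T1 T2 ne; have /fdisjointP D := Tdis _ _ T1 T2 ne.
  apply/negPn/negP; rewrite /far => nfar.
  (* Squares that are not [far] share the cell at the coordinatewise maximum of their corners. *)
  have := D (Posz (maxn i i'), Posz (maxn j j')).
  case: mem_placed => [_|[]]; last first.
    by exists (i < i'), (j < j'); congr (Posz _, Posz _); lia.
  move/(_ isT); case: mem_placed => // -[].
  by exists (i' < i), (j' < j); congr (Posz _, Posz _); lia.
- move=> [[i j] k] ijk x /mem_placed[a [b ->]].
  by have [] := Tin _ _ _ ijk; rewrite /in_grid /=; lia.
- move=> [[i j] k] [[i' j'] k'] T1 T2 ne; have := Tfar _ _ _ _ _ _ T1 T2 ne.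
  rewrite /far => F; apply/fdisjointP => x /mem_placed[a [b ->]].
  by apply/negP => /mem_placed[a' [b' []]]; lia.
Qed.

Definition nat_tiling (n : nat) (t : nat -> nat -> nat -> bool) : Prop :=
  (forall i j k, t i j k -> [/\ i.+1 < n, j.+1 < n & k < 2]) /\
  (forall i j k i' j' k', t i j k -> t i' j' k' ->
     (i, j, k) != (i', j', k') -> far i j i' j').

Lemma consistentP (I : instance 2) : consistent two_squares I <->
  exists t : nat -> nat -> nat -> bool,
  [/\ nat_tiling (grid_size I) t,
      forall i k, row_sums I i k = \sum_(0 <= j < grid_size I) t i j k
    & forall j k, col_sums I j k = \sum_(0 <= i < grid_size I) t i j k].
Proof.
case: I => n r c; rewrite /consistent /=; split.
- move=> [T [/tilingP[Tin Tfar] Er Ec]].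
  pose t i j k := [exists p in T, [&& nat_of_ord p.1.1 == i,
                                      nat_of_ord p.1.2 == j & nat_of_ord p.2 == k]].
  have tE (i j : 'I_n) (k : 'I_2) : t i j k = ((i, j, k) \in T).
    apply/existsP/idP => [[[[i' j'] k'] /= /andP[pT /and3P[/eqP e1 /eqP e2 /eqP e3]]]|pT].
      by rewrite -(val_inj e1) -(val_inj e2) -(val_inj e3).
    by exists (i, j, k); rewrite pT !eqxx.
  exists t; split.
  + split=> [i j k|i j k i' j' k'].
      move=> /existsP[[[i1 j1] k1] /= /andP[pT /and3P[/eqP e1 /eqP e2 /eqP e3]]].
      by have [] := Tin _ _ _ pT; rewrite e1 e2 -e3.
    move=> /existsP[[[i1 j1] k1] /= /andP[pT /and3P[/eqP e1 /eqP e2 /eqP e3]]].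
    move=> /existsP[[[i2 j2] k2] /= /andP[qT /and3P[/eqP f1 /eqP f2 /eqP f3]]].
    move=> ne; have := Tfar _ _ _ _ _ _ pT qT; rewrite e1 e2 f1 f2; apply.
    by apply: contraNneq ne => -[E1 E2 E3]; rewrite -e1 -e2 -e3 -f1 -f2 -f3 E1 E2 E3.
  + move=> i k; rewrite -Er mxE -sum1dep_card big_mkord big_mkcond /=.
    by apply: eq_bigr => j _; rewrite tE; case: (_ \in T).
  + move=> j k; rewrite -Ec mxE -sum1dep_card big_mkord big_mkcond /=.
    by apply: eq_bigr => i _; rewrite tE; case: (_ \in T).
- move=> [t [[tin tfar] Er Ec]].
  exists [set p : 'I_n * 'I_n * 'I_2 | t p.1.1 p.1.2 p.2]; split.
  + apply/tilingP; split=> [i j k|i j k i' j' k']; rewrite !inE /=.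
      by case/tin.
    move=> t1 t2 ne; apply: tfar t1 t2 _; apply: contraNneq ne => -[e1 e2 e3].
    by apply/eqP; congr (_, _, _); apply: val_inj.
  + apply/matrixP => i k; rewrite mxE Er -sum1dep_card big_mkord big_mkcond /=.
    by apply: eq_bigr => j _; rewrite !inE /=; case: (t _ _ _).
  + apply/matrixP => j k; rewrite mxE Ec -sum1dep_card big_mkord big_mkcond /=.
    by apply: eq_bigr => i _; rewrite !inE /=; case: (t _ _ _).
Qed.

Definition spread_matrix (N : nat) (f : nat -> nat -> nat) : 'M[nat]_(N.*2, 2) :=
  \matrix_(i < N.*2, k < 2) (if odd i then 0 else f i./2 k).

Definition spread_instance (N : nat) (r c : nat -> nat -> nat) : instance 2 :=
  Instance (spread_matrix N r) (spread_matrix N c).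

Lemma sum_double (F : nat -> nat) N :
  \sum_(0 <= i < N.*2) F i = \sum_(0 <= i < N) (F i.*2 + F i.*2.+1).
Proof.
elim: N => [|N IH]; first by rewrite !big_geq.
by rewrite doubleS !big_nat_recr //= IH addnA.
Qed.

Definition atom_of (k : nat) : option bool := Some (k == 1).

(* Atoms are placed at even positions: a square may then occupy any set of
   positions, so the tiles behave like the atoms of a 0/1/2-matrix. *)
Lemma spread_consistentP N r c : consistent two_squares (spread_instance N r c) <->
  exists M : nat -> nat -> option bool,
    (forall i k, i < N -> k < 2 -> r i k = \sum_(0 <= j < N) (M i j == atom_of k)) /\
    (forall j k, j < N -> k < 2 -> c j k = \sum_(0 <= i < N) (M i j == atom_of k)).
Proof.
rewrite consistentP /=; split.
- move=> [t [[tin tfar] Er Ec]].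
  have row0 i j k : t i j k -> ~~ odd i.
    move=> tijk; have [li lj lk] := tin _ _ _ tijk; apply/negP => oi.
    have lti : i < N.*2 by lia.
    have := Er (Ordinal lti) (Ordinal lk); rewrite mxE /= oi => /esym/eqP.
    rewrite sum_nat_seq_eq0 => /allP /(_ j); rewrite mem_index_iota tijk /=.
    by move=> H; have := H _; lia.
  have col0 i j k : t i j k -> ~~ odd j.
    move=> tijk; have [li lj lk] := tin _ _ _ tijk; apply/negP => oi.
    have ltj : j < N.*2 by lia.
    have := Ec (Ordinal ltj) (Ordinal lk); rewrite mxE /= oi => /esym/eqP.
    rewrite sum_nat_seq_eq0 => /allP /(_ i); rewrite mem_index_iota tijk /=.
    by move=> H; have := H _; lia.
  exists (fun i j => if t i.*2 j.*2 0 then Some false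
                     else if t i.*2 j.*2 1 then Some true else None).
  have E i j k : k < 2 -> ((if t i.*2 j.*2 0 then Some false
        else if t i.*2 j.*2 1 then Some true else None) == atom_of k) = t i.*2 j.*2 k.
    case: k => [|[|//]] _; rewrite /atom_of /=; first by case: ifP => // _; case: ifP.
    case: ifP => [t0|_]; last by case: ifP.
    apply/esym/negP => t1; have := tfar _ _ _ _ _ _ t0 t1; rewrite /far.
    by rewrite xpair_eqE /= andbF => /(_ isT); lia.
  split=> [i k li lk|j k lj lk].
  + have lti : i.*2 < N.*2 by lia.
    have := Er (Ordinal lti) (Ordinal lk).
    rewrite mxE /= odd_double doubleK => ->; rewrite sum_double.
    apply: eq_bigr => j _; rewrite E //.
    suff -> : t i.*2 j.*2.+1 k = false by rewrite addn0.
    by apply/negP => /col0; rewrite /= odd_double.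
  + have ltj : j.*2 < N.*2 by lia.
    have := Ec (Ordinal ltj) (Ordinal lk).
    rewrite mxE /= odd_double doubleK => ->; rewrite sum_double.
    apply: eq_bigr => i _; rewrite E //.
    suff -> : t i.*2.+1 j.*2 k = false by rewrite addn0.
    by apply/negP => /row0; rewrite /= odd_double.
- move=> [M [Er Ec]].
  exists (fun i j k => [&& ~~ odd i, ~~ odd j, i < N.*2, j < N.*2, k < 2
                         & M i./2 j./2 == atom_of k]).
  have dbl m : ~~ odd m -> m = m./2.*2.
    by move=> /negPf om; rewrite -[LHS]odd_double_half om.
  split.
  + split=> [i j k|i j k i' j' k'].
      case/and5P => /dbl-> /dbl-> ? ? /andP[? _]; split=> //; lia.
    case/and5P => /dbl e1 /dbl e2 ? ? /andP[lk /eqP M1].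
    case/and5P => /dbl f1 /dbl f2 ? ? /andP[lk' /eqP M2] ne.
    apply/negPn/negP => nfar.
    have E1 : i = i' by move: nfar; rewrite /far; lia.
    have E2 : j = j' by move: nfar; rewrite /far; lia.
    move: ne; rewrite E1 E2 !xpair_eqE !eqxx /=.
    by move: M2; rewrite -E1 -E2 M1 /atom_of => -[]; lia.
  + move=> i k; rewrite mxE; case: ifP => oi /=.
      by rewrite big1 // => j _; rewrite oi.
    have lti := ltn_ord i; have ei := dbl i (negbT oi).
    rewrite Er //; last by lia.
    rewrite sum_double; apply: eq_big_nat => j /andP[_ ltj].
    rewrite /= !odd_double /= doubleK lti ltn_ord /= addn0.
    by rewrite (_ : j.*2 < N.*2) //; lia.
  + move=> j k; rewrite mxE; case: ifP => oj /=.
      by rewrite big1 // => i _; rewrite /= andbF.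
    have ltj := ltn_ord j; have ej := dbl j (negbT oj).
    rewrite Ec //; last by lia.
    rewrite sum_double; apply: eq_big_nat => i /andP[_ lti].
    rewrite /= !odd_double /= doubleK ltj ltn_ord /= addn0.
    by rewrite (_ : i.*2 < N.*2) //; lia.
Qed.

(** * The staircase of rails *)

Definition width v := v.*2.+2.

Definition clause_size v (inc : nat -> bool) := \sum_(0 <= b < v.*2) inc b.

Definition chain_row v m (inc : nat -> nat -> bool) (i k : nat) : nat :=
  let: w := width v in let: n := v.*2 in
  let: q := i %/ w in let: a := i %% w in
  if a < n then
    if q == 0 then (if k == 0 then 0 else a + ~~ odd a + m * w)
    else if k == 0 then q.-1 * w + a.+2 else a.+1 + (m - q) * w
  else if a == n then
    (if k == 0 then q * w + v.+1 else v.-1 + (m - q) * w)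
  else
    (if k == 0 then q * w + (clause_size v (inc q)).-1
     else (n - clause_size v (inc q)).+1 + (m - q) * w).

Definition chain_col v m (inc : nat -> nat -> bool) (j k : nat) : nat :=
  let: w := width v in let: n := v.*2 in
  let: q := j %/ w in let: b := j %% w in
  if b < n then
    if q < m then
      (if k == 0 then (n - b) + inc q b + (m - q.+1) * w
       else q * w + (n - b) + ~~ inc q b)
    else if k == 0 then 0 else m * w + (n - b - ~~ odd b)
  else if b == n then
    (if k == 0 then v + (m - q.+1) * w else q.+1 * w + v)
  else (if k == 0 then n + (m - q.+1) * w else q.+1 * w).

Definition chain_size v m := m * width v + v.*2.

Definition chain_instance v m inc : instance 2 :=
  spread_instance (chain_size v m) (chain_row v m inc) (chain_col v m inc).

Lemma divmod_block v q a : a < width v ->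
  (q * width v + a) %/ width v = q /\ (q * width v + a) %% width v = a.
Proof.
move=> lt; have w0 : 0 < width v by [].
by rewrite divnMDl // modnMDl divn_small // modn_small // addn0.
Qed.

Lemma chain_row_rail v m inc q a k : a < v.*2 ->
  chain_row v m inc (q * width v + a) k =
  if q == 0 then (if k == 0 then 0 else a + ~~ odd a + m * width v)
  else if k == 0 then q.-1 * width v + a.+2 else a.+1 + (m - q) * width v.
Proof.
move=> lt; have [|E1 E2] := @divmod_block v q a; first by rewrite /width; lia.
by rewrite /chain_row E1 E2 lt.
Qed.

Lemma chain_row_e0 v m inc q k : chain_row v m inc (q * width v + v.*2) k =
  if k == 0 then q * width v + v.+1 else v.-1 + (m - q) * width v.
Proof.
have [|E1 E2] := @divmod_block v q v.*2; first by rewrite /width; lia.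
by rewrite /chain_row E1 E2 ltnn eqxx.
Qed.

Lemma chain_row_e1 v m inc q k : chain_row v m inc (q * width v + v.*2.+1) k =
  if k == 0 then q * width v + (clause_size v (inc q)).-1
  else (v.*2 - clause_size v (inc q)).+1 + (m - q) * width v.
Proof.
have [|E1 E2] := @divmod_block v q v.*2.+1; first by rewrite /width; lia.
by rewrite /chain_row E1 E2 ltnNge leqnSn /= eqn_leq ltnn.
Qed.

Lemma chain_col_rail v m inc q b k : b < v.*2 ->
  chain_col v m inc (q * width v + b) k =
  if q < m then
    (if k == 0 then (v.*2 - b) + inc q b + (m - q.+1) * width v
     else q * width v + (v.*2 - b) + ~~ inc q b)
  else if k == 0 then 0 else m * width v + (v.*2 - b - ~~ odd b).
Proof.
move=> lt; have [|E1 E2] := @divmod_block v q b; first by rewrite /width; lia.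
by rewrite /chain_col E1 E2 lt.
Qed.

Lemma chain_col_f0 v m inc q k : chain_col v m inc (q * width v + v.*2) k =
  if k == 0 then v + (m - q.+1) * width v else q.+1 * width v + v.
Proof.
have [|E1 E2] := @divmod_block v q v.*2; first by rewrite /width; lia.
by rewrite /chain_col E1 E2 ltnn eqxx.
Qed.

Lemma chain_col_f1 v m inc q k : chain_col v m inc (q * width v + v.*2.+1) k =
  if k == 0 then v.*2 + (m - q.+1) * width v else q.+1 * width v.
Proof.
have [|E1 E2] := @divmod_block v q v.*2.+1; first by rewrite /width; lia.
by rewrite /chain_col E1 E2 ltnNge leqnSn /= eqn_leq ltnn.
Qed.

Lemma sum_offset (F : nat -> nat) x n :
  \sum_(x <= i < x + n) F i = \sum_(0 <= i < n) F (x + i).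
Proof.
rewrite -{1}[x]add0n big_addn addnC addnK.
by apply: eq_bigr => i _; rewrite addnC.
Qed.

Lemma sum_block v (F : nat -> nat) q :
  \sum_(q * width v <= i < q.+1 * width v) F i =
  \sum_(0 <= a < v.*2) F (q * width v + a) + F (q * width v + v.*2) +
  F (q * width v + v.*2.+1).
Proof.
rewrite mulSn addnC sum_offset /width !big_nat_recr //=.
Qed.

Lemma sum_shifted_block v (F : nat -> nat) q :
  \sum_(q * width v + v.*2 <= i < q.+1 * width v + v.*2) F i =
  F (q * width v + v.*2) + F (q * width v + v.*2.+1) +
  \sum_(0 <= a < v.*2) F (q.+1 * width v + a).
Proof.
rewrite (@big_cat_nat _ _ _ (q.+1 * width v)) /=; try (rewrite ?mulSn /width; lia).
rewrite sum_offset; congr (_ + _).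
have -> : q.+1 * width v = q * width v + v.*2 + 2 by rewrite mulSn /width; lia.
by rewrite sum_offset !big_nat_recr //= big_nil addn0 add0n -addnA addn1.
Qed.

Lemma sum_rev_id n : \sum_(0 <= b < n) (n - b) = \sum_(0 <= a < n) a + n.
Proof.
rewrite big_nat_rev /= add0n.
have -> : \sum_(0 <= a < n) a + n = \sum_(0 <= a < n) (a + 1).
  by rewrite big_split /= sum_nat_const_nat subn0 muln1.
by apply: eq_big_nat => i Hi; lia.
Qed.

Lemma sum_addc (F : nat -> nat) c n :
  \sum_(0 <= a < n) (F a + c) = \sum_(0 <= a < n) F a + n * c.
Proof. by rewrite big_split /= sum_nat_const_nat subn0. Qed.

Lemma clause_size_le v inc : clause_size v inc <= v.*2.
Proof.
rewrite /clause_size -[X in _ <= X]muln1 -[v.*2 in X in _ <= X]subn0 -sum_nat_const_nat.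
by apply: leq_sum => i _; case: (inc i).
Qed.

(** This is the tightness required by [tight_cut] at E_q and C_q. The induction goes down from
    [q = m], where both sums vanish. Nonempty clauses make the truncated predecessor in the sum of
    the second row of E_q exact. *)
Lemma chain_cutA v m inc q : q <= m -> (forall q, q < m -> 0 < clause_size v (inc q)) ->
  0 < v ->
  \sum_(q * width v + v.*2 <= i < chain_size v m) chain_row v m inc i 0 =
  (chain_size v m - (q * width v + v.*2)) * (q * width v) +
  \sum_(q * width v <= j < chain_size v m) chain_col v m inc j 0.
Proof.
move=> leq_qm kpos vpos; rewrite /chain_size.
have [d Ed] : exists d, m = q + d by exists (m - q); lia.
elim: d q leq_qm Ed => [|d IH] q leqm Ed.
  rewrite Ed addn0 subnn mul0n add0n big_geq // sum_offset.
  apply/esym; rewrite big_nat_cond big1 // => b /andP[/andP[_ ltb] _].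
  by rewrite chain_col_rail // ltnn.
rewrite (@big_cat_nat _ _ _ (q.+1 * width v + v.*2)) /=; last 2 first.
- by rewrite mulSn; lia.
- by rewrite leq_add2r leq_mul2r; lia.
rewrite [X in _ = _ + X](@big_cat_nat _ _ _ (q.+1 * width v)) /=; last 2 first.
- by rewrite mulSn; lia.
- by rewrite (leq_trans _ (leq_addr _ _)) // leq_mul2r; lia.
rewrite IH; [|lia..].
rewrite sum_shifted_block sum_block chain_row_e0 chain_row_e1 chain_col_f0 chain_col_f1 /=.
have -> : \sum_(0 <= a < v.*2) chain_row v m inc (q.+1 * width v + a) 0 =
          \sum_(0 <= a < v.*2) a + v.*2 * (q * width v + 2).
  rewrite -sum_addc; apply: eq_big_nat => a /andP[_ lta].
  by rewrite chain_row_rail //=; lia.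
have -> : \sum_(0 <= b < v.*2) chain_col v m inc (q * width v + b) 0 =
   \sum_(0 <= a < v.*2) a + v.*2 + clause_size v (inc q) + v.*2 * (d * width v).
  rewrite -sum_rev_id /clause_size -big_split /= -sum_addc.
  apply: eq_big_nat => b /andP[_ ltb]; rewrite chain_col_rail //.
  by rewrite (_ : q < m) /=; [congr (_ + _ * _) | ]; lia.
have -> : m - q.+1 = d by lia.
have -> : m * width v + v.*2 - (q.+1 * width v + v.*2) = d * width v.
  by rewrite subnDr -mulnBl; congr (_ * _); lia.
have -> : m * width v + v.*2 - (q * width v + v.*2) = d.+1 * width v.
  by rewrite subnDr -mulnBl; congr (_ * _); lia.
have := kpos q _; rewrite Ed -[X in X < _]addn0 ltn_add2l => /(_ isT).
set k := clause_size _ _; set s := bigop.body _ _ _; set X := bigop.body _ _ _; move: k s X => k s X kp.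
rewrite !mulSn !mulnDr !mulnDl !mulnA.
have -> : v.*2 * q * width v = (width v - 2) * q * width v by rewrite /width; congr (_ * _ * _); lia.
have -> : v.*2 * d * width v = (width v - 2) * d * width v by rewrite /width; congr (_ * _ * _); lia.
have : 2 <= width v by [].
have : v.*2 = width v - 2 by rewrite /width; lia.
move: (width v) => w ->; nia.
Qed.

(** The transposed statement for B, cut at F_q and at the next row block. The base case is the last
    cut, whose columns include the final block with its correction by parity. *)
Lemma chain_cutB v m inc q : q < m -> (forall q, q < m -> 0 < clause_size v (inc q)) ->
  0 < v ->
  \sum_(q * width v + v.*2 <= j < chain_size v m) chain_col v m inc j 1 =
  (chain_size v m - (q * width v + v.*2)) * (q.+1 * width v) +
  \sum_(q.+1 * width v <= i < chain_size v m) chain_row v m inc i 1.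
Proof.
move=> leq_qm kpos vpos; rewrite /chain_size.
have [d Ed] : exists d, m = q.+1 + d by exists (m - q.+1); lia.
elim: d q leq_qm Ed => [|d IH] q leqm Ed.
  rewrite addn0 in Ed; rewrite Ed sum_shifted_block sum_offset chain_col_f0 chain_col_f1 /=.
  have -> : \sum_(0 <= a < v.*2) chain_row v q.+1 inc (q.+1 * width v + a) 1 =
            \sum_(0 <= a < v.*2) a + v.*2.
    rewrite -[X in _ + X]muln1 -sum_addc; apply: eq_big_nat => a /andP[_ lta].
    by rewrite chain_row_rail //= subnn mul0n addn0 addn1.
  set X := \sum_(0 <= a < v.*2) chain_col _ _ _ _ _.
  have EX : X + v = \sum_(0 <= a < v.*2) a + v.*2 + v.*2 * (q.+1 * width v).
    have Ev : v = \sum_(0 <= b < v.*2) ~~ odd b.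
      rewrite sum_double; under eq_bigr do rewrite /= odd_double.
      by rewrite sum_nat_const_nat subn0 muln1.
    rewrite /X [X in _ + X = _]Ev -big_split /= -sum_rev_id -sum_addc.
    apply: eq_big_nat => b /andP[_ ltb]; rewrite chain_col_rail // ltnn /=.
    by case: (odd b) => /=; lia.
  have -> : q.+1 * width v + v.*2 - (q * width v + v.*2) = width v.
    by rewrite subnDr mulSn addnK.
  rewrite /width in EX *; move: EX.
  set s := bigop.body _ _ _; move: s X => s X; rewrite !mulSn; nia.
rewrite (@big_cat_nat _ _ _ (q.+1 * width v + v.*2)) /=; last 2 first.
- by rewrite mulSn; lia.
- by rewrite leq_add2r leq_mul2r; lia.
rewrite [X in _ = _ + X](@big_cat_nat _ _ _ (q.+2 * width v)) /=; last 2 first.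
- by rewrite [q.+2 * _]mulSn; lia.
- by rewrite (leq_trans _ (leq_addr _ _)) // leq_mul2r; lia.
rewrite IH; [|lia..].
rewrite sum_shifted_block sum_block chain_row_e0 chain_row_e1 chain_col_f0 chain_col_f1 /=.
have -> : \sum_(0 <= a < v.*2) chain_row v m inc (q.+1 * width v + a) 1 =
          \sum_(0 <= a < v.*2) a + v.*2 * (1 + d.+1 * width v).
  rewrite -sum_addc; apply: eq_big_nat => a /andP[_ lta].
  rewrite chain_row_rail //= (_ : m - q.+1 = d.+1); lia.
set X := \sum_(0 <= a < v.*2) chain_col _ _ _ _ _.
have EX : X + clause_size v (inc q.+1) =
   \sum_(0 <= a < v.*2) a + v.*2 + v.*2 * (q.+1 * width v + 1).
  rewrite -sum_rev_id /clause_size /X -big_split /= -sum_addc.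
  apply: eq_big_nat => b /andP[_ ltb]; rewrite chain_col_rail //.
  rewrite (_ : q.+1 < m = true) /=; last by apply/idP; lia.
  by case: (inc _ _) => /=; lia.
have -> : m - q.+1 = d.+1 by lia.
have -> : m * width v + v.*2 - (q.+1 * width v + v.*2) = d.+1 * width v.
  by rewrite subnDr -mulnBl; congr (_ * _); lia.
have -> : m * width v + v.*2 - (q * width v + v.*2) = d.+2 * width v.
  by rewrite subnDr -mulnBl; congr (_ * _); lia.
have kp : 0 < clause_size v (inc q.+1) by apply: kpos; lia.
have := clause_size_le v (inc q.+1).
move: EX kp; set k := clause_size _ _; set s := bigop.body _ _ _.
move: k s X => k s X; set Y := bigop.body _ _ _; move: Y => Y EX kp lek.
have : v.*2 = width v - 2 by rewrite /width; lia.
have : 2 <= width v by [].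
move: EX lek; move: (width v) => w EX lek w2 Ev; rewrite Ev in EX lek *.
have -> : v = (v.-1).+1 by lia.
rewrite !mulSn; nia.
Qed.

(** * Counting in 0/1-matrices *)

Lemma sum_true (F : nat -> bool) x y : (forall i, x <= i < y -> F i) ->
  \sum_(x <= i < y) F i = y - x.
Proof.
move=> H; rewrite (eq_big_nat _ _ (F2 := fun=> 1)); last by move=> i /H->.
by rewrite sum_nat_const_nat muln1.
Qed.

Lemma sum_false (F : nat -> bool) x y : (forall i, x <= i < y -> ~~ F i) ->
  \sum_(x <= i < y) F i = 0.
Proof. by move=> H; rewrite big_nat big1 // => i /H /negPf->. Qed.

Lemma sum_bool_le (F : nat -> bool) x y : \sum_(x <= i < y) F i <= y - x.
Proof.
rewrite -[X in _ <= X]muln1 -sum_nat_const_nat.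
by apply: leq_sum => i _; case: (F i).
Qed.

Lemma sum_bool_full (F : nat -> bool) x y : y - x <= \sum_(x <= i < y) F i ->
  forall i, x <= i < y -> F i.
Proof.
move=> le i /andP[lxi liy]; apply/negPn/negP => nF; move: le.
rewrite (@big_cat_nat _ _ _ i) /=; [|lia..].
rewrite [X in _ + X]big_ltn // (negPf nF) add0n.
have := sum_bool_le F x i; have := sum_bool_le F i.+1 y; lia.
Qed.

Lemma sum2_le (P : nat -> nat -> bool) x y x' y' :
  \sum_(x <= i < y) \sum_(x' <= j < y') P i j <= (y - x) * (y' - x').
Proof.
rewrite -sum_nat_const_nat; apply: leq_sum => i _; exact: sum_bool_le.
Qed.

Lemma sum2_full (P : nat -> nat -> bool) x y x' y' :
  (y - x) * (y' - x') <= \sum_(x <= i < y) \sum_(x' <= j < y') P i j ->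
  forall i j, x <= i < y -> x' <= j < y' -> P i j.
Proof.
move=> le i j /andP[lxi liy]; apply: sum_bool_full; rewrite leqNgt; apply/negP => lt.
move: le; rewrite (@big_cat_nat _ _ _ i) /=; [|lia..].
rewrite [X in _ + X]big_ltn //.
have := sum2_le P x i x' y'; have := sum2_le P i.+1 y x' y'.
move: (bigop.body _ _ _) lt => S1 lt; move: (bigop.body _ _ _) => S2.
by rewrite leqNgt => le1 le2; nia.
Qed.

Lemma sum2_zero (P : nat -> nat -> bool) x y x' y' :
  \sum_(x <= i < y) \sum_(x' <= j < y') P i j = 0 ->
  forall i j, x <= i < y -> x' <= j < y' -> ~~ P i j.
Proof.
move=> /eqP; rewrite sum_nat_seq_eq0 => /allP H i j Hi Hj.
have := H i; rewrite mem_index_iota Hi => /(_ isT) /=.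
rewrite sum_nat_seq_eq0 => /allP /(_ j); rewrite mem_index_iota Hj => /(_ isT) /=.
by case: (P i j).
Qed.

(** Double counting: the entries common to the last rows and the last columns cancel, and two
    opposite rectangles remain. *)
Lemma rows_minus_cols (P : nat -> nat -> bool) N r0 c0 : r0 <= N -> c0 <= N ->
  \sum_(r0 <= i < N) \sum_(0 <= j < N) P i j +
  \sum_(0 <= i < r0) \sum_(c0 <= j < N) P i j =
  \sum_(r0 <= i < N) \sum_(0 <= j < c0) P i j +
  \sum_(c0 <= j < N) \sum_(0 <= i < N) P i j.
Proof.
move=> ler lec.
have -> : \sum_(c0 <= j < N) \sum_(0 <= i < N) P i j =
  \sum_(0 <= i < r0) \sum_(c0 <= j < N) P i j + \sum_(r0 <= i < N) \sum_(c0 <= j < N) P i j.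
  by rewrite exchange_big_nat -(@big_cat_nat _ _ _ r0).
have -> : \sum_(r0 <= i < N) \sum_(0 <= j < N) P i j =
  \sum_(r0 <= i < N) \sum_(0 <= j < c0) P i j + \sum_(r0 <= i < N) \sum_(c0 <= j < N) P i j.
  by rewrite -big_split; apply: eq_bigr => i _; rewrite -(@big_cat_nat _ _ _ c0).
lia.
Qed.

(** The excess of the last rows over the last columns is the content of the lower left rectangle
    minus that of the upper right one. It reaches the area of the former only if that one is full
    and the other one is empty. *)
Lemma tight_cut (P : nat -> nat -> bool) N r0 c0 : r0 <= N -> c0 <= N ->
  \sum_(r0 <= i < N) \sum_(0 <= j < N) P i j =
  (N - r0) * c0 + \sum_(c0 <= j < N) \sum_(0 <= i < N) P i j ->
  (forall i j, r0 <= i < N -> j < c0 -> P i j) /\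
  (forall i j, i < r0 -> c0 <= j < N -> ~~ P i j).
Proof.
move=> ler lec E; have := rows_minus_cols P ler lec; rewrite E.
have := sum2_le P r0 N 0 c0; rewrite subn0 => le1 E2.
split=> i j Hi Hj.
  apply: (@sum2_full P r0 N 0 c0) => //; rewrite subn0; lia.
apply: (@sum2_zero P 0 r0 c0 N) => //; lia.
Qed.

(** The same count without tightness. Inside a block of the staircase this inequality is all that is
    used. *)
Lemma staircase_le (P : nat -> nat -> bool) n l (R C : nat -> nat) : l <= n ->
  (forall i, i < n -> \sum_(0 <= j < n) P i j = R i) ->
  (forall j, j < n -> \sum_(0 <= i < n) P i j = C j) ->
  \sum_(l <= i < n) R i <= (n - l) * l + \sum_(l <= j < n) C j.
Proof.
move=> len HR HC; have := rows_minus_cols P len len.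
rewrite (eq_big_nat _ _ (F2 := R)); last by move=> i Hi; apply: HR; lia.
rewrite [X in _ = _ + X](eq_big_nat _ _ (F2 := C)); last by move=> i Hi; apply: HC; lia.
by have := sum2_le P l n 0 l; lia.
Qed.

(** The equality case of [staircase_le], attained by the strict lower triangle. Hence, for sums that
    deviate from the triangle, the inequality compares the deviations alone. *)
Lemma sum_staircase l n : l <= n ->
  \sum_(l <= i < n) i = (n - l) * l + \sum_(l <= j < n) (n - j.+1).
Proof.
move=> len; have [d ->] : exists d, n = l + d by exists (n - l); lia.
rewrite !(sum_offset _ l) addKn addnC; under eq_bigr do rewrite addnC.
rewrite sum_addc; congr (_ + _); rewrite [RHS]big_nat_rev /=.
by apply: eq_big_nat => i Hi; lia.
Qed.

Lemma sum_odd_suffix f v : f <= v ->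
  \sum_(f.*2 <= a < v.*2) odd a = v - f /\ \sum_(f.*2 <= a < v.*2) ~~ odd a = v - f.
Proof.
move=> lef; have [d ->] : exists d, v = f + d by exists (v - f); lia.
rewrite doubleD !(sum_offset _ f.*2) !sum_double.
split; rewrite (eq_bigr (fun=> 1)) ?sum_nat_const_nat; try lia.
Qed.

Lemma atom_excl (x : option bool) : (x == atom_of 0) + (x == atom_of 1) <= 1.
Proof. by case: x => [[]|]. Qed.

Lemma sum_cell_full (F G : nat -> bool) n :
  (forall j, F j + G j <= 1) -> \sum_(0 <= j < n) F j + \sum_(0 <= j < n) G j = n ->
  forall j, j < n -> F j + G j = 1.
Proof.
move=> le1; rewrite -big_split /= => E j ltj.
have H b : F b + G b = (F b || G b) by have := le1 b; case: (F b); case: (G b).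
rewrite H (@sum_bool_full (fun b => F b || G b) 0 n) ?ltj //.
by rewrite subn0 -{1}E; apply: leq_sum => i _; rewrite H.
Qed.

Lemma sum_split_block v (F : nat -> nat) q N : q.+1 * width v <= N ->
  \sum_(0 <= j < N) F j =
  \sum_(0 <= j < q * width v) F j + \sum_(0 <= b < v.*2) F (q * width v + b) +
  F (q * width v + v.*2) + F (q * width v + v.*2.+1) +
  \sum_(q.+1 * width v <= j < N) F j.
Proof.
move=> le; have E : q.+1 * width v = q * width v + width v by rewrite mulSn addnC.
rewrite (@big_cat_nat _ _ _ (q * width v)) /=; [|lia..].
rewrite [X in _ + X = _](@big_cat_nat _ _ _ (q.+1 * width v)) /=; [|lia..].
by rewrite sum_block; lia.
Qed.

Lemma sum_split_rails (F : nat -> nat) x n N : x + n <= N ->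
  \sum_(x <= j < N) F j = \sum_(0 <= b < n) F (x + b) + \sum_(x + n <= j < N) F j.
Proof. by move=> le; rewrite (@big_cat_nat _ _ _ (x + n)) /= ?leq_addr // sum_offset. Qed.

(** The units on the rails from [l] on can only decrease along the staircase: [Z q.+1 l + c q l <= E
    q l <= Z q l + c q l]. They start on the odd rails and end on the even ones, which forces
    equality for even [l]. So each pair keeps its unit, which moves at most once, from odd to even,
    that is from false to true. *)
Lemma chain_sound v m inc : 0 < v -> 0 < m ->
  (forall q, q < m -> 0 < clause_size v (inc q)) ->
  consistent two_squares (chain_instance v m inc) ->
  exists x : nat -> nat -> bool,
    (forall q f, q.+1 < m -> f < v -> x q f -> x q.+1 f) /\
    (forall q, q < m -> exists b, [/\ b < v.*2, inc q b & x q b./2 = ~~ odd b]).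
Proof.
move=> vpos mpos kpos /spread_consistentP [M [HR HC]].
set N := chain_size v m in HR HC.
pose w := width v; pose n := v.*2.
have EN : N = m * w + n by [].
have Ew : w = n.+2 by [].
have blk q : q < m -> q.+1 * w = q * w + w /\ q.+1 * w <= m * w.
  by move=> lt; split; [rewrite mulSn addnC | rewrite leq_mul2r lt orbT].
pose A i j := M i j == atom_of 0; pose B i j := M i j == atom_of 1.
have AB i j : A i j + B i j <= 1 by apply: atom_excl.
have AnB i j : A i j -> ~~ B i j by have := AB i j; case: (A i j); case: (B i j).
have BnA i j : B i j -> ~~ A i j by have := AB i j; case: (A i j); case: (B i j).
have rowA i : i < N -> \sum_(0 <= j < N) A i j = chain_row v m inc i 0.
  by move=> lt; rewrite HR.
have rowB i : i < N -> \sum_(0 <= j < N) B i j = chain_row v m inc i 1.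
  by move=> lt; rewrite HR.
have colA j : j < N -> \sum_(0 <= i < N) A i j = chain_col v m inc j 0.
  by move=> lt; rewrite HC.
have colB j : j < N -> \sum_(0 <= i < N) B i j = chain_col v m inc j 1.
  by move=> lt; rewrite HC.
have cutA q : q <= m ->
  (forall i j, q * w + n <= i < N -> j < q * w -> A i j) /\
  (forall i j, i < q * w + n -> q * w <= j < N -> ~~ A i j).
  move=> leq; have leqw : q * w <= m * w by rewrite leq_mul2r leq orbT.
  apply: tight_cut; [lia | lia |].
  rewrite (eq_big_nat _ _ (F2 := fun i => chain_row v m inc i 0)); last first.
    by move=> i Hi; apply: rowA; lia.
  rewrite [X in _ = _ + X](eq_big_nat _ _ (F2 := fun i => chain_col v m inc i 0)); last first.
    by move=> i Hi; apply: colA; lia.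
  exact: chain_cutA.
have cutB q : q < m ->
  (forall i j, i < q.+1 * w -> q * w + n <= j < N -> B i j) /\
  (forall i j, q.+1 * w <= i < N -> j < q * w + n -> ~~ B i j).
  move=> ltq; have [E1 E2] := blk _ ltq.
  have [|||H1 H2] := @tight_cut (fun j i => B i j) N (q * w + n) (q.+1 * w);
    [lia | lia | | by split=> i j Hi Hj; [apply: H1 | apply: H2]].
  rewrite (eq_big_nat _ _ (F2 := fun i => chain_col v m inc i 1)); last first.
    by move=> i Hi; apply: colB; lia.
  rewrite [X in _ = _ + X](eq_big_nat _ _ (F2 := fun i => chain_row v m inc i 1)); last first.
    by move=> i Hi; apply: rowB; lia.
  exact: chain_cutB.
(* The A sum and the B sum of a row of E_q add up to [N], so no cell of it is empty. *)
have fullE q s b : q < m -> s < 2 -> b < n ->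
  A (q * w + (n + s)) (q * w + b) + B (q * w + (n + s)) (q * w + b) = 1.
  move=> ltq lts; have [E1 E2] := blk _ ltq.
  have [A1 A2] := cutA _ (ltnW ltq); have [_ A2'] := cutA _ ltq.
  have [B1 B2] := cutB _ ltq.
  set i := q * w + (n + s).
  apply: (@sum_cell_full (fun b => A i (q * w + b)) (fun b => B i (q * w + b))) => //.
  have ltiN : i < N by rewrite /i; lia.
  have := rowA i ltiN; have := rowB i ltiN.
  rewrite !(@sum_split_block v _ q N); [|by rewrite -/w; lia..].
  rewrite (@sum_true (A i)); last by move=> j Hj; apply: A1; rewrite /i; lia.
  rewrite (@sum_false (B i)); last by move=> j Hj; apply/AnB/A1; rewrite /i; lia.
  rewrite (@sum_false (A i)); last by move=> j Hj; apply: A2'; rewrite /i; lia.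
  rewrite (@sum_true (B i)); last by move=> j Hj; apply: B1; rewrite /i; lia.
  have Bf0 : B i (q * width v + v.*2) by apply: B1; rewrite /i -/w -/n; lia.
  have Bf1 : B i (q * width v + v.*2.+1) by apply: B1; rewrite /i -/w -/n; lia.
  rewrite Bf0 Bf1 (negPf (BnA _ _ Bf0)) (negPf (BnA _ _ Bf1)) -/w.
  set SA := bigop.body _ _ _; set SB := bigop.body _ _ _.
  have -> : N - q.+1 * w = n + (m - q.+1) * w by rewrite mulnBl; lia.
  have -> : (m - q.+1) * w = m * w - q.+1 * w by rewrite mulnBl.
  have := clause_size_le v (inc q); have := kpos _ ltq.
  case: s lts @i ltiN @SA @SB A1 A2 B1 B2 Bf0 Bf1 => [|[|//]] _ i ltiN SA SB _ _ _ _ _ _.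
    rewrite /i addn0 chain_row_e0 chain_row_e0 /= -/w => k1 k2.
    have -> : (m - q) * w = m * w - q * w by rewrite mulnBl.
    rewrite -/n in k2 *; have -> : n = v + v by rewrite /n addnn.
    lia.
  rewrite /i addn1 chain_row_e1 chain_row_e1 /= -/w -/n => k1 k2.
  have -> : (m - q) * w = m * w - q * w by rewrite mulnBl.
  lia.
have fullF q s a : q < m -> s < 2 -> a < n ->
  A (q.+1 * w + a) (q * w + (n + s)) + B (q.+1 * w + a) (q * w + (n + s)) = 1.
  move=> ltq lts; have [E1 E2] := blk _ ltq.
  have [A1 A2] := cutA _ (ltnW ltq); have [A1' A2'] := cutA _ ltq.
  have [B1 B2] := cutB _ ltq.
  set j := q * w + (n + s).
  apply: (@sum_cell_full (fun a => A (q.+1 * w + a) j) (fun a => B (q.+1 * w + a) j)).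
    by move=> a'; apply: AB.
  have ltjN : j < N by rewrite /j; lia.
  have := colA j ltjN; have := colB j ltjN.
  rewrite !(@big_cat_nat _ _ _ (q.+1 * w) 0 N) /=; try lia.
  rewrite !(@sum_split_rails _ (q.+1 * w) n N); try lia.
  rewrite (@sum_true (B^~ j)); last by move=> i Hi; apply: B1; rewrite /j; lia.
  rewrite (@sum_false (A^~ j)); last by move=> i Hi; apply/BnA/B1; rewrite /j; lia.
  rewrite (@sum_true (A^~ j)); last by move=> i Hi; apply: A1'; rewrite /j; lia.
  rewrite (@sum_false (B^~ j)); last by move=> i Hi; apply/AnB/A1'; rewrite /j; lia.
  set SA := bigop.body _ _ _; set SB := bigop.body _ _ _.
  have Emq : (m - q.+1) * w = m * w - q.+1 * w by rewrite mulnBl.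
  case: s lts @j ltjN @SA @SB B1 B2 => [|[|//]] _ j ltjN SA SB _ _.
    rewrite /j !addn0 !chain_col_f0 /= -/w.
    have : n = v + v by rewrite /n addnn.
    lia.
  rewrite /j !addn1 !chain_col_f1 /= -/w -/n.
  lia.
(* The B in the two crossings of a rail with E_q or F_q. The unit on rail [b] is [e q b] minus
   [~~ inc q b], because a rail outside the clause receives one extra B. *)
pose e q b := B (q * w + n) (q * w + b) + B (q * w + n.+1) (q * w + b).
pose f q a := B (q.+1 * w + a) (q * w + n) + B (q.+1 * w + a) (q * w + n.+1).
(* By the cuts, the rail rows of block [q.+1] meet the rail columns of block [q] only in A, and
   those of block [q] meet them only in B. Subtracting all forced cells leaves triangular sums,
   corrected by [e] and [f]. *)
have Drow q a : q < m -> a < n ->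
  \sum_(0 <= b < n) A (q.+1 * w + a) (q * w + b) = a + f q a.
  move=> ltq lta; have [E1 E2] := blk _ ltq.
  have [A1 A2] := cutA _ (ltnW ltq); have [A1' A2'] := cutA _ ltq.
  set i := q.+1 * w + a; have ltiN : i < N by rewrite /i; lia.
  have := rowA i ltiN; rewrite (@sum_split_block v _ q N); last by rewrite -/w; lia.
  rewrite (@sum_true (A i)); last by move=> j Hj; apply: A1; rewrite /i; lia.
  rewrite (@sum_false (A i)); last by move=> j Hj; apply: A2'; rewrite /i; lia.
  have := fullF q 0 a ltq isT lta; have := fullF q 1 a ltq isT lta.
  rewrite {2}/i chain_row_rail //= /f addn0 addn1 -/w -/n -/i.
  lia.
have Dcol q b : q < m -> b < n ->
  \sum_(0 <= a < n) A (q.+1 * w + a) (q * w + b) + ~~ inc q b = n - b.+1 + e q b.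
  move=> ltq ltb; have [E1 E2] := blk _ ltq.
  have [A1 A2] := cutA _ (ltnW ltq); have [A1' A2'] := cutA _ ltq.
  set j := q * w + b; have ltjN : j < N by rewrite /j; lia.
  have := colA j ltjN; rewrite (@sum_split_block v _ q N); last by rewrite -/w; lia.
  rewrite (@sum_false (A^~ j)); last by move=> i Hi; apply: A2; rewrite /j; lia.
  rewrite (@sum_false (fun a => A (q * width v + a) j)); last first.
    by move=> i Hi; apply: A2; rewrite /j -/w; lia.
  rewrite (@sum_split_rails _ (q.+1 * width v) n N); last by rewrite -/w; lia.
  rewrite (@sum_true (A^~ j)); last by move=> i Hi; apply: A1'; rewrite /j -/w in Hi *; lia.
  have := fullE q 0 b ltq isT ltb; have := fullE q 1 b ltq isT ltb.
  rewrite {5}/j chain_col_rail //= ltq /e addn0 addn1 -/w -/n -/j.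
  have -> : (m - q.+1) * w = m * w - q.+1 * w by rewrite mulnBl.
  case: (inc q b) => /=; lia.
have Urow0 a : a < n -> \sum_(0 <= b < n) B a b = a + ~~ odd a.
  move=> lta; have [E1 E2] := blk _ mpos; have [B1 B2] := cutB _ mpos.
  have ltiN : a < N by lia.
  have := rowB a ltiN; rewrite (@big_cat_nat _ _ _ n) /=; [|lia..].
  rewrite (@sum_true (B a) n N); last by move=> j Hj; apply: B1; lia.
  have := @chain_row_rail v m inc 0 a 1 lta; rewrite mul0n add0n => -> /=.
  rewrite -/w; lia.
have Urow q a : q < m -> a < n ->
  \sum_(0 <= b < n) B (q.+1 * w + a) (q.+1 * w + b) + f q a = a.+1.
  move=> ltq lta; have [E1 E2] := blk _ ltq; have [B1 B2] := cutB _ ltq.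
  set i := q.+1 * w + a; have ltiN : i < N by rewrite /i; lia.
  have := rowB i ltiN; rewrite (@sum_split_block v _ q N); last by rewrite -/w; lia.
  rewrite (@sum_false (B i)); last by move=> j Hj; apply: B2; rewrite /i; lia.
  rewrite (@sum_false (fun b => B i (q * width v + b))); last first.
    by move=> j Hj; apply: B2; rewrite /i -/w; lia.
  rewrite (@sum_split_rails _ (q.+1 * width v) n N); last by rewrite -/w; lia.
  rewrite (@sum_true (B i)); last first.
    rewrite -/w => j Hj; have ltq' : q.+1 < m.
      by rewrite -(ltn_pmul2r (isT : 0 < w)); lia.
    have [B1' _] := cutB _ ltq'; have [E3 E4] := blk _ ltq'.
    by apply: B1'; rewrite /i; lia.
  rewrite {4}/i chain_row_rail //= /f -/w -/n -/i.
  have -> : (m - q.+1) * w = m * w - q.+1 * w by rewrite mulnBl.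
  lia.
have Ucol q b : q < m -> b < n ->
  \sum_(0 <= a < n) B (q * w + a) (q * w + b) + e q b = n - b + ~~ inc q b.
  move=> ltq ltb; have [E1 E2] := blk _ ltq; have [B1 B2] := cutB _ ltq.
  set j := q * w + b; have ltjN : j < N by rewrite /j; lia.
  have := colB j ltjN; rewrite (@sum_split_block v _ q N); last by rewrite -/w; lia.
  rewrite (@sum_true (B^~ j)); last first.
    case: q ltq @j ltjN E1 E2 B1 B2 => [|q] ltq j ltjN E1 E2 B1 B2 i Hi.
      by rewrite mul0n in Hi; lia.
    have [B1' _] := cutB _ (ltnW ltq); have [E3 E4] := blk _ (ltnW ltq).
    by apply: B1'; rewrite /j -/w in Hi *; lia.
  rewrite (@sum_false (B^~ j)); last by move=> i Hi; apply: B2; rewrite /j; lia.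
  rewrite {4}/j chain_col_rail //= ltq /e -/w -/n -/j; lia.
have Ucolm b : b < n -> \sum_(0 <= a < n) B (m * w + a) (m * w + b) + ~~ odd b = n - b.
  move=> ltb; have lt1 : m.-1 < m by lia.
  have [E1 E2] := blk _ lt1; have [B1 B2] := cutB _ lt1; rewrite prednK // in E1 B1 B2.
  set j := m * w + b; have ltjN : j < N by rewrite /j; lia.
  have := colB j ltjN; rewrite (@big_cat_nat _ _ _ (m * w)) /=; [|lia..].
  rewrite (@sum_true (B^~ j)); last by move=> i Hi; apply: B1; rewrite /j; lia.
  rewrite EN sum_offset {3}/j chain_col_rail //= ltnn -/w -/n -/j; case: (odd b) => /=; lia.
pose c q l := \sum_(l <= b < n) ~~ inc q b.
pose E q l := \sum_(l <= b < n) e q b.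
(* The units that enter block [q] on the rails from [l] on. *)
pose Z q l := if q is q'.+1 then \sum_(l <= a < n) f q' a else \sum_(l <= a < n) odd a.
have Dle q l : q < m -> l <= n -> Z q.+1 l + c q l <= E q l.
  move=> ltq lel.
  have HC' b : b < n -> \sum_(0 <= a < n) A (q.+1 * w + a) (q * w + b) =
      n - b.+1 + e q b - ~~ inc q b.
    by move=> ltb; rewrite -(Dcol q b ltq ltb) addnK.
  have := staircase_le lel (fun a => Drow q a ltq) HC'.
  have Esum : \sum_(l <= b < n) (n - b.+1 + e q b - ~~ inc q b) + c q l =
      \sum_(l <= b < n) (n - b.+1) + E q l.
    rewrite /c /E -!big_split /=; apply: eq_big_nat => b Hb.
    by rewrite subnK // -(Dcol q b ltq) ?leq_addl //; lia.
  rewrite big_split /= (sum_staircase lel) /Z; move: Esum.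
  move: (bigop.body _ _ _) => X; rewrite /E.
  lia.
have Ule q l : q < m -> l <= n -> E q l <= Z q l + c q l.
  move=> ltq lel.
  have Esum : \sum_(l <= b < n) (n - b + ~~ inc q b - e q b) + E q l =
      \sum_(l <= b < n) (n - b.+1) + (n - l) + c q l.
    have -> : n - l = \sum_(l <= b < n) 1 by rewrite sum_nat_const_nat muln1.
    rewrite /c /E -!big_split /=; apply: eq_big_nat => b Hb.
    have := Ucol q b ltq; lia.
  have Estair : \sum_(l <= a < n) a.+1 = (n - l) * l + \sum_(l <= j < n) (n - j.+1) + (n - l).
    rewrite -(sum_staircase lel).
    have -> : n - l = \sum_(l <= b < n) 1 by rewrite sum_nat_const_nat muln1.
    by rewrite -big_split /=; apply: eq_bigr => i _; rewrite addn1.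
  case: q ltq Esum => [|q] ltq Esum.
    have HC' b : b < n -> \sum_(0 <= a < n) B a b = n - b + ~~ inc 0 b - e 0 b.
      move=> ltb; rewrite -(Ucol 0 b ltq ltb) addnK mul0n add0n.
      by apply: eq_bigr => a _; rewrite add0n.
    have := staircase_le lel Urow0 HC'.
    have : \sum_(l <= a < n) (a + ~~ odd a) + \sum_(l <= a < n) odd a = \sum_(l <= a < n) a.+1.
      by rewrite -big_split /=; apply: eq_bigr => a _; case: (odd a) => /=; lia.
    rewrite /Z; lia.
  have ltq' := ltnW ltq.
  have HR' a : a < n -> \sum_(0 <= b < n) B (q.+1 * w + a) (q.+1 * w + b) = a.+1 - f q a.
    by move=> lta; rewrite -(Urow q a ltq' lta) addnK.
  have HC' b : b < n -> \sum_(0 <= a < n) B (q.+1 * w + a) (q.+1 * w + b) =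
      n - b + ~~ inc q.+1 b - e q.+1 b.
    by move=> ltb; rewrite -(Ucol q.+1 b ltq ltb) addnK.
  have := staircase_le lel HR' HC'.
  have : \sum_(l <= a < n) (a.+1 - f q a) + \sum_(l <= a < n) f q a = \sum_(l <= a < n) a.+1.
    rewrite -big_split /=; apply: eq_big_nat => a Ha.
    by have := Urow q a ltq'; lia.
  rewrite /Z; lia.
(* The other end of the chain: the column sums of the last block ask for units on the even rails. *)
have Mle l : l <= n -> \sum_(l <= b < n) ~~ odd b <= Z m l.
  move=> lel.
  have Esum : \sum_(l <= b < n) (n - b - ~~ odd b) + \sum_(l <= b < n) ~~ odd b =
      \sum_(l <= b < n) (n - b.+1) + (n - l).
    have -> : n - l = \sum_(l <= b < n) 1 by rewrite sum_nat_const_nat muln1.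
    rewrite -!big_split /=; apply: eq_big_nat => b Hb.
    have := Ucolm b; lia.
  have Estair : \sum_(l <= a < n) a.+1 = (n - l) * l + \sum_(l <= j < n) (n - j.+1) + (n - l).
    rewrite -(sum_staircase lel).
    have -> : n - l = \sum_(l <= b < n) 1 by rewrite sum_nat_const_nat muln1.
    by rewrite -big_split /=; apply: eq_bigr => i _; rewrite addn1.
  have [q Eq] : exists q, m = q.+1 by exists m.-1; lia.
  have ltq : q < m by lia.
  have HR' a : a < n -> \sum_(0 <= b < n) B (m * w + a) (m * w + b) = a.+1 - f q a.
    by move=> lta; rewrite -(Urow q a ltq lta) Eq addnK.
  have HC' b : b < n -> \sum_(0 <= a < n) B (m * w + a) (m * w + b) = n - b - ~~ odd b.
    by move=> ltb; rewrite -(Ucolm b ltb) addnK.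
  have := staircase_le lel HR' HC'.
  have : \sum_(l <= a < n) (a.+1 - f q a) + \sum_(l <= a < n) f q a = \sum_(l <= a < n) a.+1.
    rewrite -big_split /=; apply: eq_big_nat => a Ha.
    by have := Urow q a ltq; lia.
  rewrite /Z Eq; lia.
have Zmono q l : q < m -> l <= n -> Z q.+1 l <= Z q l.
  by move=> ltq lel; have := Dle q l ltq lel; have := Ule q l ltq lel; lia.
have Zle0 q l : q <= m -> l <= n -> Z q l <= Z 0 l.
  move=> leq lel; elim: q leq => [//|q IH] ltq.
  by apply: leq_trans (Zmono _ _ ltq lel) (IH _); apply: ltnW.
have Zgem q l : q <= m -> l <= n -> Z m l <= Z q l.
  move=> leq lel; have [d Ed] : exists d, m = q + d by exists (m - q); lia.
  elim: d q leq Ed => [|d IH] q leq Ed; first by rewrite Ed addn0.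
  by apply: leq_trans (IH q.+1 _ _) (Zmono _ _ _ lel); lia.
(* From an even rail on there are as many odd rails as even ones, so the two ends of the decreasing
   sequence [Z] coincide. *)
have Zeven q g : q <= m -> g <= v -> Z q g.*2 = v - g.
  move=> leq leg; have len : g.*2 <= n by rewrite /n leq_double.
  have [O1 O2] := sum_odd_suffix leg.
  have := Zle0 q _ leq len; have := Zgem q _ leq len; have := Mle _ len.
  have -> : Z 0 g.*2 = v - g := O1.
  by rewrite -/n in O2; lia.
have Zodd_ge q g : q <= m -> g < v -> v - g.+1 <= Z q g.*2.+1.
  move=> leq leg; have len : g.*2.+1 <= n by rewrite /n; lia.
  have [O1 O2] := sum_odd_suffix leg.
  have := Zgem q _ leq len; have := Mle _ len.
  have : \sum_(g.+1.*2 <= b < n) ~~ odd b <= \sum_(g.*2.+1 <= b < n) ~~ odd b.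
    by rewrite [X in _ <= X]big_ltn ?doubleS ?leq_addl // /n; lia.
  rewrite /n; lia.
(* Variable [g] is true at clause [q] if the rails from [2g+1] on carry only the units of later
   variables, so that its own unit is on the even rail [2g]. *)
exists (fun q g => E q g.*2.+1 <= c q g.*2.+1 + (v - g.+1)); split.
- move=> q g ltq ltg le1; have len : g.*2.+1 <= n by rewrite /n; lia.
  have := Dle q _ (ltnW ltq) len; have := Ule q.+1 _ ltq len; lia.
- move=> q ltq.
  (* Pigeonhole in the second row of E_q: it has more B on the rails than there are rails outside
     the clause. *)
  have [b [ltb incb Bb]] : exists b, [/\ b < n, inc q b & B (q * w + n.+1) (q * w + b)].
    have [A1 A2] := cutA _ (ltnW ltq); have [_ A2'] := cutA _ ltq.
    have [B1 B2] := cutB _ ltq; have [E1 E2] := blk _ ltq.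
    set i := q * w + n.+1; have ltiN : i < N by rewrite /i; lia.
    have := rowB i ltiN; rewrite (@sum_split_block v _ q N); last by rewrite -/w; lia.
    rewrite (@sum_false (B i)); last by move=> j Hj; apply/AnB/A1; rewrite /i; lia.
    rewrite (@sum_true (B i)); last by move=> j Hj; apply: B1; rewrite /i; lia.
    rewrite !B1; [|rewrite /i -/w -/n; lia..].
    rewrite {2}/i chain_row_e1 /= -/w -/n.
    have -> : (m - q) * w = m * w - q * w by rewrite mulnBl.
    move=> Esum.
    have lek := clause_size_le v (inc q).
    have Hlt : \sum_(0 <= b < n) ~~ inc q b < \sum_(0 <= b < n) B i (q * w + b).
      have : \sum_(0 <= b < n) ~~ inc q b + clause_size v (inc q) = n.
        rewrite /clause_size -big_split /= (eq_bigr (fun=> 1)).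
          by rewrite sum_nat_const_nat subn0 muln1.
        by move=> b _; case: (inc q b).
      by rewrite -/n in lek *; lia.
    case: (boolP [exists b : 'I_n, inc q b && B i (q * w + b)]) => [/existsP[b /andP[]]|].
      by exists b.
    rewrite negb_exists => /forallP none; exfalso; move: Hlt; rewrite ltnNge => /negP[].
    rewrite [X in X <= _]big_nat [X in _ <= X]big_nat; apply: leq_sum => b /andP[_ ltb].
    by have := none (Ordinal ltb); rewrite /=; case: (inc q b); case: (B i _).
  exists b; split=> //.
  have ltg : b./2 < v by move: ltb; rewrite /n; lia.
  have len2 : b./2.*2 <= n by rewrite /n; lia.
  have len1 : b./2.*2.+1 <= n by rewrite /n; lia.
  have len3 : b./2.+1.*2 <= n by rewrite /n; lia.
  have := Ule q _ ltq len2; rewrite Zeven ?(ltnW ltq) ?(ltnW ltg) //.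
  have := Dle q _ ltq len3; rewrite Zeven //.
  have := Dle q _ ltq len1; have := Zodd_ge q.+1 _ ltq ltg.
  (* Rail [b] is incident, so this B is not an extra one: it is the single unit of its pair, and the
     parity of [b] gives the value of the variable. *)
  have eb : 0 < e q b by rewrite /e Bb addn1.
  rewrite /E /c [\sum_(b./2.*2 <= _ < _) e _ _]big_ltn //.
  rewrite [\sum_(b./2.*2 <= _ < _) ~~ _]big_ltn //.
  have Es : b./2.+1.*2 = b./2.*2.+2 by rewrite doubleS.
  case: (boolP (odd b)) => ob /=.
    have Eb : b = b./2.*2.+1 by rewrite -{1}(odd_double_half b) ob.
    rewrite [\sum_(b./2.*2.+1 <= _ < _) e _ _]big_ltn -?Eb //.
    rewrite [\sum_(b <= _ < _) ~~ _]big_ltn // incb Es -Eb /= => H1 H2 H3 H4.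
    by apply/negbTE; rewrite -ltnNge; lia.
  have Eb : b = b./2.*2 by rewrite -{1}(odd_double_half b) (negPf ob).
  rewrite -Eb incb /= => H1 H2 H3 H4; lia.
Qed.

(** * A matrix from a satisfying assignment *)

Lemma sum_lt n a : a <= n -> \sum_(0 <= b < n) (b < a) = a.
Proof.
move=> le; rewrite (@big_cat_nat _ _ _ a) //=.
by rewrite (@sum_true (fun b => b < a)) ?(@sum_false (fun b => b < a)); lia.
Qed.

Lemma sum_gt n b : b < n -> \sum_(0 <= a < n) (b < a) = n - b.+1.
Proof.
move=> le; rewrite (@big_cat_nat _ _ _ b.+1) //=.
by rewrite (@sum_false (fun a => b < a)) ?(@sum_true (fun a => b < a)); lia.
Qed.

Lemma sum_delta n a (c : nat -> bool) : a < n ->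
  \sum_(0 <= b < n) ((b == a) && c b) = c a.
Proof.
move=> lt; rewrite (@big_cat_nat _ _ _ a) ?(ltnW lt) //=.
rewrite (@sum_false (fun b => (b == a) && c b)); last by move=> i Hi; lia.
rewrite big_ltn // eqxx (@sum_false (fun b => (b == a) && c b)) ?addn0 //.
by move=> i Hi; lia.
Qed.

(** Units enter on the rails [z] and leave on the rails [y]. To the strict triangle one adds a
    diagonal cell for a rail without a unit on either side. If a unit passes from the odd to the
    even rail, row [2g] and column [2g+1] each lack an entry, and one cell above the diagonal
    supplies both. The reverse passage would need cell [(2g+1, 2g)], which the triangle already
    occupies: hence monotonicity. *)
Definition core (z y : nat -> bool) a b :=
  [|| b < a, [&& b == a, ~~ z a & ~~ y a] | [&& ~~ odd a, b == a.+1, ~~ z a & y a]].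

Definition rails (z : nat -> bool) := forall g, z g.*2.+1 = ~~ z g.*2.

Lemma rails_odd z b : rails z -> odd b -> z b = ~~ z b.-1.
Proof.
move=> Hz ob; have -> : b = b./2.*2.+1 by rewrite -{1}(odd_double_half b) ob.
by rewrite Hz.
Qed.

Lemma core_row z y v a : rails z -> rails y -> (forall g, z g.*2 -> y g.*2) ->
  a < v.*2 -> \sum_(0 <= b < v.*2) core z y a b = a + ~~ z a.
Proof.
move=> Hz Hy Hzy lta.
have E b : core z y a b = (b < a) + ((b == a) && (~~ z a && ~~ y a)) +
    ((b == a.+1) && (~~ odd a && (~~ z a && y a))) :> nat.
  by rewrite /core; case: (z a); case: (y a); lia.
under eq_bigr do rewrite E; rewrite !big_split /= sum_lt ?(ltnW lta) //.
rewrite (@sum_delta _ _ (fun=> _)) //; case: (boolP (odd a)) => oa.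
  rewrite (@sum_false (fun b => _)); last by move=> *; rewrite andbF.
  have Ha : ~~ z a -> ~~ y a.
    by rewrite (rails_odd Hz oa) (rails_odd Hy oa) !negbK (_ : a.-1 = a.-1./2.*2); [apply: Hzy | lia].
  by move: Ha; case: (z a); case: (y a) => /= H; try lia; have := H isT.
have lt1 : a.+1 < v.*2.
  by rewrite ltn_neqAle lta andbT; apply: contraNneq oa => /(congr1 odd) /=; rewrite odd_double; case: odd.
rewrite (@sum_delta _ _ (fun=> _)) //=.
by case: (z a); case: (y a) => /=; lia.
Qed.

Lemma core_col z y v b : rails z -> rails y -> (forall g, z g.*2 -> y g.*2) ->
  b < v.*2 -> \sum_(0 <= a < v.*2) core z y a b = v.*2 - b.+1 + ~~ y b.
Proof.
move=> Hz Hy Hzy ltb.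
have E a : core z y a b = (b < a) + ((a == b) && (~~ z b && ~~ y b)) +
    ((a == b.-1) && (odd b && (~~ z b.-1 && y b.-1))) :> nat.
  rewrite /core; case: (eqVneq a b) => [->|nab].
    by case: (z b); case: (y b); case: (z b.-1); case: (y b.-1); lia.
  case: (eqVneq a b.-1) => [->|nab1]; last by case: (z a); case: (y a); case: (z b.-1); case: (y b.-1); lia.
  by case: (z b.-1); case: (y b.-1); lia.
under eq_bigr do rewrite E; rewrite !big_split /= sum_gt //.
rewrite (@sum_delta _ _ (fun=> _)) // (@sum_delta _ _ (fun=> _)); last by lia.
case: (boolP (odd b)) => ob /=.
  have := Hzy b.-1./2; rewrite (_ : b.-1./2.*2 = b.-1); last by lia.
  have := rails_odd Hz ob; have := rails_odd Hy ob.
  by case: (z b); case: (y b); case: (z b.-1); case: (y b.-1) => //= _ _ H; try lia; have := H isT.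
have := Hzy b./2; rewrite (_ : b./2.*2 = b); last by lia.
by case: (z b); case: (y b) => /= H; try lia; have := H isT.
Qed.

Lemma sum_rails z v : rails z -> \sum_(0 <= b < v.*2) z b = v.
Proof.
move=> Hz; rewrite sum_double (eq_bigr (fun=> 1)).
  by rewrite sum_nat_const_nat subn0 muln1.
by move=> i _; rewrite Hz; case: (z _).
Qed.

Lemma sum_neg n (F : nat -> bool) :
  \sum_(0 <= b < n) ~~ F b + \sum_(0 <= b < n) F b = n.
Proof.
rewrite -big_split /= (eq_bigr (fun=> 1)); first by rewrite sum_nat_const_nat subn0 muln1.
by move=> b _; case: (F b).
Qed.

Lemma sum_remove n (F : nat -> bool) c : c < n -> F c ->
  \sum_(0 <= b < n) (F b && (b != c)) + 1 = \sum_(0 <= b < n) F b.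
Proof.
move=> lt Fc; rewrite -[1](_ : nat_of_bool (F c) = 1); last by rewrite Fc.
rewrite -(@sum_delta n c F lt) -big_split /=; apply: eq_bigr => b _.
by case: (b == c); case: (F b).
Qed.

Lemma sum_add n (F : nat -> bool) c : c < n -> ~~ F c ->
  \sum_(0 <= b < n) (F b || (b == c)) = (\sum_(0 <= b < n) F b).+1.
Proof.
move=> lt Fc; rewrite -addn1 -[1](_ : nat_of_bool (~~ F c) = 1); last by rewrite Fc.
rewrite -(@sum_delta n c (fun b => ~~ F b) lt) -big_split /=; apply: eq_bigr => b _.
by case: (b == c); case: (F b).
Qed.

Lemma sum_const_atom (F : nat -> option bool) c k x y :
  (forall j, x <= j < y -> F j = Some c) ->
  \sum_(x <= j < y) (F j == atom_of k) = if c == (k == 1) then y - x else 0.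
Proof.
move=> H; rewrite (eq_big_nat _ _ (F2 := fun=> nat_of_bool (c == (k == 1)))).
  by rewrite sum_nat_const_nat; case: (c == _); rewrite ?muln1 ?muln0.
by move=> j /H->.
Qed.

Lemma sum_if_atom (F : nat -> option bool) (P : nat -> bool) c k n :
  (forall b, b < n -> F b = if P b then Some c else None) ->
  \sum_(0 <= b < n) (F b == atom_of k) =
  if c == (k == 1) then \sum_(0 <= b < n) P b else 0.
Proof.
move=> H; rewrite (eq_big_nat _ _ (F2 := fun b => nat_of_bool (P b && (c == (k == 1))))).
  case: (c == _); first by under eq_bigr do rewrite andbT.
  by rewrite big1 // => b _; rewrite andbF.
by move=> b /andP[_ /H->]; case: (P b).
Qed.

Lemma sum_choose_atom (F : nat -> option bool) (P : nat -> bool) k n : k < 2 ->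
  (forall b, b < n -> F b = Some (P b)) ->
  \sum_(0 <= b < n) (F b == atom_of k) =
  if k == 1 then \sum_(0 <= b < n) P b else \sum_(0 <= b < n) ~~ P b.
Proof.
move=> ltk H; rewrite (eq_big_nat _ _ (F2 := fun b => nat_of_bool (P b == (k == 1)))).
  case: (k == 1); first by under eq_bigr do rewrite eqb_id.
  by under eq_bigr do rewrite eqbF_neg.
by move=> b /andP[_ /H->].
Qed.

(** A single assignment serves all clauses. Units move only in block 0, which turns the all-odd
    start into [x], and in block [m], which turns [x] into the all-even end. *)
Lemma chain_complete v m (inc : nat -> nat -> bool) (x : nat -> bool) : 0 < v -> 0 < m ->
  (forall q, q < m -> exists b, [/\ b < v.*2, inc q b & x b./2 = ~~ odd b]) ->
  consistent two_squares (chain_instance v m inc).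
Proof.
move=> vpos mpos sat; apply/spread_consistentP.
set N := chain_size v m.
pose w := width v; pose n := v.*2.
have EN : N = m * w + n by [].
have Ew : w = n.+2 by [].
have w0 : 0 < w by [].
have blk q : q < m -> q.+1 * w = q * w + w /\ q.+1 * w <= m * w.
  by move=> lt; split; [rewrite mulSn addnC | rewrite leq_mul2r lt orbT].
pose X b := x b./2 == ~~ odd b.
have RX : rails X.
  move=> g; rewrite /X /= odd_double /= uphalf_double doubleK; by case: (x g).
have Rodd : rails odd by move=> g; rewrite /= odd_double.
have Reven : rails (fun b => ~~ odd b) by move=> g; rewrite /= odd_double.
(* The first true rail of clause [q]. The second row of E_q has its B there and outside the clause,
   the first row on the remaining true rails. *)
pose vis q := find (fun b => inc q b && X b) (iota 0 n).
have visP q : q < m -> [/\ vis q < n, inc q (vis q) & X (vis q)].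
  move=> ltq; have [b [ltb ib xb]] := sat q ltq.
  have Hh : has (fun b => inc q b && X b) (iota 0 n).
    by apply/hasP; exists b; [rewrite mem_iota | rewrite ib /X xb eqxx].
  have lt := Hh; rewrite has_find size_iota in lt.
  by have := nth_find 0 Hh; rewrite -/(vis q) nth_iota // add0n => /andP[].
pose z q a := if q == 0 then odd a else X a.
pose y q a := if q < m then X a else ~~ odd a.
have Rz q : rails (z q) by rewrite /z; case: (q == 0).
have Ry q : rails (y q) by rewrite /y; case: (q < m).
have zy q g : z q g.*2 -> y q g.*2.
  by rewrite /z /y; case: (q == 0); case: (q < m) => //; rewrite odd_double.
pose cA : option bool := Some false; pose cB : option bool := Some true.
(* Row line [a] of block [q] against column line [b] of block [p]. For a rail row, [p.+1 == q] gives
   the A-triangle and the columns F, and [p == q] the B-triangle; for a row of E_q only [p == q] is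
   not constant. *)
pose cell q a p b :=
  if a < n then
    if p.+1 < q then cA
    else if p.+1 == q then
      if b < n then (if (b < a) || ((b == a) && X a) then cA else None)
      else if b == n then (if X a then cB else cA) else cA
    else if p == q then
      if b < n then (if core (z q) (y q) a b then cB else None) else cB
    else cB
  else if p < q then cA
  else if p == q then
    if b < n then
      if a == n then (if X b && (b != vis q) then cB else cA)
      else (if ~~ inc q b || (b == vis q) then cB else cA)
    else cB
  else cB.
pose M i j := cell (i %/ w) (i %% w) (j %/ w) (j %% w).
have ME q a j : a < w -> M (q * w + a) j = cell q a (j %/ w) (j %% w).
  by move=> lta; rewrite /M divnMDl // modnMDl divn_small // modn_small // addn0.
have MEr i p b : b < w -> M i (p * w + b) = cell (i %/ w) (i %% w) p b.
  by move=> ltb; rewrite /M (divnMDl p b w0) (modnMDl p) (divn_small ltb) (modn_small ltb) addn0.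
have ltnw : n < w by rewrite Ew; lia.
have ltnw1 : n.+1 < w by rewrite Ew; lia.
have divlt i q : i < q * w -> i %/ w < q by rewrite ltn_divLR.
have divge i q : q * w <= i -> q <= i %/ w by rewrite leq_divRL.
have tail q : q < m -> N - q.+1 * w = (m - q.+1) * w + n.
  by move=> ltq; have := blk q ltq; rewrite mulnBl EN; lia.
have tail0 q : q <= m -> N - (q * w + n) = (m - q) * w.
  by move=> leq; rewrite EN subnDr mulnBl.
have kE q : q < m -> clause_size v (inc q) + \sum_(0 <= b < n) ~~ inc q b = n.
  by move=> ltq; rewrite addnC; apply: sum_neg.
have Mrow q a j : a < w -> M (q * w + a) j = cell q a (j %/ w) (j %% w) := ME q a j.
have divE j : j = j %/ w * w + j %% w by apply: divn_eq.
have divEq j q : j %/ w = q -> j = q * w + j %% w by move=> <-.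
have modlt j : j %% w < w by rewrite ltn_mod.
have kcase k : k < 2 -> k = 0 \/ k = 1 by lia.
have lediv q q' : q <= q' -> q * w <= q' * w by move=> le; rewrite leq_mul2r le orbT.
have cellqq q : ((q.+1 < q) = false) * ((q.+1 == q) = false) by split; lia.
have sumD a : a < n -> \sum_(0 <= b < n) ((b < a) || (b == a) && X a) = a + X a.
  move=> lta; rewrite -[X in X + _](@sum_lt n a) ?(ltnW lta) //.
  rewrite -(@sum_delta n a (fun=> X a)) // -big_split /=; apply: eq_bigr => b _.
  by case: (X a); lia.
have sumD' b : b < n -> \sum_(0 <= a < n) ((b < a) || (b == a) && X a) = n - b.+1 + X b.
  move=> ltb; rewrite -(@sum_gt n b) // -(@sum_delta n b X) // -big_split /=.
  by apply: eq_bigr => a _; case: (eqVneq a b) => [->|]; case: (X _); lia.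
have SX : \sum_(0 <= b < n) X b = v by apply: sum_rails.
have SnX : \sum_(0 <= b < n) ~~ X b = v.
  by have := sum_neg n X; rewrite SX /n; lia.
exists M; split=> [i k ltiN ltk|j k ltjN ltk].
- set q := i %/ w; set a := i %% w.
  have Ei : i = q * w + a by apply: divn_eq.
  have lta : a < w by apply: modlt.
  have leqm : q <= m.
    by rewrite leqNgt; apply/negP => /lediv; rewrite mulSn; lia.
  case: (ltnP a n) => [ltan|lean].
    rewrite Ei chain_row_rail //.
    case Eq: q => [|p].
      rewrite (@big_cat_nat _ _ _ n) /=; [|lia..].
      rewrite (@sum_if_atom _ (core (z 0) (y 0) a) true); last first.
        move=> b ltb; rewrite Mrow // divn_small ?modn_small; [|lia..].
        by rewrite /cell ltan ltb.
      rewrite (core_row (Rz 0) (Ry 0) (zy 0) ltan) (@sum_const_atom _ true); last first.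
        move=> j Hj; rewrite Mrow //; have := divE j; rewrite /cell ltan /=.
        by case: (j %/ w) => [|p'] /= Ej; rewrite ?ifN //; lia.
      by rewrite /z; case: (kcase _ ltk) => -> /=; rewrite -/w; lia.
    have ltp : p < m by lia.
    have [E1 E2] := blk p ltp.
    have M1 j : j < p * w -> M (p.+1 * w + a) j = cA.
      by move=> /divlt lt; rewrite Mrow // /cell ltan ltnS lt.
    have M2 b : b < w -> M (p.+1 * w + a) (p * w + b) = cell p.+1 a p b.
      by move=> ltb; rewrite MEr // divnMDl // modnMDl divn_small // modn_small // addn0.
    have M3 b : b < n -> M (p.+1 * w + a) (p.+1 * w + b) =
        if core (z p.+1) (y p.+1) a b then cB else None.
      move=> ltb; rewrite MEr; last by lia.
      rewrite divnMDl // modnMDl divn_small // modn_small // addn0 /cell ltan ltb.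
      have -> : (p.+2 < p.+1) = false by lia.
      have -> : (p.+2 == p.+1) = false by lia.
      by rewrite eqxx.
    have M4 j : p.+1 * w + n <= j -> M (p.+1 * w + a) j = cB.
      move=> lej; rewrite Mrow //; have Ej := divE j.
      have := divge j p.+1; rewrite (leq_trans (leq_addr _ _) lej) => /(_ isT) leq.
      rewrite /cell ltan; have -> : ((j %/ w).+1 < p.+1) = false by lia.
      have -> : ((j %/ w).+1 == p.+1) = false by lia.
      case: eqP => // Ejq.
      by rewrite Ejq in Ej; rewrite ifN //; lia.
    rewrite (@sum_split_block v _ p); last by rewrite -/w; lia.
    rewrite (@sum_split_rails _ (p.+1 * width v) n); last by rewrite -/w; lia.
    rewrite (@sum_const_atom _ false _ 0 (p * width v)) -/w; last by move=> j Hj; apply: M1; lia.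
    rewrite (@sum_const_atom _ true _ (p.+1 * w + n)); last by move=> j Hj; apply: M4; lia.
    rewrite (@sum_if_atom (fun b => M (p.+1 * w + a) (p * w + b))
      (fun b => (b < a) || (b == a) && X a) false); last first.
      move=> b ltb; rewrite M2; last by lia.
      by rewrite /cell ltan ltnn eqxx ltb.
    rewrite (@sum_if_atom _ (core (z p.+1) (y p.+1) a) true); last by move=> b ltb; rewrite M3.
    rewrite (core_row (Rz p.+1) (Ry p.+1) (zy p.+1) ltan) sumD // -/n !M2 //.
    rewrite {1 2}/cell ltan !ltnn !eqxx.
    have -> : (n.+1 < n) = false by lia.
    have -> : (n.+1 == n) = false by lia.
    rewrite {1}/z /= tail0 // subn0 mulnBl.
    case: (kcase _ ltk) => -> /=; case: (X a) => /=; lia.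
  have ltq : q < m.
    by rewrite ltn_neqAle leqm andbT; apply/eqP => Eq; rewrite Eq in Ei; lia.
  have [E1 E2] := blk q ltq; have [vis1 vis2 vis3] := visP q ltq.
  have nlt : (a < n) = false by lia.
  have M1 j : j < q * w -> M (q * w + a) j = cA.
    by move=> /divlt lt; rewrite Mrow // /cell nlt lt.
  have M2 b : b < w -> M (q * w + a) (q * w + b) = cell q a q b.
    by move=> ltb; rewrite MEr // divnMDl // modnMDl divn_small // modn_small // addn0.
  have M3 j : q.+1 * w <= j -> M (q * w + a) j = cB.
    by move=> /divge leq; rewrite Mrow // /cell nlt !ifN //; lia.
  rewrite Ei (@sum_split_block v _ q); last by rewrite -/w; lia.
  rewrite (@sum_const_atom _ false _ 0 (q * width v)) -/w; last by move=> j Hj; apply: M1; lia.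
  rewrite (@sum_const_atom _ true _ (q.+1 * w)); last by move=> j Hj; apply: M3; lia.
  rewrite !M2 -/n; [|lia..].
  rewrite {1 2}/cell nlt !ltnn eqxx [n.+1 < n]ltnNge leqnSn /=.
  rewrite subn0 tail // mulnBl.
  case: (eqVneq a n) => [Ea|nEa].
    rewrite Ea chain_row_e0 -/w (@sum_choose_atom _ (fun b => X b && (b != vis q))) //; last first.
      move=> b ltb; rewrite -Ea M2; last by lia.
      by rewrite /cell nlt ltnn !eqxx ltb Ea eqxx; case: (X b && _).
    have S1 := sum_remove vis1 vis3; have S2 := sum_neg n (fun b => X b && (b != vis q)).
    rewrite SX in S1; rewrite mulnBl; have En : n = v + v by rewrite /n addnn.
    case: (kcase _ ltk) => -> /=; lia.
  have Ea : a = n.+1 by lia.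
  rewrite Ea chain_row_e1 -/w (@sum_choose_atom _ (fun b => ~~ inc q b || (b == vis q))) //; last first.
    move=> b ltb; rewrite -Ea M2; last by lia.
    by rewrite /cell nlt ltnn !eqxx ltb Ea [n.+1 == n]gtn_eqF //; case: (~~ inc q b || _).
  have S1 := @sum_add n (fun b => ~~ inc q b) _ vis1; rewrite vis2 in S1.
  have {S1} S1 := S1 isT.
  have S2 := sum_neg n (fun b => ~~ inc q b || (b == vis q)); have S3 := kE q ltq.
  rewrite mulnBl -/n; case: (kcase _ ltk) => -> /=; lia.
- set q := j %/ w; set b := j %% w.
  have Ej : j = q * w + b by apply: divn_eq.
  have ltb : b < w by apply: modlt.
  have leqm : q <= m.
    by rewrite leqNgt; apply/negP => /lediv; rewrite mulSn; lia.
  have Mb i : M i j = cell (i %/ w) (i %% w) q b by [].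
  have M1 i : i < q * w -> M i j = cB.
    move=> /divlt lt; rewrite Mb /cell.
    have -> : (q.+1 < i %/ w) = false by lia.
    have -> : (q.+1 == i %/ w) = false by lia.
    have -> : (q == i %/ w) = false by lia.
    have -> : (q < i %/ w) = false by lia.
    by case: ifP.
  have M2 q' a : a < w -> M (q' * w + a) j = cell q' a q b.
    by move=> lta; rewrite Mrow.
  case: (ltnP b n) => [ltbn|lebn].
    rewrite [in LHS]Ej chain_col_rail //.
    case: (ltnP q m) => [ltq|geq]; last first.
      have Eq : q = m by lia.
      rewrite (@big_cat_nat _ _ _ (q * w)) /=; [|rewrite ?EN Eq; lia..].
      rewrite (@sum_const_atom _ true _ 0 (q * w)); last by move=> i Hi; apply: M1; lia.
      rewrite EN -Eq sum_offset (@sum_if_atom _ (fun a => core (z q) (y q) a b) true); last first.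
        move=> a lta; rewrite M2; last by lia.
        by rewrite /cell lta !cellqq eqxx ltbn.
      rewrite (core_col (Rz q) (Ry q) (zy q) ltbn) /y ltnNge Eq leqnn /= subn0.
      by case: (kcase _ ltk) => -> //=; rewrite -/w -/n; case: (odd b) => /=; lia.
    have [E1 E2] := blk q ltq; have [vis1 vis2 vis3] := visP q ltq.
    rewrite (@sum_split_block v _ q); last by rewrite -/w; lia.
    rewrite (@sum_split_rails _ (q.+1 * width v) n); last by rewrite -/w; lia.
    rewrite (@sum_const_atom _ true _ 0 (q * width v)) -/w; last by move=> i Hi; apply: M1; lia.
    rewrite (@sum_const_atom _ false _ (q.+1 * w + n)); last first.
      move=> i Hi; rewrite Mb; have Ei := divE i.
      have := divge i q.+1; rewrite (leq_trans (leq_addr _ _) (proj1 (andP Hi))) => /(_ isT) leq.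
      rewrite /cell; case: ifP => lti; last by rewrite leq.
      have -> // : q.+1 < i %/ w; case: (ltnP q.+1 (i %/ w)) => // geq.
      have Ediv : i %/ w = q.+1 by lia.
      by rewrite Ediv in Ei; lia.
    rewrite (@sum_if_atom (fun a => M (q * w + a) j) (fun a => core (z q) (y q) a b) true); last first.
      move=> a lta; rewrite M2; last by lia.
      by rewrite /cell lta !cellqq eqxx ltbn.
    rewrite (@sum_if_atom _ (fun a => (b < a) || (b == a) && X a) false); last first.
      move=> a lta; rewrite M2; last by lia.
      by rewrite /cell lta ltnn eqxx ltbn.
    rewrite (core_col (Rz q) (Ry q) (zy q) ltbn) sumD' // -/n !M2; [|lia..].
    rewrite /cell !ltnn !eqxx ltbn [n.+1 < n]ltnNge leqnSn /= [n.+1 == n]gtn_eqF //.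
    rewrite {1}/y ltq tail0 // subn0 /=.
    (* At the rail [vis q] the second row supplies the B that the first row gives up. *)
    have : X b && (b != vis q) + (~~ inc q b || (b == vis q)) = X b + ~~ inc q b :> nat.
      by case: (eqVneq b (vis q)) => [->|]; rewrite ?vis2 ?vis3 //= andbT orbF.
    case: (kcase _ ltk) => -> /=;
    case: (X b && _); case: (~~ inc q b || _); case: (X b); case: (inc q b) => //= _; lia.
  have ltq : q < m.
    by rewrite ltn_neqAle leqm andbT; apply/eqP => Eq; rewrite Eq in Ej; lia.
  have nlt : (b < n) = false by lia.
  have [E1 E2] := blk q ltq.
  rewrite (@big_cat_nat _ _ _ (q.+1 * w)) /=; [|lia..].
  rewrite (@sum_split_rails _ (q.+1 * w) n); last by lia.
  rewrite (@sum_const_atom _ true _ 0 (q.+1 * w)); last first.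
    move=> i /andP[_ lti]; case: (ltnP i (q * w)) => [/M1 //|gei].
    rewrite Mb /cell nlt; have := divge _ _ gei; have := divlt _ _ lti.
    move=> l1 l2; have -> : i %/ w = q by lia.
    by rewrite ltnn eqxx !cellqq; case: ifP.
  rewrite (@sum_const_atom _ false _ (q.+1 * w + n)); last first.
    move=> i Hi; rewrite Mb; have Ei := divE i.
    have := divge i q.+1; rewrite (leq_trans (leq_addr _ _) (proj1 (andP Hi))) => /(_ isT) leq.
    rewrite /cell; case: ifP => lti; last by rewrite leq.
    have -> // : q.+1 < i %/ w; case: (ltnP q.+1 (i %/ w)) => // geq.
    have Ediv : i %/ w = q.+1 by lia.
    by rewrite Ediv in Ei; lia.
  rewrite tail0 // subn0.
  case: (eqVneq b n) => [Eb|nEb].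
    rewrite [in LHS]Ej Eb chain_col_f0 -/w (@sum_choose_atom _ X) //; last first.
      move=> a lta; rewrite M2; last by lia.
      by rewrite /cell lta ltnn eqxx nlt Eb eqxx; case: (X a).
    rewrite SX SnX; case: (kcase _ ltk) => -> /=; lia.
  have Eb : b = n.+1 by lia.
  rewrite [in LHS]Ej Eb chain_col_f1 -/w -/n (@sum_choose_atom _ (fun=> false)) //; last first.
    move=> a lta; rewrite M2; last by lia.
    by rewrite /cell lta ltnn eqxx nlt ifN.
  rewrite big1 // (@sum_true (fun=> true)) // subn0.
  by case: (kcase _ ltk) => -> /=; lia.
Qed.

(** * Clauses and tableaux *)

Definition fact (L : finType) := (nat * nat * L)%type.
Definition literal (L : finType) := (bool * fact L)%type.

Definition fvar (L : finType) W (f : fact L) : nat :=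
  (f.1.1 * W + f.1.2) * #|L| + enum_rank f.2.

(** Positive literals get the even rails, towards which the units move. *)
Definition rail (L : finType) W (l : literal L) : nat := (fvar W l.2).*2 + ~~ l.1.

Definition num_vars (L : finType) T W := T.+1 * W * #|L|.

Definition in_range (L : finType) T W (l : literal L) :=
  (l.2.1.1 <= T) && (l.2.1.2 < W).

Definition incidence (L : finType) W (cs : seq (seq (literal L))) q b : bool :=
  has (fun l => rail W l == b) (nth [::] cs q).

Definition sat_clause (L : finType) (S : fact L -> bool) (c : seq (literal L)) : bool :=
  has (fun l => S l.2 == l.1) c.

Definition subfacts (L : finType) (S S' : fact L -> bool) := forall f, S f -> S' f.

(* The facts may only switch from false to true while the clauses are read. *)
Fixpoint mono_path (L : finType) (S : fact L -> bool) (cs : seq (seq (literal L)))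
    (S' : fact L -> bool) : Prop :=
  if cs is c :: cs' then
    exists S1, [/\ subfacts S S1, sat_clause S1 c & mono_path S1 cs' S']
  else subfacts S S'.

Lemma fvar_lt (L : finType) T W (f : fact L) : f.1.1 <= T -> f.1.2 < W ->
  fvar W f < num_vars L T W.
Proof.
case: f => [[t p] g] /= let_ ltp; rewrite /fvar /num_vars /=.
have ltg := ltn_ord (enum_rank g).
apply: (@leq_trans ((t * W + p).+1 * #|L|)); first by rewrite mulSn addnC ltn_add2r.
rewrite leq_mul2r; apply/orP; right.
by apply: (@leq_trans (t.+1 * W)); [rewrite mulSn addnC ltn_add2r | rewrite leq_mul2r ltnS let_ orbT].
Qed.

Lemma rail_lt (L : finType) T W (l : literal L) : in_range T W l ->
  rail W l < (num_vars L T W).*2.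
Proof.
by case/andP => l1 l2; have := fvar_lt l1 l2; rewrite /rail; case: (l.1) => /=; lia.
Qed.

Lemma half_rail (L : finType) W (l : literal L) : (rail W l)./2 = fvar W l.2.
Proof. by rewrite /rail; move: (fvar _ _) => u; case: (l.1) => /=; lia. Qed.

Lemma clause_size_gt0 (L : finType) T W (cs : seq (seq (literal L))) q :
  q < size cs -> all (fun c => (c != [::]) && all (in_range T W) c) cs ->
  0 < clause_size (num_vars L T W) (incidence W cs q).
Proof.
move=> ltq /allP /(_ _ (mem_nth [::] ltq)); rewrite /clause_size /incidence.
case: (nth [::] cs q) => [//|l c] /= /andP[rl _].
have ltr := rail_lt rl.
rewrite (@big_cat_nat _ _ _ (rail W l)) ?(ltnW ltr) //= [X in _ + X]big_ltn //= eqxx /=; lia.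
Qed.

Lemma mono_path_weaken (L : finType) (S0 S S' : fact L -> bool) cs :
  subfacts S0 S -> mono_path S cs S' -> mono_path S0 cs S'.
Proof.
move=> S0S; case: cs => [|c cs] /=; first by move=> SS' f /S0S /SS'.
by move=> [S1 [SS1 sat H]]; exists S1; split=> // f /S0S /SS1.
Qed.

(** Nothing is known after the last clause, hence the final state that contains every fact. *)
Lemma mono_path_of_states (L : finType) (x : nat -> fact L -> bool)
    (cs : seq (seq (literal L))) k :
  (forall q, k <= q -> q.+1 < k + size cs -> subfacts (x q) (x q.+1)) ->
  (forall q, q < size cs -> sat_clause (x (k + q)) (nth [::] cs q)) ->
  mono_path (x k) cs (fun=> true).
Proof.
elim: cs k => [|c cs IH] k mon sat //=.
exists (x k); split=> //; first by have := sat 0 isT; rewrite addn0.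
have H : mono_path (x k.+1) cs (fun=> true).
  apply: IH => [q lekq ltq|q ltq]; first by apply: mon; rewrite /=; lia.
  by have := sat q.+1 ltq; rewrite addnS.
case: cs {IH sat} mon H => [//|c' cs] mon H.
by apply: mono_path_weaken H; apply: mon; rewrite /=; lia.
Qed.

Lemma mono_path_sub (L : finType) (S S' : fact L -> bool) cs :
  mono_path S cs S' -> subfacts S S'.
Proof.
elim: cs S => [//|c cs IH] S /= [S1 [SS1 _ /IH S1S']] f /SS1; exact: S1S'.
Qed.

Lemma mono_path_cat (L : finType) (S S' : fact L -> bool) cs cs' :
  mono_path S (cs ++ cs') S' ->
  exists2 S1, mono_path S cs S1 & mono_path S1 cs' S'.
Proof.
elim: cs S => [|c cs IH] S /=; first by exists S.
by move=> [S1 [SS1 sat /IH [S2 H1 H2]]]; exists S2 => //; exists S1.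
Qed.

Lemma mono_path_mem (L : finType) (S S' : fact L -> bool) cs c :
  mono_path S cs S' -> c \in cs ->
  exists S1, [/\ subfacts S S1, sat_clause S1 c & subfacts S1 S'].
Proof.
elim: cs S => [//|c' cs IH] S /= [S1 [SS1 sat H]]; rewrite inE => /predU1P[->|/(IH _ H)].
  by exists S1; split=> //; apply: mono_path_sub H.
by move=> [S2 [S12 sat2 S2S']]; exists S2; split=> // f /SS1 /S12.
Qed.

(** Premises that hold at the start still hold when the clause is read, and what it makes true
    survives to the end. The place of the clause within the path is therefore irrelevant. *)
Lemma mono_path_horn (L : finType) (S S' : fact L -> bool) cs (c : seq (literal L)) :
  mono_path S cs S' -> c \in cs -> (forall l, l \in c -> ~~ l.1 -> S l.2) ->
  exists l, [/\ l \in c, l.1 & S' l.2].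
Proof.
move=> H cin neg; have [S1 [SS1 /hasP[l lin /eqP Sl] S1S']] := mono_path_mem H cin.
case: (boolP l.1) => [pl|nl].
  by exists l; split=> //; apply: S1S'; rewrite Sl.
by have /SS1 := neg l lin nl; rewrite Sl (negPf nl).
Qed.

Definition cnf_instance (L : finType) T W (cs : seq (seq (literal L))) : instance 2 :=
  chain_instance (num_vars L T W) (size cs) (incidence W cs).

Lemma cnf_sound (L : finType) T W (cs : seq (seq (literal L))) :
  0 < num_vars L T W -> 0 < size cs ->
  all (fun c => (c != [::]) && all (in_range T W) c) cs ->
  consistent two_squares (cnf_instance T W cs) ->
  exists S S', mono_path S cs S'.
Proof.
move=> vpos mpos ok con.
have [//|//|q ltq|x [mon sat]] := chain_sound _ _ _ con.
  exact: clause_size_gt0.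
pose dom (f : fact L) := (f.1.1 <= T) && (f.1.2 < W).
(* Monotonicity is known only for variables below [num_vars]; facts outside the grid are set to
   false. *)
exists (fun f => dom f && x 0 (fvar W f)), (fun=> true).
apply: (@mono_path_of_states L (fun q f => dom f && x q (fvar W f)) cs 0).
  move=> q _ ltq f /andP[df xf]; rewrite df /=; apply: mon => //.
  by case/andP: df; apply: fvar_lt.
move=> q ltq; rewrite add0n; have [b [ltb /hasP[l lin /eqP El] xb]] := sat q ltq.
apply/hasP; exists l => //.
have /andP[_ /allP /(_ _ lin) rl] := allP ok _ (mem_nth [::] ltq).
have -> : dom l.2 = true by [].
move: xb; rewrite -El half_rail /rail oddD odd_double /=.
by move=> ->; case: (l.1).
Qed.

Lemma cnf_complete (L : finType) T W (cs : seq (seq (literal L))) (S : fact L -> bool) :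
  0 < num_vars L T W -> 0 < size cs ->
  all (fun c => (c != [::]) && all (in_range T W) c) cs ->
  all (sat_clause S) cs ->
  consistent two_squares (cnf_instance T W cs).
Proof.
move=> vpos mpos ok sat.
have L0 : 0 < #|L| by move: vpos; rewrite /num_vars; case: #|L|; rewrite ?muln0.
have [g0 _] : exists g : L, g \in L by apply/card_gt0P.
(* The inverse of [fvar] on the grid; [g0] only provides the default value of [nth]. *)
pose dec u : fact L := (u %/ #|L| %/ W, (u %/ #|L|) %% W,
  enum_val (cast_ord (erefl _) (nth (enum_rank g0) (enum 'I_#|L|) (u %% #|L|)))).
have decK f : f.1.2 < W -> dec (fvar W f) = f.
  case: f => [[t p] g] /= ltp; rewrite /dec /fvar /=.
  have ltg := ltn_ord (enum_rank g).
  have W0 : 0 < W by lia.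
  have E1 : ((t * W + p) * #|L| + enum_rank g) %/ #|L| = t * W + p.
    by rewrite divnMDl // divn_small // addn0.
  have E2 : ((t * W + p) * #|L| + enum_rank g) %% #|L| = enum_rank g.
    by rewrite modnMDl modn_small.
  have E3 : (t * W + p) %/ W = t by rewrite divnMDl // divn_small // addn0.
  have E4 : (t * W + p) %% W = p by rewrite modnMDl modn_small.
  rewrite E1 E2 E3 E4.
  congr (_, _, _); rewrite cast_ord_id.
  rewrite (_ : nth _ _ _ = enum_rank g) ?enum_rankK //.
  by apply: val_inj; rewrite /= nth_enum_ord.
apply: (@chain_complete _ _ _ (fun u => S (dec u))) => // q ltq.
have /hasP[l lin /eqP Sl] := allP sat _ (mem_nth [::] ltq).
have /andP[_ /allP /(_ _ lin) rl] := allP ok _ (mem_nth [::] ltq).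
exists (rail W l); split; first exact: rail_lt rl.
  by apply/hasP; exists l.
rewrite half_rail decK; last by case/andP: rl.
by rewrite Sl /rail oddD odd_double /=; case: (l.1).
Qed.

(** * Clause templates of the tableau *)

Definition label (M : machine) : finType :=
  (state M + 'I_(ntapes M).+1 * symbol (aux M))%type.

(* A literal of a clause template: an optional guard, the sign, the time
   offset, and the position, relative to the current position or to the cell
   left of the head. *)
Definition tlit (L : finType) := (option nat * bool * bool * (bool * nat) * L)%type.

Definition guard_ok (L : finType) (T p : nat) (e : tlit L) : bool :=
  if e.1.1.1.1 is Some d then p + d == T else true.

Definition inst_lit (L : finType) (T t p : nat) (e : tlit L) : literal L :=
  (e.1.1.1.2, (t + e.1.1.2, (if e.1.2.1 then p else T.-1) + e.1.2.2, e.2)).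

Definition inst (L : finType) (T t p : nat) (tpl : seq (tlit L)) : seq (literal L) :=
  [seq inst_lit T t p e | e <- tpl & guard_ok T p e].

(** In head-centred coordinates a move of the head shifts the tape: the new cell [p + 1] is the old
    cell [p + source d]. Naming the new cell [p + 1] keeps all offsets nonnegative. *)
Definition source (d : direction) :=
  match d with ToLeft => 0 | Stay => 1 | ToRight => 2 end.

(** Where the symbol just written lies after the move, counted from the cell left of the head: on
    the side opposite to the move. *)
Definition target (d : direction) :=
  match d with ToLeft => 2 | Stay => 1 | ToRight => 0 end.

Definition scanned_symbols (M : machine) := {ffun 'I_(ntapes M).+1 -> symbol (aux M)}.

(** A halted machine repeats its configuration, so a tableau of fixed height covers runs that stop
    early. *)
Definition next (M : machine) (q : state M) (s : scanned_symbols M) :=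
  if halting q then (q, fun i => (s i, Stay)) else delta q s.

Definition premises (M : machine) (q : state M) (s : scanned_symbols M) :
    seq (tlit (label M)) :=
  (None, false, false, (false, 1), inl q) ::
  [seq (None, false, false, (false, 1), inr (i, s i)) | i <- enum 'I_(ntapes M).+1].

Definition state_tpl (M : machine) q s : seq (tlit (label M)) :=
  rcons (premises q s) (None, true, true, (false, 1), inl (next q s).1).

Definition write_tpl (M : machine) q s i : seq (tlit (label M)) :=
  let a := (next q s).2 i in
  rcons (premises q s) (None, true, true, (false, target a.2), inr (i, a.1)).

(* The guarded literal makes the clause a tautology at the scanned cell, whose
   content is overwritten instead of being copied. *)
Definition copy_tpl (M : machine) q s i x : seq (tlit (label M)) :=
  let d := source ((next q s).2 i).2 in
  premises q s ++
  [:: (None, false, false, (true, d), inr (i, x));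
      (None, true, true, (true, 1), inr (i, x));
      (Some d, true, false, (false, 1), inl q)].

Definition step_tpls (M : machine) : seq (seq (tlit (label M))) :=
  flatten [seq state_tpl qs.1 qs.2 ::
    flatten [seq write_tpl qs.1 qs.2 i ::
      [seq copy_tpl qs.1 qs.2 i x | x <- enum (symbol (aux M))]
    | i <- enum 'I_(ntapes M).+1]
  | qs <- enum {: state M * scanned_symbols M}].

Definition common_tpls (M : machine) : seq (seq (tlit (label M))) :=
  [:: (None, true, false, (false, 1), inl (start M))] ::
  [seq [:: (None, true, false, (true, 0), inr (i, blank))]
  | i <- enum 'I_(ntapes M).+1 & i != ord0].

Definition unit_tpl (M : machine) (x : symbol (aux M)) : seq (tlit (label M)) :=
  [:: (None, true, false, (true, 0), inr (ord0, x))].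

Definition choice_tpl (M : machine) : seq (tlit (label M)) :=
  [:: (None, true, false, (true, 0), inr (ord0, bit true));
      (None, true, false, (true, 0), inr (ord0, bit false));
      (None, true, false, (true, 0), inr (ord0, blank))].

(** Blanks propagate to the right, so that the guessed cells spell a word followed by blanks. *)
Definition blank_tpl (M : machine) : seq (tlit (label M)) :=
  [:: (None, false, false, (true, 0), inr (ord0, blank));
      (None, true, false, (true, 1), inr (ord0, blank))].

Definition zone_tpls (M : machine) T (dx : seq bool) Y p : seq (seq (tlit (label M))) :=
  if p < T then [:: unit_tpl blank]
  else if p < T + size dx then [:: unit_tpl (bit (nth false dx (p - T)))]
  else if p < T + size dx + Y then [:: choice_tpl M; blank_tpl M]
  else [:: unit_tpl blank].

Definition init_clauses (M : machine) T dx Y : seq (seq (literal (label M))) :=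
  flatten [seq [seq inst T 0 p tpl | tpl <- common_tpls M ++ zone_tpls M T dx Y p]
          | p <- iota 0 T.*2.+2].

Definition step_clauses (M : machine) T t : seq (seq (literal (label M))) :=
  flatten [seq [seq inst T t p tpl | tpl <- step_tpls M] | p <- iota 0 T.*2].

(** A positive request for output 1 could be met by a fact that switches on without being derived; a
    negative clause leaves no such escape. *)
Definition final_tpl (M : machine) : seq (tlit (label M)) :=
  [:: (None, false, false, (false, 1), inr (ord0, bit false))].

Definition tableau (M : machine) T dx Y : seq (seq (literal (label M))) :=
  init_clauses M T dx Y ++ flatten [seq step_clauses M T t | t <- iota 0 T] ++
  [:: inst T T 0 (final_tpl M)].

Definition tape_cell (aux : finType) c (tp : tape (symbol aux)) p : symbol aux :=
  if p < c then nth blank (tape_left tp) (c - p.+1)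
  else if p == c then scanned tp else nth blank (tape_right tp) (p - c.+1).

Lemma tape_cell_move (aux : finType) c (a : symbol aux * direction) tp p : 0 < c ->
  tape_cell c (write_move a tp) p.+1 =
  if p + source a.2 == c then a.1 else tape_cell c tp (p + source a.2).
Proof.
case: tp => l x r; case: a => [s []] c0; rewrite /tape_cell /= ?addn0 ?addn1 ?addn2.
- case: (ltngtP p.+1 c) => [lt|gt|Ep].
  + by rewrite [p == c]ltn_eqF ?(ltnW lt) // nth_behead; congr nth; lia.
  + case: (eqVneq p c) => [->|ne]; first by rewrite subnn.
    by have -> : p.+1 - c.+1 = (p - c.+1).+1 by lia.
  + by rewrite -Ep [p == _]ltn_eqF // subnn nth0.
- by case: (ltngtP p.+1 c).
- case: (ltngtP p.+2 c) => [lt|gt|Ep].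
  + by rewrite (_ : c - p.+2 = (c - p.+3).+1) //; lia.
  + case: (eqVneq p.+1 c) => [Ep|ne]; first by rewrite -Ep subnn nth0.
    by rewrite nth_behead; congr nth; lia.
  + by rewrite -Ep subnn.
Qed.

Lemma tape_cell_word (aux : finType) c (w : seq bool) p :
  tape_cell c (@word_tape aux w) p =
  if p < c then blank else nth blank (map bit w) (p - c).
Proof.
rewrite /tape_cell /word_tape /=; case: ltngtP => [lt|gt|->].
- by rewrite nth_nil.
- by rewrite nth_behead; congr nth; lia.
- by rewrite subnn nth0.
Qed.

Lemma step_control (M : machine) (cf : config M) :
  control (step cf) = (next (control cf) [ffun i => scanned (tapes cf i)]).1.
Proof. by rewrite /step /next; case: halting => //; case: delta. Qed.

Lemma step_tapes (M : machine) (cf : config M) i :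
  tapes (step cf) i =
  write_move ((next (control cf) [ffun i => scanned (tapes cf i)]).2 i) (tapes cf i).
Proof.
rewrite /step /next; case: halting => /=; last by case: delta.
by rewrite ffunE; case: (tapes cf i).
Qed.

Lemma tape_cell_head (aux : finType) c (tp : tape (symbol aux)) :
  tape_cell c tp c = scanned tp.
Proof. by rewrite /tape_cell ltnn eqxx. Qed.

(** Only inclusion is claimed: [S] may contain further facts. [r] is the radius of the known window
    around the head; as the tape shifts, the window loses one cell on each side at every step. *)
Definition facts_at (M : machine) T (cf : config M) t r (S : fact (label M) -> bool) :=
  S (t, T, inl (control cf)) /\
  (forall i p, T <= p + r -> p <= T + r -> S (t, p, inr (i, tape_cell T (tapes cf i) p))).

Lemma inst_horn (L : finType) T t p (tpl : seq (tlit L)) (S S' : fact L -> bool) cs :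
  mono_path S cs S' -> inst T t p tpl \in cs ->
  (forall e, e \in tpl -> guard_ok T p e -> ~~ e.1.1.1.2 -> S (inst_lit T t p e).2) ->
  exists e, [/\ e \in tpl, guard_ok T p e, e.1.1.1.2 & S' (inst_lit T t p e).2].
Proof.
move=> path cin neg.
have [l lin|l [/mapP[e]]] := mono_path_horn path cin.
  by move: lin => /mapP[e]; rewrite mem_filter => /andP[ok ein] ->; apply: neg.
by rewrite mem_filter => /andP[ok ein] -> *; exists e.
Qed.

Lemma mem_step_clauses (M : machine) T t p (tpl : seq (tlit (label M))) :
  p < T.*2 -> tpl \in step_tpls M -> inst T t p tpl \in step_clauses M T t.
Proof.
move=> ltp tin; apply/flatten_mapP; exists p; first by rewrite mem_iota.
by apply/mapP; exists tpl.
Qed.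

Lemma mem_state_tpl (M : machine) q s : state_tpl q s \in step_tpls M.
Proof.
by apply/flatten_mapP; exists (q, s); rewrite ?mem_enum //= inE eqxx.
Qed.

Lemma mem_write_tpl (M : machine) q s i : write_tpl q s i \in step_tpls M.
Proof.
apply/flatten_mapP; exists (q, s); rewrite ?mem_enum //= inE; apply/orP; right.
by apply/flatten_mapP; exists i; rewrite ?mem_enum //= inE eqxx.
Qed.

Lemma mem_copy_tpl (M : machine) q s i x : copy_tpl q s i x \in step_tpls M.
Proof.
apply/flatten_mapP; exists (q, s); rewrite ?mem_enum //= inE; apply/orP; right.
apply/flatten_mapP; exists i; rewrite ?mem_enum //= inE; apply/orP; right.
by apply/mapP; exists x; rewrite ?mem_enum.
Qed.

Lemma step_facts (M : machine) T (cf : config M) t r (S S' : fact (label M) -> bool) :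
  r < T -> facts_at T cf t r.+1 S -> mono_path S (step_clauses M T t) S' ->
  facts_at T (step cf) t.+1 r S'.
Proof.
move=> ltr [Sq Sc] path; have T0 : 0 < T by lia.
have cenE : T.-1 + 1 = T by lia.
set q := control cf; set s := [ffun i => scanned (tapes cf i)].
have prem p e : e \in premises q s -> S (inst_lit T t p e).2.
  rewrite inE => /predU1P[->|/mapP[i _ ->]]; rewrite /inst_lit /= addn0 cenE //.
  by rewrite ffunE -(tape_cell_head T); apply: Sc; lia.
have premneg e : e \in premises q s -> ~~ e.1.1.1.2.
  by rewrite inE => /predU1P[->|/mapP[i _ ->]].
split.
  rewrite step_control -/q -/s.
  have [||e [ein _ pe]] := @inst_horn _ T t 0 (state_tpl q s) _ _ _ path.
  - by apply: mem_step_clauses (mem_state_tpl _ _); lia.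
  - move=> e; rewrite mem_rcons inE => /predU1P[->//|ein] _ _; exact: prem ein.
  move: ein; rewrite mem_rcons inE => /predU1P[->|/premneg]; last by move=> /negP; rewrite pe.
  by rewrite /inst_lit /= addn1 cenE.
move=> i p le1 le2; have [p' Ep] : exists p', p = p'.+1 by exists p.-1; lia.
rewrite step_tapes -/q -/s Ep tape_cell_move //.
set a := (next q s).2 i.
case: eqP => [Esrc|Esrc].
  have [||e [ein _ pe]] := @inst_horn _ T t 0 (write_tpl q s i) _ _ _ path.
  - by apply: mem_step_clauses (mem_write_tpl _ _ _); lia.
  - move=> e; rewrite mem_rcons inE => /predU1P[->//|ein] _ _; exact: prem ein.
  move: ein; rewrite mem_rcons inE => /predU1P[->|/premneg]; last by move=> /negP; rewrite pe.
  rewrite /inst_lit /= -/a addn1.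
  suff -> : T.-1 + target a.2 = p'.+1 by [].
  by move: Esrc; case: (a.2) => /=; lia.
have ltp : p' < T.*2 by lia.
set x := tape_cell T (tapes cf i) _.
have [||e [ein ok pe]] := @inst_horn _ T t p' (copy_tpl q s i x) _ _ _ path.
- exact: mem_step_clauses (mem_copy_tpl _ _ _ _).
- move=> e; rewrite mem_cat => /orP[ein _ _|]; first exact: prem ein.
  rewrite !inE => /or3P[] /eqP -> //= _ _; rewrite /inst_lit /= addn0.
  by apply: Sc; move: Esrc; case: (a.2) => /=; lia.
move: ein; rewrite mem_cat => /orP[/premneg|]; first by move=> /negP; rewrite pe.
rewrite !inE => /or3P[] /eqP Ee; subst e => //.
  by rewrite /inst_lit /= !addn1.
(* The guard would make this cell the scanned one, against [Esrc]. *)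
by move: ok => /eqP.
Qed.

Lemma steps_facts (M : machine) T (cf : config M) (S S' : fact (label M) -> bool) n t :
  t + n = T -> facts_at T cf t n S ->
  mono_path S (flatten [seq step_clauses M T u | u <- iota t n]) S' ->
  facts_at T (iter n (@step M) cf) T 0 S'.
Proof.
elim: n t cf S => [|n IH] t cf S.
  rewrite addn0 => -> [Sq Sc] /= sub; split=> [|i p le1 le2]; first exact: sub.
  by apply/sub/Sc.
rewrite -addSnnS => ET F /= /mono_path_cat[S1 H1 H2].
have ltn : n < T by lia.
rewrite -iterS iterSr; apply: IH ET _ H2.
exact: step_facts ltn F H1.
Qed.

(** * The initial configuration and the guessed certificate *)

Lemma flatten_iotaS (A : Type) (F : nat -> seq A) p n :
  flatten [seq F u | u <- iota p n.+1] = F p ++ flatten [seq F u | u <- iota p.+1 n].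
Proof. by []. Qed.

Definition choice_block (M : machine) T p : seq (seq (literal (label M))) :=
  [seq inst T 0 p tpl | tpl <- common_tpls M ++ [:: choice_tpl M; blank_tpl M]].

(** The cases depend on the blank fact at the moment [blank_tpl] is read. If it holds, the next cell
    becomes blank. If not, it did not hold earlier either, so the choice clause was met by a bit;
    its absence from [S] is what [blank_run] contradicts. *)
Lemma choice_block_path (M : machine) T p (S S' : fact (label M) -> bool) :
  mono_path S (choice_block M T p) S' ->
  (S' (0, p, inr (ord0, blank)) /\ S' (0, p.+1, inr (ord0, blank))) \/
  exists2 b, ~~ S (0, p, inr (ord0, blank)) & S' (0, p, inr (ord0, bit b)).
Proof.
rewrite /choice_block map_cat => /mono_path_cat[S1 /mono_path_sub SS1].
move=> /= [S2 [S12 sat2 [S3 [S23 sat3 S3S']]]].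
case B3: (S3 (0, p, inr (ord0, blank))).
  left; split; first exact: S3S'.
  by move: sat3; rewrite /sat_clause /= /inst_lit /= !addn0 addn1 B3 /= orbF => /eqP/S3S'.
have B2 : S2 (0, p, inr (ord0, blank)) = false.
  by apply/negP => /S23; rewrite B3.
have B0 : ~~ S (0, p, inr (ord0, blank)).
  by apply/negP => /SS1/S12; rewrite B2.
right; move: sat2; rewrite /sat_clause /= /inst_lit /= !addn0 B2 /= !orbF.
by case/orP => /eqP H; [exists true | exists false] => //; apply/S3S'/S23.
Qed.

Lemma blank_run (M : machine) T n p (S S' : fact (label M) -> bool) :
  S (0, p, inr (ord0, blank)) ->
  mono_path S (flatten [seq choice_block M T u | u <- iota p n]) S' ->
  forall i, i < n -> S' (0, p + i, inr (ord0, blank)).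
Proof.
elim: n p S => [//|n IH] p S Sp; rewrite flatten_iotaS => /mono_path_cat[S1 H1 H2] i lti.
have [[B0 B1]|[b]] := choice_block_path H1; last by rewrite Sp.
case: i lti => [_|i lti]; first by rewrite addn0; apply: (mono_path_sub H2).
by rewrite addnS -addSn; apply: IH B1 H2 i lti.
Qed.

(** The word ends at the first block that takes the blank alternative. A cell may carry several
    symbols; the word records one that holds. *)
Lemma choice_word (M : machine) T n p (S S' : fact (label M) -> bool) :
  mono_path S (flatten [seq choice_block M T u | u <- iota p n]) S' ->
  exists2 y, size y <= n &
    forall i, i < n -> S' (0, p + i, inr (ord0, nth blank (map bit y) i)).
Proof.
elim: n p S => [|n IH] p S; first by exists [::].
rewrite flatten_iotaS => /mono_path_cat[S1 H1 H2].
have [[B0 B1]|[b nb Sb]] := choice_block_path H1.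
  exists [::] => // -[|i] lti /=; first by rewrite addn0; apply: (mono_path_sub H2).
  by rewrite addnS -addSn; apply: blank_run B1 H2 i lti.
have [y lty Hy] := IH _ _ H2; exists (b :: y) => // -[|i] lti /=.
  by rewrite addn0; apply: (mono_path_sub H2).
by rewrite addnS -addSn; apply: Hy.
Qed.

Lemma init_facts (M : machine) T dx Y (S S' : fact (label M) -> bool) :
  0 < T -> size dx + Y <= T -> mono_path S (init_clauses M T dx Y) S' ->
  exists2 y, size y <= Y & facts_at T (init_config M (dx ++ y)) 0 T S'.
Proof.
move=> T0 leT path.
have unitP e p : p < T.*2.+2 -> [:: e] \in common_tpls M ++ zone_tpls M T dx Y p ->
    guard_ok T p e -> e.1.1.1.2 -> S' (inst_lit T 0 p e).2.
  move=> ltp ein ok pe.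
  have [||e' [/=]] := @inst_horn _ T 0 p [:: e] _ _ _ path.
  - apply/flatten_mapP; exists p; first by rewrite mem_iota.
    by apply/mapP; exists [:: e].
  - by move=> e'; rewrite inE => /eqP->; rewrite pe.
  by rewrite inE => /eqP->.
have [y ley Hy] : exists2 y, size y <= Y &
    forall i, i < Y -> S' (0, T + size dx + i, inr (ord0, nth blank (map bit y) i)).
  move: path; rewrite /init_clauses.
  have -> : T.*2.+2 = (T + size dx) + (Y + (T.*2.+2 - (T + size dx + Y))) by lia.
  rewrite iotaD map_cat flatten_cat => /mono_path_cat[S1 _].
  rewrite iotaD map_cat flatten_cat => /mono_path_cat[S2 H2 H3].
  have E : [seq [seq inst T 0 p tpl | tpl <- common_tpls M ++ zone_tpls M T dx Y p]
          | p <- iota (0 + (T + size dx)) Y] =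
      [seq choice_block M T u | u <- iota (T + size dx) Y].
    rewrite add0n; apply/eq_in_map => p; rewrite mem_iota => /andP[lep ltp].
    rewrite /choice_block /zone_tpls; case: ltnP => [|_]; first by lia.
    by case: ltnP => [|_]; [lia | rewrite ltp].
  rewrite E in H2; have [y ley Hy] := choice_word H2.
  by exists y => // i /Hy; apply: (mono_path_sub H3).
exists y => //; split.
  have := unitP (None, true, false, (false, 1), inl (start M)) 0 isT.
  rewrite mem_cat inE eqxx => /(_ isT isT isT); rewrite /inst_lit /=.
  by rewrite (_ : T.-1 + 1 = T) //; lia.
have cellP i x p : p < T.*2.+2 ->
    [:: (None, true, false, (true, 0), inr (i, x))] \in
      common_tpls M ++ zone_tpls M T dx Y p -> S' (0, p, inr (i, x)).
  by move=> ltp tin; have := unitP _ p ltp tin isT isT; rewrite /inst_lit /= !addn0.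
move=> i p _ lep; have ltp : p < T.*2.+2 by lia.
rewrite /= tape_cell_word; case: (eqVneq i ord0) => [->|ni]; last first.
  rewrite (_ : (if p < T then _ else _) = blank); last by case: ifP => //; rewrite nth_nil.
  apply: cellP => //; rewrite mem_cat inE; apply/orP; left; apply/orP; right.
  by apply/mapP; exists i => //; rewrite mem_filter ni mem_enum.
have zoneP x : unit_tpl x \in zone_tpls M T dx Y p -> S' (0, p, inr (ord0, x)).
  by move=> H; apply: cellP => //; rewrite mem_cat H orbT.
move: zoneP; rewrite /zone_tpls; case: (ltnP p T) => lepT.
  by apply; rewrite inE.
rewrite map_cat nth_cat size_map; case: (ltnP p (T + size dx)) => lt1.
  have -> : p - T < size dx by lia.
  by rewrite (nth_map false) => [H|]; [apply: H; rewrite inE | lia].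
have -> : (p - T < size dx) = false by lia.
case: (ltnP p (T + size dx + Y)) => lt2.
  move=> _; have lt3 : p - (T + size dx) < Y by lia.
  have := Hy _ lt3.
  have -> : T + size dx + (p - (T + size dx)) = p by lia.
  by have -> : p - (T + size dx) = p - T - size dx by lia.
rewrite nth_default; last by rewrite size_map; lia.
by apply; rewrite inE.
Qed.

(** After the step clauses the real final configuration is among the facts. An output 0 would
    persist and violate the last clause. *)
Lemma tableau_sound (M : machine) T dx Y (S S' : fact (label M) -> bool) :
  0 < T -> size dx + Y <= T -> mono_path S (tableau M T dx Y) S' ->
  exists2 y, size y <= Y &
    scanned (tapes (iter T (@step M) (init_config M (dx ++ y))) ord0) != bit false.
Proof.
move=> T0 leT /mono_path_cat[S1 H1 /mono_path_cat[S2 H2 H3]].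
have [y ley F0] := init_facts T0 leT H1; exists y => //.
have [_ Fc] := steps_facts (add0n T) F0 H2.
have := Fc ord0 T; rewrite !addn0 tape_cell_head => /(_ (leqnn _) (leqnn _)).
apply: contraTneq => ->; move: H3 => /= [S3 [S23 sat3 _]].
apply/negP => /S23; move: sat3.
by rewrite /sat_clause /= /inst_lit /= addn0 (_ : T.-1 + 1 = T); [case: (S3 _) | lia].
Qed.

(** * The facts of a real run satisfy the tableau *)

Definition real_facts (M : machine) T (w : seq bool) (f : fact (label M)) : bool :=
  let cf := iter f.1.1 (@step M) (init_config M w) in
  match f.2 with
  | inl q => control cf == q
  | inr (i, x) => tape_cell T (tapes cf i) f.1.2 == x
  end.

Lemma sat_inst (L : finType) T t p (tpl : seq (tlit L)) (S : fact L -> bool) :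
  (exists e, [/\ e \in tpl, guard_ok T p e & S (inst_lit T t p e).2 = e.1.1.1.2]) ->
  sat_clause S (inst T t p tpl).
Proof.
move=> [e [ein ok Se]]; apply/hasP; exists (inst_lit T t p e); last by rewrite Se.
by apply/mapP; exists e; rewrite ?mem_filter ?ok.
Qed.

Lemma sat_step (M : machine) T w t p (tpl : seq (tlit (label M))) :
  1 < T -> tpl \in step_tpls M -> sat_clause (real_facts T w) (inst T t p tpl).
Proof.
move=> T0 /flatten_mapP[[q s] _ /=]; set cf := iter t (@step M) (init_config M w).
have cenE : T.-1 + 1 = T by lia.
(* A template for another state or other scanned symbols has a false premise, so only the template
   of the actual transition needs its conclusion. *)
have prem pre : (forall e, e \in premises q s -> e \in pre) ->
   (control cf = q -> [ffun i => scanned (tapes cf i)] = s ->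
      sat_clause (real_facts T w) (inst T t p pre)) ->
   sat_clause (real_facts T w) (inst T t p pre).
  move=> sub H; case: (eqVneq (control cf) q) => [Eq|nq]; last first.
    apply: sat_inst; exists (None, false, false, (false, 1), inl q).
    split=> //; first by apply: sub; rewrite inE eqxx.
    by rewrite /real_facts /= addn0; apply: negPf.
  case: (eqVneq ([ffun i => scanned (tapes cf i)] : scanned_symbols M) s) => [Es|ns].
    exact: H.
  have [i ni] : exists i, scanned (tapes cf i) != s i.
    apply/existsP; apply: contraNT ns; rewrite negb_exists => /forallP E.
    by apply/eqP/ffunP => i; rewrite ffunE; apply/eqP/negPn/E.
  apply: sat_inst; exists (None, false, false, (false, 1), inr (i, s i)).
  split=> //; first by apply: sub; rewrite inE; apply/orP; right; apply/mapP; exists i; rewrite ?mem_enum.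
  by rewrite /real_facts /= addn0 cenE tape_cell_head; apply: negPf.
rewrite inE => /predU1P[->|/flatten_mapP[i _]].
  apply: prem => [e ein|Eq Es]; first by rewrite mem_rcons inE ein orbT.
  apply: sat_inst; exists (None, true, true, (false, 1), inl (next q s).1).
  by rewrite mem_rcons inE eqxx /real_facts /= addn1 /= -/cf step_control Eq Es eqxx.
rewrite inE => /predU1P[->|/mapP[x _ ->]].
  apply: prem => [e ein|Eq Es]; first by rewrite mem_rcons inE ein orbT.
  apply: sat_inst; eexists; split; [by rewrite mem_rcons inE; apply/orP; left | by [] |].
  rewrite /real_facts /= addn1 /= -/cf step_tapes Eq Es.
  set a := (next q s).2 i.
  have [p' Ep Ep'] : exists2 p', T.-1 + target a.2 = p'.+1 & p' + source a.2 = T.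
    (* The move to the right needs [1 < T]. *)
    by case: (a.2) => /=; [exists T | exists T.-1 | exists T.-2]; lia.
  by rewrite Ep tape_cell_move 1?Ep' ?eqxx //; lia.
apply: prem => [e ein|Eq Es]; first by rewrite mem_cat ein.
set a := (next q s).2 i; set d := source a.2.
case: (eqVneq (tape_cell T (tapes cf i) (p + d)) x) => [Ex|nx]; last first.
  apply: sat_inst; exists (None, false, false, (true, d), inr (i, x)).
  split=> //; first by rewrite mem_cat !inE eqxx orbT.
  by rewrite /real_facts /= addn0; apply: negPf.
case: (eqVneq (p + d) T) => [Ep|np].
  apply: sat_inst; exists (Some d, true, false, (false, 1), inl q).
  split; first by rewrite mem_cat !inE eqxx !orbT.
    by rewrite /guard_ok /= Ep.
  by rewrite /real_facts /= addn0 Eq eqxx.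
apply: sat_inst; exists (None, true, true, (true, 1), inr (i, x)).
split=> //; first by rewrite mem_cat !inE eqxx !orbT.
rewrite /real_facts /= !addn1 /= -/cf step_tapes Eq Es -/a tape_cell_move; last by lia.
by rewrite -/d (negPf np) Ex eqxx.
Qed.

Lemma sat_init (M : machine) T dx Y y p (tpl : seq (tlit (label M))) :
  0 < T -> tpl \in common_tpls M ++ zone_tpls M T dx Y p -> size y <= Y ->
  sat_clause (real_facts T (dx ++ y)) (inst T 0 p tpl).
Proof.
move=> T0 tin ley; move: tin; have cenE : T.-1 + 1 = T by lia.
rewrite mem_cat inE -orbA => /or3P[/eqP->|/mapP[i]|H].
- by rewrite /sat_clause /= /real_facts /= eqxx.
- rewrite mem_filter => /andP[ni _] ->.
  rewrite /sat_clause /= /real_facts /= addn0 (negPf ni) tape_cell_word.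
  by rewrite orbF; case: ifP => _ //; rewrite nth_nil.
have unitE x : tape_cell T (@word_tape (aux M) (dx ++ y)) p = x ->
    sat_clause (real_facts T (dx ++ y)) (inst T 0 p (unit_tpl x)).
  by move=> E; rewrite /sat_clause /= /real_facts /= addn0 E eqxx.
move: H; rewrite /zone_tpls.
case: (ltnP p T) => lepT; first by rewrite inE => /eqP->; apply: unitE; rewrite tape_cell_word lepT.
have Ew : tape_cell T (@word_tape (aux M) (dx ++ y)) p = nth blank (map bit (dx ++ y)) (p - T).
  by rewrite tape_cell_word ltnNge lepT.
case: (ltnP p (T + size dx)) => lt1.
  rewrite inE => /eqP->; apply: unitE; rewrite Ew map_cat nth_cat size_map.
  by rewrite (_ : p - T < size dx) ?(nth_map false) //; lia.
case: (ltnP p (T + size dx + Y)) => lt2; last first.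
  rewrite inE => /eqP->; apply: unitE; rewrite Ew nth_default // size_map size_cat; lia.
rewrite !inE => /orP[/eqP->|/eqP->]; rewrite /sat_clause /= /real_facts /= !addn0 ?addn1 Ew.
  case: (ltnP (p - T) (size (dx ++ y))) => lt.
    by rewrite (nth_map false) //; case: (nth false _ _); rewrite eqxx ?orbT.
  by rewrite nth_default ?size_map // eqxx !orbT.
case: (ltnP (p - T) (size (dx ++ y))) => lt; first by rewrite (nth_map false).
have E1 : tape_cell T (@word_tape (aux M) (dx ++ y)) p.+1 = blank.
  by rewrite tape_cell_word ifN ?nth_default ?size_map //; lia.
by rewrite E1 /= !orbT.
Qed.

Lemma tableau_complete (M : machine) T dx Y y : 1 < T -> size y <= Y ->
  scanned (tapes (iter T (@step M) (init_config M (dx ++ y))) ord0) != bit false ->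
  all (sat_clause (real_facts T (dx ++ y))) (tableau M T dx Y).
Proof.
move=> T1 ley nF; rewrite /tableau (all_cat _ (init_clauses M T dx Y)) (all_cat _ (flatten _)).
apply/and3P; split.
- apply/allP => c /flatten_mapP[p _ /mapP[tpl tin ->]].
  by apply: sat_init tin ley; lia.
- apply/allP => c /flatten_mapP[t _ /flatten_mapP[p _ /mapP[tpl tin ->]]].
  exact: sat_step.
- rewrite /= /sat_clause /= /real_facts /= addn0 (_ : T.-1 + 1 = T); last by lia.
  by rewrite tape_cell_head (negPf nF).
Qed.

Lemma premises_range (M : machine) T t p q s (e : tlit (label M)) :
  0 < T -> t <= T -> e \in premises q s -> in_range T T.*2.+2 (inst_lit T t p e).
Proof.
move=> T0 let_; rewrite inE => /predU1P[->|/mapP[i _ ->]];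
  rewrite /in_range /=; lia.
Qed.

Lemma inst_range (L : finType) T W t p (tpl : seq (tlit L)) :
  (exists2 e, e \in tpl & guard_ok T p e) ->
  (forall e, e \in tpl -> in_range T W (inst_lit T t p e)) ->
  (inst T t p tpl != [::]) && all (in_range T W) (inst T t p tpl).
Proof.
move=> [e ein ok] H; apply/andP; split.
  apply/eqP => E; have : inst_lit T t p e \in inst T t p tpl.
    by apply/mapP; exists e; rewrite ?mem_filter ?ok.
  by rewrite E.
by apply/allP => l /mapP[e']; rewrite mem_filter => /andP[_ ein'] ->; apply: H.
Qed.

Lemma tableau_range (M : machine) T dx Y : 0 < T -> size dx + Y <= T ->
  all (fun c => (c != [::]) && all (in_range T T.*2.+2) c) (tableau M T dx Y).
Proof.
move=> T0 leT; rewrite /tableau (all_cat _ (init_clauses M T dx Y)) (all_cat _ (flatten _)).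
apply/and3P; split.
- apply/allP => c /flatten_mapP[p]; rewrite mem_iota add0n => /andP[_ ltp] /mapP[tpl tin ->].
  move: tin; rewrite mem_cat inE -orbA => /or3P[/eqP->|/mapP[i _ ->]|].
  + by rewrite /inst /= /in_range /=; lia.
  + by rewrite /inst /= /in_range /=; lia.
  rewrite /zone_tpls; case: ifP => _; first by rewrite inE => /eqP->; rewrite /inst /= /in_range /=; lia.
  case: ifP => _; first by rewrite inE => /eqP->; rewrite /inst /= /in_range /=; lia.
  case: ifP => lt2; last by rewrite inE => /eqP->; rewrite /inst /= /in_range /=; lia.
  by rewrite !inE => /orP[]/eqP->; rewrite /inst /= /in_range /=; lia.
- apply/allP => c /flatten_mapP[t]; rewrite mem_iota add0n => /andP[_ ltt].
  move=> /flatten_mapP[p]; rewrite mem_iota add0n => /andP[_ ltp] /mapP[tpl tin ->].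
  move: tin => /flatten_mapP[[q s] _ /=]; have pr := @premises_range M T t p q s _ T0 (ltnW ltt).
  pose hl : tlit (label M) := (None, false, false, (false, 1), inl q).
  have hd : hl \in premises q s by rewrite inE eqxx.
  rewrite inE => /predU1P[->|/flatten_mapP[i _]].
    apply: inst_range => [|e]; first by exists hl => //; rewrite mem_rcons inE hd orbT.
    by rewrite mem_rcons inE => /predU1P[->|/pr//]; rewrite /in_range /=; lia.
  rewrite inE => /predU1P[->|/mapP[x _ ->]].
    apply: inst_range => [|e]; first by exists hl => //; rewrite mem_rcons inE hd orbT.
    rewrite mem_rcons inE => /predU1P[->|/pr//]; rewrite /in_range /=.
    by case: (((next q s).2 i).2) => /=; lia.
  apply: inst_range => [|e]; first by exists hl => //; rewrite mem_cat hd.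
  rewrite mem_cat => /orP[/pr//|]; rewrite !inE.
  by case: (((next q s).2 i).2) => /or3P[]/eqP->; rewrite /in_range /=; lia.
- by rewrite /inst /= /in_range /=; lia.
Qed.

Lemma tableau_size (M : machine) T dx Y : 0 < size (tableau M T dx Y).
Proof.
by rewrite /tableau (size_cat (init_clauses M T dx Y)) (size_cat (flatten _)) addnA addn1.
Qed.

Lemma label_card (M : machine) T W : 0 < W -> 0 < num_vars (label M) T W.
Proof.
move=> W0; rewrite /num_vars !muln_gt0 W0 /=.
by apply/card_gt0P; exists (inl (start M)).
Qed.

(** Why the width is [T.*2.+2]: the positions up to [2T] form the initial window of radius [T], and
    the copying clauses look one cell further to the right. *)
Theorem tableau_correct (M : machine) T dx Y : 1 < T -> size dx + Y <= T ->
  consistent two_squares (cnf_instance T T.*2.+2 (tableau M T dx Y)) <->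
  exists2 y, size y <= Y &
    scanned (tapes (iter T (@step M) (init_config M (dx ++ y))) ord0) != bit false.
Proof.
move=> T1 leT; have T0 : 0 < T by lia.
have rng := @tableau_range M T dx Y T0 leT.
split.
  move=> /cnf_sound [||//|S [S' path]]; rewrite ?label_card ?tableau_size //.
  exact: tableau_sound path.
move=> [y ley nF]; apply: cnf_complete (tableau_complete T1 ley nF) => //.
  exact: label_card.
Qed.

(** * Functions computed by expressions *)

Notation U n := (nseq n true).

Lemma flatmap_unary F n k : flatmap_suffixes F (U n) (U k) =
  flatten [seq F (U (n - i)) (U (k + i)) | i <- iota 0 n].
Proof.
elim: n k => [//|n IH] k.
rewrite -[RHS]/(F (U (n.+1 - 0)) (U (k + 0)) ++
  flatten [seq F (U (n.+1 - i)) (U (k + i)) | i <- iota 1 n]) addn0 subn0.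
rewrite -[LHS]/(F (U n.+1) (U k) ++ flatmap_suffixes F (U n) (U k.+1)) IH.
rewrite -[1]addn0 iotaDl -map_comp; congr (_ ++ flatten _).
by apply: eq_map => i; rewrite [RHS]/= add1n subSS addSnnS.
Qed.

Lemma eval_flatmap env e1 e2 n : eval env e1 = U n ->
  eval env (FlatMap e1 e2) =
  flatten [seq eval (env ++ [:: U (n - i); U i]) e2 | i <- iota 0 n].
Proof. by move=> /= ->; apply: (flatmap_unary _ n 0). Qed.

Fixpoint Const (n : nat) : expr := if n is n'.+1 then Cons true (Const n') else Nil.

Lemma eval_const env n : eval env (Const n) = U n.
Proof. by elim: n => //= n ->. Qed.

(** A one-bit accumulator, flipped in each round. It is [Var 4], after the three arguments and the
    suffix. *)
Definition parF := Fold (Var 0) (Cons false Nil)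
  (Case (Var 4) Nil (Cons false Nil) (Cons true Nil)).

Definition Par e := Call parF e Nil Nil.

Lemma eval_par env e n : eval env e = U n -> eval env (Par e) = [:: odd n].
Proof.
move=> E; rewrite /Par /parF /= E.
suff H b : fold_suffixes (fun s a => take 1 match a with
    | [::] => [::] | true :: _ => [:: false] | false :: _ => [:: true] end) (U n) [:: b]
    = [:: b (+) odd n] by rewrite (H false).
elim: n b {E} => [|n IH] b /=; first by rewrite addbF.
by case: b; rewrite IH /=; case: (odd n).
Qed.

Lemma eval_case env e e0 e1 e2 : eval env (Case e e0 e1 e2) =
  match eval env e with
  | [::] => eval env e0 | true :: _ => eval env e1 | false :: _ => eval env e2
  end.
Proof. by []. Qed.

(** [Var 3] is the current suffix. Its lengths run from [n] down to 1, and one unit is emitted for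
    each even length. *)
Definition halfF := FlatMap (Var 0) (Case (Par (Var 3)) Nil Nil (Const 1)).

Definition Half e := Call halfF e Nil Nil.

Lemma eval_half env e n : eval env e = U n -> eval env (Half e) = U n./2.
Proof.
move=> E; rewrite /Half -[LHS]/(eval [:: eval env e; [::]; [::]] halfF) E /halfF.
rewrite (@eval_flatmap _ (Var 0) _ n) //.
have -> : [seq eval ([:: U n; [::]; [::]] ++ [:: U (n - i); U i])
   (Case (Par (Var 3)) Nil Nil (Const 1)) | i <- iota 0 n] =
   [seq U (~~ odd (n - i)) | i <- iota 0 n].
  by apply: eq_map => i; rewrite eval_case (@eval_par _ (Var 3) (n - i)) //; case: odd.
elim: n {E env e} => [//|n IH].
rewrite -[iota 0 n.+1]/(0 :: iota 1 n) map_cons /= -[1]addn0 iotaDl -map_comp.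
rewrite (eq_map (g := fun i => U (~~ odd (n - i)))); last by move=> i /=; rewrite add1n subSS.
by rewrite IH -nseqD; congr nseq; rewrite ?negbK ?uphalf_half.
Qed.

Definition halfsF := Fold (Var 0) (Var 1) (Half (Var 4)).

Definition Halfs i e := Call halfsF i e Nil.

Lemma fold_half F m i j : (forall s j, j <= m -> F s (U j) = U j./2) -> j <= m ->
  fold_suffixes F (U i) (U j) = U (j %/ 2 ^ i).
Proof.
move=> HF; elim: i j => [|i IH] j lej; first by rewrite expn0 divn1.
rewrite -[LHS]/(fold_suffixes F (U i) (F (U i.+1) (U j))) HF // IH; last by lia.
by rewrite expnS divnMA divn2.
Qed.

Lemma eval_halfs env ei e i m : eval env ei = U i -> eval env e = U m ->
  eval env (Halfs ei e) = U (m %/ 2 ^ i).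
Proof.
move=> Ei E; rewrite /Halfs -[LHS]/(eval [:: eval env ei; eval env e; [::]] halfsF) Ei E.
apply: (@fold_half _ m) => // s j lej.
rewrite -[LHS]/(take (size (U m)) (eval [:: U i; U m; [::]; s; U j] (Half (Var 4)))).
rewrite (@eval_half _ (Var 4) j) // size_nseq take_oversize // size_nseq; lia.
Qed.

Lemma eval_let env e1 e2 : eval env (Let e1 e2) = eval (rcons env (eval env e1)) e2.
Proof. by []. Qed.

Definition encF :=
  let emit := Cons true (Par (Var 5)) in
  Cat (FlatMap (Cons true (Var 0))
         (Let (Halfs (Var 4) (Var 0))
            (Case (Var 4) emit (Case (Var 5) Nil emit emit) Nil)))
      (Cons false Nil).

Definition Enc e := Call encF e Nil Nil.

Lemma eval_enc env e m : eval env e = U m -> eval env (Enc e) = encode_nat m.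
Proof.
move=> E; rewrite /Enc -[LHS]/(eval [:: eval env e; [::]; [::]] encF) E.
rewrite /encode_nat /delimit /encF; set body := Let _ _.
rewrite -[LHS]/(eval [:: U m; [::]; [::]] (FlatMap (Cons true (Var 0)) body) ++ [:: false]); congr (_ ++ _).
rewrite (@eval_flatmap _ (Cons true (Var 0)) _ m.+1) //.
have -> : [seq eval ([:: U m; [::]; [::]] ++ [:: U (m.+1 - i); U i]) body | i <- iota 0 m.+1] =
   [seq (if (i == 0) || (0 < m %/ 2 ^ i) then [:: true; odd (m %/ 2 ^ i)] else [::])
   | i <- iota 0 m.+1].
  apply: eq_map => i; set env' := _ ++ _.
  have Eh : eval env' (Halfs (Var 4) (Var 0)) = U (m %/ 2 ^ i) by apply: eval_halfs.
  rewrite /body eval_let Eh.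
  set env2 := rcons _ _.
  have Ep : eval env2 (Par (Var 5)) = [:: odd (m %/ 2 ^ i)] by apply: eval_par.
  have Ee : eval env2 (Cons true (Par (Var 5))) = [:: true; odd (m %/ 2 ^ i)].
    by rewrite -[LHS]/(true :: eval env2 (Par (Var 5))) Ep.
  rewrite eval_case -[eval env2 (Var 4)]/(U i) -[eval env2 Nil]/[::] eval_case Ee.
  rewrite -[eval env2 (Var 5)]/(U (m %/ 2 ^ i)) -[eval env2 Nil]/[::].
  by case: (i) => [//|k] /=; case: (m %/ _).
rewrite /binary -map_comp; set l := trunc_log 2 m.
have lel : l <= m.
  by rewrite /l; case: (posnP m) => [->//|m0]; apply: ltnW; apply: leq_trans (ltn_expl _ (isT : 1 < 2)) (trunc_logP _ _).
have -> : m.+1 = l.+1 + (m - l) by lia.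
rewrite iotaD map_cat flatten_cat add0n [X in _ ++ X](_ : _ = [::]); last first.
  have -> : [seq (if (i == 0) || (0 < m %/ 2 ^ i) then [:: true; odd (m %/ 2 ^ i)] else [::])
     | i <- iota l.+1 (m - l)] = [seq [::] | _ <- iota l.+1 (m - l)].
    apply/eq_in_map => i; rewrite mem_iota => /andP[lei _].
    rewrite divn_small; last first.
      by apply: leq_trans (trunc_log_ltn m (isT : 1 < 2)) _; rewrite leq_exp2l.
    by case: i lei.
  by elim: (iota _ _).
rewrite cats0; congr flatten; apply/eq_in_map => i; rewrite mem_iota add0n => /andP[_ lei] /=.
case: i lei => [//|i] lei /=; rewrite divn_gt0 ?expn_gt0 //.
have m0 : 0 < m by rewrite lt0n; apply/eqP => m0; move: lei; rewrite /l m0 trunc_log0.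
by rewrite (leq_trans _ (trunc_logP (isT : 1 < 2) m0)) // leq_exp2l.
Qed.

(** Makes room for [d] variables at level [s]. Bodies of calls stay as they are, since they see only
    their arguments. *)
Fixpoint shift (s d : nat) (x : expr) : expr :=
  match x with
  | Var i => Var (if i < s then i else i + d)
  | Nil => Nil
  | Cons b e => Cons b (shift s d e)
  | Tail e => Tail (shift s d e)
  | Case e e0 e1 e2 => Case (shift s d e) (shift s d e0) (shift s d e1) (shift s d e2)
  | Cat e1 e2 => Cat (shift s d e1) (shift s d e2)
  | Drop e1 e2 => Drop (shift s d e1) (shift s d e2)
  | Let e1 e2 => Let (shift s d e1) (shift s d e2)
  | Call f a b c => Call f (shift s d a) (shift s d b) (shift s d c)
  | FlatMap e1 e2 => FlatMap (shift s d e1) (shift s d e2)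
  | Fold e1 e0 e2 => Fold (shift s d e1) (shift s d e0) (shift s d e2)
  end.

Lemma eval_shift x env1 ins env2 :
  eval (env1 ++ ins ++ env2) (shift (size env1) (size ins) x) = eval (env1 ++ env2) x.
Proof.
elim: x env2 => //= [i|b e IH|e IH|e IH e0 IH0 e1 IH1 e2 IH2|e1 IH1 e2 IH2|e1 IH1 e2 IH2
  |e1 IH1 e2 IH2|f _ a IHa b IHb c IHc|e1 IH1 e2 IH2|e1 IH1 e0 IH0 e2 IH2] env2.
- case: (ltnP i (size env1)) => [lt|ge]; first by rewrite !nth_cat lt.
  rewrite !nth_cat; have [-> -> ->] : [/\ (i + size ins < size env1) = false,
    (i + size ins - size env1 < size ins) = false & (i < size env1) = false] by split; lia.
  by congr nth; lia.
- by rewrite IH.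
- by rewrite IH.
- by rewrite IH IH0 IH1 IH2.
- by rewrite IH1 IH2.
- by rewrite IH1 IH2.
- by rewrite IH1 !rcons_cat IH2.
- by rewrite IHa IHb IHc.
- rewrite IH1; congr flatmap_suffixes.
  by do 2![apply: functional_extensionality => ?]; rewrite -!catA IH2.
- rewrite IH1 IH0; congr fold_suffixes.
  by do 2![apply: functional_extensionality => ?]; rewrite -!catA IH2.
Qed.

(** * Functions computable in a scope *)

Record scope (A : Type) := Scope {
  values :> A -> seq (seq bool);
  arity : nat;
  size_values : forall a, size (values a) = arity
}.

Definition computable A (G : scope A) (F : A -> seq bool) : Prop :=
  exists x, forall a, eval (G a) x = F a.

Definition numeric A (G : scope A) (n : A -> nat) : Prop :=
  computable G (fun a => U (n a)).

Definition testable A (G : scope A) (b : A -> bool) : Prop :=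
  computable G (fun a => [:: b a]).

(** The scope inside a loop over [U (n a)]: [FlatMap] binds the remaining rounds and the counter. *)
Definition bind_values A (G : scope A) (n : A -> nat) (p : A * nat) :=
  G p.1 ++ [:: U (n p.1 - p.2); U p.2].

Fact bind_size A (G : scope A) n p : size (@bind_values A G n p) = arity G + 2.
Proof. by rewrite size_cat size_values. Qed.

Definition bind A (G : scope A) n := Scope (@bind_size A G n).

Lemma computable_weak A (G : scope A) n F : computable G F ->
  computable (bind G n) (fun p => F p.1).
Proof.
move=> [x Hx]; exists (shift (arity G) 2 x) => -[a i] /=; rewrite -Hx /bind_values /=.
have := @eval_shift x (G a) [:: U (n a - i); U i] [::].
by rewrite !cats0 size_values.
Qed.

Lemma numeric_last A (G : scope A) n : numeric (bind G n) (fun p => p.2).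
Proof.
exists (Var (arity G).+1) => -[a i] /=.
by rewrite /bind_values nth_cat size_values ltnNge leqW //= subSn // subnn.
Qed.

Lemma computable_eq A (G : scope A) F F' : computable G F -> F =1 F' -> computable G F'.
Proof. by move=> [x Hx] E; exists x => a; rewrite Hx. Qed.

Lemma numeric_eq A (G : scope A) n n' : numeric G n -> n =1 n' -> numeric G n'.
Proof. by move=> H E; apply: computable_eq H _ => a; rewrite E. Qed.

Lemma testable_eq A (G : scope A) b b' : testable G b -> b =1 b' -> testable G b'.
Proof. by move=> H E; apply: computable_eq H _ => a; rewrite E. Qed.

Lemma computable_flatten A (G : scope A) n F : numeric G n ->
  computable (bind G n) (fun p => F p.1 p.2) ->
  computable G (fun a => flatten [seq F a i | i <- iota 0 (n a)]).
Proof.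
move=> [x Hx] [y Hy]; exists (FlatMap x y) => a.
rewrite (eval_flatmap _ (Hx a)); congr flatten; apply: eq_map => i.
exact: (Hy (a, i)).
Qed.

Lemma computable_nil A (G : scope A) : computable G (fun=> [::]).
Proof. by exists Nil. Qed.

Lemma computable_cat A (G : scope A) F F' : computable G F -> computable G F' ->
  computable G (fun a => F a ++ F' a).
Proof. by move=> [x Hx] [y Hy]; exists (Cat x y) => a /=; rewrite Hx Hy. Qed.

Lemma computable_drop A (G : scope A) n F : numeric G n -> computable G F ->
  computable G (fun a => drop (n a) (F a)).
Proof.
by move=> [x Hx] [y Hy]; exists (Drop x y) => a /=; rewrite Hx Hy size_nseq.
Qed.

Lemma computable_if A (G : scope A) b F F' : testable G b ->
  computable G F -> computable G F' -> computable G (fun a => if b a then F a else F' a).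
Proof.
move=> [x Hx] [y Hy] [z Hz]; exists (Case x Nil y z) => a /=.
by rewrite Hx Hy Hz; case: (b a).
Qed.

Lemma computable_encode A (G : scope A) n : numeric G n ->
  computable G (fun a => encode_nat (n a)).
Proof. by move=> [x Hx]; exists (Enc x) => a; apply: eval_enc. Qed.

Lemma numeric_const A (G : scope A) n : numeric G (fun=> n).
Proof. by exists (Const n) => a; apply: eval_const. Qed.

Lemma testable_const A (G : scope A) b : testable G (fun=> b).
Proof. by exists (Cons b Nil). Qed.

Lemma testable_head A (G : scope A) F : computable G F ->
  testable G (fun a => head false (F a)).
Proof.
move=> [x Hx]; exists (Case x (Cons false Nil) (Cons true Nil) (Cons false Nil)) => a /=.
by rewrite Hx; case: (F a) => [|[] ?].
Qed.

Lemma testable_nth A (G : scope A) F n : computable G F -> numeric G n ->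
  testable G (fun a => nth false (F a) (n a)).
Proof.
move=> HF Hn; apply: testable_eq (testable_head (computable_drop Hn HF)) _ => a.
by rewrite -nth0 nth_drop addn0.
Qed.

Lemma testable_nilp A (G : scope A) F : computable G F -> testable G (fun a => nilp (F a)).
Proof.
move=> [x Hx]; exists (Case x (Cons true Nil) (Cons false Nil) (Cons false Nil)) => a /=.
by rewrite Hx; case: (F a) => [|[] ?].
Qed.

Lemma testable_not A (G : scope A) b : testable G b -> testable G (fun a => ~~ b a).
Proof.
move=> Hb; apply: computable_eq (computable_if Hb (testable_const G false) (testable_const G true)) _.
by move=> a; case: (b a).
Qed.

Lemma testable_and A (G : scope A) b c : testable G b -> testable G c ->
  testable G (fun a => b a && c a).
Proof.
move=> Hb Hc; apply: computable_eq (computable_if Hb Hc (testable_const G false)) _.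
by move=> a; case: (b a).
Qed.

Lemma testable_or A (G : scope A) b c : testable G b -> testable G c ->
  testable G (fun a => b a || c a).
Proof.
move=> Hb Hc; apply: computable_eq (computable_if Hb (testable_const G true) Hc) _.
by move=> a; case: (b a).
Qed.

Lemma numeric_size A (G : scope A) F : computable G F -> numeric G (fun a => size (F a)).
Proof.
move=> [x Hx]; exists (Call (FlatMap (Var 0) (Const 1)) x Nil Nil) => a /=; rewrite Hx.
suff H s p : flatmap_suffixes (fun _ _ => U 1) s p = U (size s) by apply: H.
by elim: s p => [//|b s IH] p /=; rewrite IH.
Qed.

Lemma numeric_if A (G : scope A) b m n : testable G b ->
  numeric G m -> numeric G n -> numeric G (fun a => if b a then m a else n a).
Proof.
by move=> Hb Hm Hn; apply: computable_eq (computable_if Hb Hm Hn) _ => a; case: (b a).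
Qed.

Lemma numeric_bool A (G : scope A) (b : A -> bool) : testable G b -> numeric G b.
Proof.
move=> Hb; apply: numeric_eq (numeric_if Hb (numeric_const G 1) (numeric_const G 0)) _.
by move=> a; case: (b a).
Qed.

Lemma numeric_add A (G : scope A) m n : numeric G m -> numeric G n ->
  numeric G (fun a => m a + n a).
Proof.
by move=> Hm Hn; apply: computable_eq (computable_cat Hm Hn) _ => a; rewrite nseqD.
Qed.

Lemma numeric_succ A (G : scope A) n : numeric G n -> numeric G (fun a => (n a).+1).
Proof. by move=> Hn; apply: numeric_eq (numeric_add Hn (numeric_const G 1)) _ => a; rewrite addn1. Qed.

Lemma numeric_double A (G : scope A) n : numeric G n -> numeric G (fun a => (n a).*2).
Proof. by move=> Hn; apply: numeric_eq (numeric_add Hn Hn) _ => a; rewrite addnn. Qed.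

Lemma numeric_sub A (G : scope A) m n : numeric G m -> numeric G n ->
  numeric G (fun a => m a - n a).
Proof.
by move=> Hm Hn; apply: computable_eq (computable_drop Hn Hm) _ => a; rewrite drop_nseq.
Qed.

Lemma numeric_pred A (G : scope A) n : numeric G n -> numeric G (fun a => (n a).-1).
Proof. by move=> Hn; apply: numeric_eq (numeric_sub Hn (numeric_const G 1)) _ => a; rewrite subn1. Qed.

Lemma numeric_half A (G : scope A) n : numeric G n -> numeric G (fun a => (n a)./2).
Proof. by move=> [x Hx]; exists (Half x) => a; apply: eval_half. Qed.

Lemma numeric_sum A (G : scope A) n F : numeric G n ->
  numeric (bind G n) (fun p => F p.1 p.2) ->
  numeric G (fun a => \sum_(0 <= i < n a) F a i).
Proof.
move=> Hn HF; apply: (computable_eq (F := fun a => flatten [seq U (F a i) | i <- iota 0 (n a)])).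
  exact: (computable_flatten (F := fun a i => U (F a i)) Hn HF).
move=> a; rewrite /index_iota subn0; elim: (iota 0 (n a)) => [|i s IH]; first by rewrite big_nil.
by rewrite big_cons nseqD -IH.
Qed.

Lemma numeric_mul A (G : scope A) m n : numeric G m -> numeric G n ->
  numeric G (fun a => m a * n a).
Proof.
move=> Hm Hn; apply: numeric_eq (numeric_sum (F := fun a _ => n a) Hm (computable_weak _ Hn)) _.
by move=> a; rewrite sum_nat_const_nat subn0.
Qed.

Lemma numeric_exp A (G : scope A) n k : numeric G n -> numeric G (fun a => n a ^ k).
Proof.
move=> Hn; elim: k => [|k IH]; first exact: numeric_const.
by apply: numeric_eq (numeric_mul Hn IH) _ => a; rewrite expnS.
Qed.

Lemma testable_eqn A (G : scope A) m n : numeric G m -> numeric G n ->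
  testable G (fun a => m a == n a).
Proof.
move=> Hm Hn.
apply: testable_eq (testable_nilp (numeric_add (numeric_sub Hm Hn) (numeric_sub Hn Hm))) _.
by move=> a; rewrite /nilp size_nseq addn_eq0 !subn_eq0 -eqn_leq.
Qed.

Lemma testable_leq A (G : scope A) m n : numeric G m -> numeric G n ->
  testable G (fun a => m a <= n a).
Proof.
move=> Hm Hn; apply: testable_eq (testable_nilp (numeric_sub Hm Hn)) _.
by move=> a; rewrite /nilp size_nseq subn_eq0.
Qed.

Lemma testable_odd A (G : scope A) n : numeric G n -> testable G (fun a => odd (n a)).
Proof. by move=> [x Hx]; exists (Par x) => a; apply: eval_par. Qed.

Lemma testable_all A (G : scope A) n (b : A -> nat -> bool) : numeric G n ->
  testable (bind G n) (fun p => b p.1 p.2) ->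
  testable G (fun a => all (b a) (iota 0 (n a))).
Proof.
move=> Hn Hb; apply: (testable_eq (b := fun a =>
  nilp (flatten [seq (if b a i then [::] else [:: true]) | i <- iota 0 (n a)]))).
  apply: testable_nilp; apply: (computable_flatten
    (F := fun a i => if b a i then [::] else [:: true])) => //.
  by apply: computable_if => //; [apply: computable_nil | apply: testable_const].
by move=> a; elim: (iota 0 (n a)) => //= i s; case: (b a i).
Qed.

Lemma testable_has A (G : scope A) (E : Type) (s : seq E) (b : E -> A -> bool) :
  (forall e, testable G (b e)) -> testable G (fun a => has (fun e => b e a) s).
Proof.
move=> H; elim: s => [|e s IH] /=; first exact: testable_const.
exact: testable_or.
Qed.

(** The quotient counts the positive multiples of [n] up to [m]. The guard yields 0 for [n = 0], as
    [divn] does. *)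
Lemma numeric_div A (G : scope A) m n : numeric G m -> numeric G n ->
  numeric G (fun a => m a %/ n a).
Proof.
move=> Hm Hn; apply: (numeric_eq (n := fun a =>
  \sum_(0 <= j < m a) ((0 < n a) && (j.+1 * n a <= m a)))).
  apply: numeric_sum => //; apply: numeric_bool; apply: testable_and.
    exact: (computable_weak _ (testable_leq (numeric_const G 1) Hn)).
  apply: testable_leq; last exact: (computable_weak _ Hm).
  by apply: numeric_mul (computable_weak _ Hn); apply: numeric_succ; apply: numeric_last.
move=> a; case: (posnP (n a)) => [->|n0]; first by rewrite big1 // divn0.
rewrite (eq_bigr (fun j => nat_of_bool (j < m a %/ n a))) => [|j _]; last by rewrite leq_divRL.
by rewrite sum_lt // leq_div.
Qed.

Lemma numeric_mod A (G : scope A) m n : numeric G m -> numeric G n ->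
  numeric G (fun a => m a %% n a).
Proof.
move=> Hm Hn; apply: numeric_eq (numeric_sub Hm (numeric_mul (numeric_div Hm Hn) Hn)) _.
by move=> a; rewrite {1}(divn_eq (m a) (n a)) addKn.
Qed.

Ltac lift_to G H k :=
  first [ k H
        | match G with bind ?G' ?n =>
            lift_to G' H ltac:(fun H' => k constr:(@computable_weak _ G' n _ H')) end ].

Ltac index_of G k :=
  match G with bind ?G' ?n =>
    first [ k constr:(@numeric_last _ G' n)
          | index_of G' ltac:(fun H => k constr:(@computable_weak _ G' n _ H)) ] end.

Ltac scope_leaf :=
  match goal with
  | |- @numeric _ ?G _ => index_of G ltac:(fun H => exact H)
  | H : @numeric _ _ _ |- @numeric _ ?G _ => lift_to G H ltac:(fun H => exact H)
  | H : @testable _ _ _ |- @testable _ ?G _ => lift_to G H ltac:(fun H => exact H)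
  | H : @computable _ _ _ |- @computable _ ?G _ => lift_to G H ltac:(fun H => exact H)
  end.

(* The dispatch is syntactic: [apply:] alone would unify up to unfolding. *)
Ltac compute_rule :=
  lazymatch goal with
  | |- numeric _ (fun=> ?c) => apply: numeric_const
  | |- numeric _ (fun a => (@?n a).+1) => apply: numeric_succ
  | |- numeric _ (fun a => (@?n a).-1) => apply: numeric_pred
  | |- numeric _ (fun a => (@?n a).*2) => apply: numeric_double
  | |- numeric _ (fun a => (@?n a)./2) => apply: numeric_half
  | |- numeric _ (fun a => (@?m a) + (@?n a)) => apply: numeric_add
  | |- numeric _ (fun a => (@?m a) - (@?n a)) => apply: numeric_sub
  | |- numeric _ (fun a => (@?m a) * (@?n a)) => apply: numeric_mul
  | |- numeric _ (fun a => (@?m a) ^ ?k) => apply: numeric_exp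
  | |- numeric _ (fun a => (@?m a) %/ (@?n a)) => apply: numeric_div
  | |- numeric _ (fun a => (@?m a) %% (@?n a)) => apply: numeric_mod
  | |- numeric _ (fun a => nat_of_bool (@?b a)) => apply: numeric_bool
  | |- numeric _ (fun a => size (@?F a)) => apply: numeric_size
  | |- numeric _ size => apply: (numeric_size (F := id))
  | |- numeric _ _ => first [apply: numeric_sum | apply: numeric_if]
  | |- testable _ (fun=> ?c) => apply: testable_const
  | |- testable _ (fun a => (@?b a) && (@?c a)) => apply: testable_and
  | |- testable _ (fun a => (@?b a) || (@?c a)) => apply: testable_or
  | |- testable _ (fun a => ~~ (@?b a)) => apply: testable_not
  | |- testable _ (fun a => (@?m a) == (@?n a)) => apply: testable_eqn
  | |- testable _ (fun a => (@?m a) <= (@?n a)) => apply: testable_leq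
  | |- testable _ (fun a => odd (@?n a)) => apply: testable_odd
  | |- testable _ (fun a => nth false (@?F a) (@?n a)) => apply: testable_nth
  | |- testable _ (fun a => all (@?b a) (@?s a)) => apply: testable_all
  | |- computable _ (fun=> [::]) => apply: computable_nil
  | |- computable _ (fun a => encode_nat (@?n a)) => apply: computable_encode
  | |- computable _ (fun a => flatten (@?s a)) => apply: computable_flatten
  | |- computable _ (fun a => (@?F a) ++ (@?F' a)) => apply: computable_cat
  | |- computable _ (fun a => drop (@?n a) (@?F a)) => apply: computable_drop
  | |- computable _ (fun a => [:: @?b a]) => apply: (_ : testable _ _)
  | |- computable _ _ => apply: computable_if
  end.

Ltac compute_step := first [scope_leaf | compute_rule].

Ltac compute_auto := cbv beta; repeat (compute_step; cbv beta).

(** * Computing the instances *)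

Lemma encode_matrix_iota m h (f : nat -> nat -> nat) :
  encode_matrix (\matrix_(i < m, k < h) f i k) =
  flatten [seq flatten [seq encode_nat (f i k) | k <- iota 0 h] | i <- iota 0 m].
Proof.
rewrite /encode_matrix -(val_enum_ord m) -(val_enum_ord h) -map_comp.
elim: (enum 'I_m) => [//|i s IH] /=; rewrite flatten_cat IH; congr (flatten _ ++ _).
by rewrite -map_comp; apply: eq_map => k /=; rewrite mxE.
Qed.

Lemma computable_instance A (G : scope A) n (r c : A -> nat -> nat -> nat) : numeric G n ->
  numeric (bind (bind G n) (fun=> 2)) (fun p => r p.1.1 p.1.2 p.2) ->
  numeric (bind (bind G n) (fun=> 2)) (fun p => c p.1.1 p.1.2 p.2) ->
  computable G (fun a => encode_instance (Instance
    (\matrix_(i < n a, k < 2) r a i k) (\matrix_(i < n a, k < 2) c a i k))).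
Proof.
move=> Hn Hr Hc; apply: (computable_eq (F := fun a => encode_nat (n a) ++
  flatten [seq flatten [seq encode_nat (r a i k) | k <- iota 0 2] | i <- iota 0 (n a)] ++
  flatten [seq flatten [seq encode_nat (c a i k) | k <- iota 0 2] | i <- iota 0 (n a)])).
  by compute_auto.
by move=> a; rewrite /encode_instance !encode_matrix_iota.
Qed.

Lemma eq_clause_size v inc inc' : (forall b, b < v.*2 -> inc b = inc' b) ->
  clause_size v inc = clause_size v inc'.
Proof.
move=> E; rewrite /clause_size !big_mkord; apply: eq_bigr => b _.
by rewrite E.
Qed.

(** Justifies replacing the incidence of literals by lookups in a table of [m] rows of [2v] bits. *)
Lemma eq_chain_instance v m inc inc' :
  (forall q b, q < m -> b < v.*2 -> inc q b = inc' q b) ->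
  chain_instance v m inc = chain_instance v m inc'.
Proof.
move=> E; rewrite /chain_instance /spread_instance; congr Instance; apply/matrixP => i k;
  rewrite !mxE; case: (odd i) => //; have := ltn_ord i; rewrite {2}/chain_size;
  move: {i}(i : nat) => i lti;
  have {lti} lti : i./2 < m * width v + v.*2 by lia.
- rewrite /chain_row; have w0 : 0 < width v by [].
  case: ltnP => // gea; case: eqP => // nea.
  have ltq : i./2 %/ width v < m.
    rewrite ltnNge; apply/negP => le.
    have := leq_mul2r (width v) m (i./2 %/ width v); rewrite le orbT => le2.
    have := divn_eq i./2 (width v); lia.
  by rewrite (eq_clause_size (fun b => E _ b ltq)).
- rewrite /chain_col; case: ltnP => // ltb; case: ltnP => // ltq.
  by rewrite E.
Qed.

Lemma computable_chain A (G : scope A) v m B : numeric G v -> numeric G m ->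
  computable G B -> computable G (fun a =>
    encode_instance (chain_instance (v a) (m a)
      (fun q b => nth false (B a) (q * (v a).*2 + b)))).
Proof.
move=> Hv Hm HB; rewrite /chain_instance /spread_instance /spread_matrix.
apply: (computable_instance (n := fun a => (chain_size (v a) (m a)).*2)
  (r := fun a i k => if odd i then 0 else chain_row (v a) (m a)
    (fun q b => nth false (B a) (q * (v a).*2 + b)) i./2 k)
  (c := fun a i k => if odd i then 0 else chain_col (v a) (m a)
    (fun q b => nth false (B a) (q * (v a).*2 + b)) i./2 k)).
- by rewrite /chain_size /width; compute_auto.
- by rewrite /chain_row /clause_size /width; compute_auto.
- by rewrite /chain_col /width; compute_auto.
Qed.

Definition clause_bits (L : finType) W n (c : seq (literal L)) : seq bool :=
  [seq has (fun l => rail W l == b) c | b <- iota 0 n].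

Lemma nth_clause_bits (L : finType) W n (cs : seq (seq (literal L))) q b :
  q < size cs -> b < n ->
  nth false (flatten [seq clause_bits W n c | c <- cs]) (q * n + b) = incidence W cs q b.
Proof.
rewrite /incidence => + ltb; elim: cs q => [//|c cs IH] [|q] /= ltq.
  by rewrite nth_cat size_map size_iota ltb (nth_map 0) ?size_iota // nth_iota.
rewrite nth_cat size_map size_iota ltnNge mulSn -addnA leq_addr /= addKn.
exact: IH.
Qed.

(* A list of clauses is computed as the concatenation of its incidence rows,
   together with its length. *)
Definition computable_clauses A (G : scope A) (L : finType) (W n : A -> nat)
    (cs : A -> seq (seq (literal L))) : Prop :=
  computable G (fun a => flatten [seq clause_bits (W a) (n a) c | c <- cs a]) /\
  numeric G (fun a => size (cs a)).

Lemma clauses_cat A (G : scope A) (L : finType) W n (cs ds : A -> seq (seq (literal L))) :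
  computable_clauses G W n cs -> computable_clauses G W n ds ->
  computable_clauses G W n (fun a => cs a ++ ds a).
Proof.
move=> [C N] [C' N']; split.
  by apply: computable_eq (computable_cat C C') _ => a; rewrite map_cat flatten_cat.
by apply: numeric_eq (numeric_add N N') _ => a; rewrite size_cat.
Qed.

Lemma clauses_if A (G : scope A) (L : finType) W n b (cs ds : A -> seq (seq (literal L))) :
  testable G b -> computable_clauses G W n cs -> computable_clauses G W n ds ->
  computable_clauses G W n (fun a => if b a then cs a else ds a).
Proof.
move=> Hb [C N] [C' N']; split.
  by apply: computable_eq (computable_if Hb C C') _ => a; case: (b a).
by apply: numeric_eq (numeric_if Hb N N') _ => a; case: (b a).
Qed.

Lemma clauses_flatten A (G : scope A) (L : finType) W n k
    (cs : A -> nat -> seq (seq (literal L))) :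
  numeric G k ->
  computable_clauses (bind G k) (fun p => W p.1) (fun p => n p.1) (fun p => cs p.1 p.2) ->
  computable_clauses G W n (fun a => flatten [seq cs a i | i <- iota 0 (k a)]).
Proof.
move=> Hk [C N]; split.
  apply: computable_eq (computable_flatten (F := fun a i =>
    flatten [seq clause_bits (W a) (n a) c | c <- cs a i]) Hk C) _ => a.
  by elim: (iota _ _) => //= i s ->; rewrite map_cat flatten_cat.
apply: numeric_eq (numeric_sum (F := fun a i => size (cs a i)) Hk N) _ => a.
rewrite /index_iota subn0; elim: (iota _ _) => [|i s IH]; first by rewrite big_nil.
by rewrite big_cons IH /= size_cat.
Qed.

(** The templates and their literals form a fixed finite list, so the iteration over them is
    unrolled into the expression; only times and positions are data. *)
Lemma clauses_inst A (G : scope A) (L : finType) W n (T t p : A -> nat)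
    (tpls : seq (seq (tlit L))) :
  numeric G W -> numeric G n -> numeric G T -> numeric G t -> numeric G p ->
  computable_clauses G W n (fun a => [seq inst (T a) (t a) (p a) tpl | tpl <- tpls]).
Proof.
move=> HW Hn HT Ht Hp; split; last first.
  by apply: numeric_eq (numeric_const G (size tpls)) _ => a; rewrite size_map.
elim: tpls => [|tpl tpls IH] /=; first exact: computable_nil.
apply: computable_cat IH; apply: (computable_eq (F := fun a => flatten
  [seq [:: has (fun e => guard_ok (T a) (p a) e && (rail (W a) (inst_lit (T a) (t a) (p a) e) == b)) tpl]
  | b <- iota 0 (n a)])).
  apply: computable_flatten => //; apply: testable_has => -[[[[g s] dt] [rel d]] x].
  rewrite /guard_ok /rail /fvar /inst_lit /=.
  by case: g => [c|]; compute_auto.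
move=> a; rewrite /clause_bits /inst; elim: (iota 0 (n a)) => //= b s ->; congr cons.
elim: tpl => //= e tpl IHt; rewrite IHt; by case: guard_ok.
Qed.

Lemma computable_tableau A (G : scope A) (M : machine) T dx Y n :
  numeric G T -> computable G dx -> numeric G Y -> numeric G n ->
  computable_clauses G (fun a => (T a).*2.+2) n (fun a => tableau M (T a) (dx a) (Y a)).
Proof.
move=> HT Hdx HY Hn; have HW : numeric G (fun a => (T a).*2.+2) by compute_auto.
have Hs : numeric G (fun a => size (dx a)) by compute_auto.
rewrite /tableau; apply: clauses_cat; [|apply: clauses_cat].
- rewrite /init_clauses; apply: clauses_flatten; first by compute_auto.
  set G' := bind _ _; rewrite /zone_tpls.
  have Hin tpls : computable_clauses G' (fun p => (T p.1).*2.+2) (fun p => n p.1)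
      (fun p => [seq inst (T p.1) 0 p.2 tpl | tpl <- tpls : seq (seq (tlit (label M)))]).
    by apply: clauses_inst; rewrite /G'; compute_auto.
  have Hlt k : numeric G k -> testable G' (fun p => p.2 < k p.1).
    by move=> Hk; rewrite /G'; compute_auto.
  have H0 := Hlt _ HT.
  have H1 : testable G' (fun p => p.2 < T p.1 + size (dx p.1)).
    by apply: (Hlt (fun a => T a + size (dx a))); compute_auto.
  have H2 : testable G' (fun p => p.2 < T p.1 + size (dx p.1) + Y p.1).
    by apply: (Hlt (fun a => T a + size (dx a) + Y a)); compute_auto.
  have H3 : testable G' (fun p => nth false (dx p.1) (p.2 - T p.1)).
    by rewrite /G'; compute_auto.
  (* The template for a cell of [dx] depends on a bit of the input; branching on this bit leaves a
     fixed list in each case. *)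
  have := clauses_if H0 (Hin (common_tpls M ++ [:: unit_tpl blank]))
    (clauses_if H1 (clauses_if H3 (Hin (common_tpls M ++ [:: unit_tpl (bit true)]))
        (Hin (common_tpls M ++ [:: unit_tpl (bit false)])))
      (clauses_if H2 (Hin (common_tpls M ++ [:: choice_tpl M; blank_tpl M]))
        (Hin (common_tpls M ++ [:: unit_tpl blank])))).
  rewrite /computable_clauses => -[C N]; split.
    apply: computable_eq C _ => -[a p] /=.
    by do 3!case: ifP => // _; case: nth.
  apply: numeric_eq N _ => -[a p] /=.
  by do 3!case: ifP => // _; case: nth.
- apply: clauses_flatten => //; rewrite /step_clauses; apply: clauses_flatten.
    by compute_auto.
  by apply: clauses_inst; compute_auto.
- by apply: (clauses_inst (T := T) (t := T) (p := fun=> 0) [:: final_tpl M]); compute_auto.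
Qed.

Theorem computable_cnf A (G : scope A) (M : machine) T dx Y :
  numeric G T -> computable G dx -> numeric G Y ->
  computable G (fun a => encode_instance
    (cnf_instance (T a) (T a).*2.+2 (tableau M (T a) (dx a) (Y a)))).
Proof.
move=> HT Hdx HY.
have Hv : numeric G (fun a => num_vars (label M) (T a) (T a).*2.+2).
  by rewrite /num_vars; compute_auto.
have [HB Hm] := @computable_tableau A G M T dx Y _ HT Hdx HY (numeric_double Hv).
apply: computable_eq (computable_chain Hv Hm HB) _ => a.
rewrite /cnf_instance; congr encode_instance; apply: eq_chain_instance => q b ltq ltb.
exact: nth_clause_bits.
Qed.

(** * NP-completeness *)

Fact input_size (x : seq bool) : size [:: x] = 1.
Proof. by []. Qed.

Definition input_scope : scope (seq bool) := Scope input_size.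

Lemma computable_input : computable input_scope (fun x => x).
Proof. by exists (Var 0). Qed.

Lemma computable_polytime F : computable input_scope F -> polytime F.
Proof.
move=> [x Hx]; have [M [k Hk]] := expr_polytime x.
by exists M, k => w; rewrite -Hx; apply: Hk.
Qed.

Lemma computable_delimit A (G : scope A) F : computable G F ->
  computable G (fun a => delimit (F a)).
Proof.
move=> HF; apply: (computable_eq (F := fun a =>
  flatten [seq [:: true] ++ [:: nth false (F a) i] | i <- iota 0 (size (F a))] ++ [:: false])).
  apply: computable_cat (testable_const G false); apply: computable_flatten.
    exact: numeric_size.
  apply: computable_cat (testable_const _ true) _.
  by apply: (_ : testable _ _); compute_auto.
move=> a; rewrite /delimit; congr (flatten _ ++ _).
rewrite -[in RHS](mkseq_nth false (F a)) /mkseq -map_comp.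
exact: eq_map.
Qed.

Lemma testable_eqseq A (G : scope A) F F' : computable G F -> computable G F' ->
  testable G (fun a => F a == F' a).
Proof.
move=> HF HF'; apply: (testable_eq (b := fun a => (size (F a) == size (F' a)) &&
  all (fun i => (nth false (F a) i && nth false (F' a) i) ||
                (~~ nth false (F a) i && ~~ nth false (F' a) i)) (iota 0 (size (F a))))).
  by compute_auto.
move=> a; apply/andP/eqP => [[/eqP Es /allP all_eq]|->].
  apply: (eq_from_nth (x0 := false)) => // i lti.
  have := all_eq i; rewrite mem_iota lti => /(_ isT).
  by case: nth; case: nth.
by split=> //; apply/allP => i _; case: nth.
Qed.

(** The integer square root of half the length. A certificate consists of [2 n^2] bits, so its
    length alone determines the grid size. *)
Definition cert_grid (y : seq bool) : nat :=
  \sum_(0 <= i < size y) (i.+1 ^ 2 * 2 <= size y).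

Definition cert_tiling (y : seq bool) (i j k : nat) : bool :=
  [&& i < cert_grid y, j < cert_grid y, k < 2
    & nth false y ((i * cert_grid y + j) * 2 + k)].

Definition sum_instance n (t : nat -> nat -> nat -> bool) : instance 2 :=
  Instance (\matrix_(i < n, k < 2) \sum_(0 <= j < n) t i j k)
           (\matrix_(j < n, k < 2) \sum_(0 <= i < n) t i j k).

Definition valid_at n (t : nat -> nat -> nat -> bool) i j k : bool :=
  ~~ t i j k || [&& i.+1 < n, j.+1 < n &
    all (fun i' => all (fun j' => all (fun k' =>
      ~~ t i' j' k' || ([&& i == i', j == j' & k == k'] || far i j i' j'))
    (iota 0 2)) (iota 0 n)) (iota 0 n)].

Definition valid n (t : nat -> nat -> nat -> bool) : bool :=
  all (fun i => all (fun j => all (fun k => valid_at n t i j k)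
    (iota 0 2)) (iota 0 n)) (iota 0 n).

Lemma all_iotaP (P : pred nat) n : reflect (forall i, i < n -> P i) (all P (iota 0 n)).
Proof.
apply: (iffP allP) => H i; first by move=> lti; apply: H; rewrite mem_iota.
by rewrite mem_iota add0n => /andP[_]; apply: H.
Qed.

Lemma validP n (t : nat -> nat -> nat -> bool) : (forall i j k, t i j k -> [/\ i < n, j < n & k < 2]) ->
  reflect (nat_tiling n t) (valid n t).
Proof.
move=> bnd; apply: (iffP idP) => [/all_iotaP V|[tin tfar]].
  have {}V i j k : t i j k -> [/\ i.+1 < n, j.+1 < n & forall i' j' k', t i' j' k' ->
      [&& i == i', j == j' & k == k'] || far i j i' j'].
    move=> tijk; have [lti ltj ltk] := bnd _ _ _ tijk.
    move: (V i lti) => /all_iotaP /(_ j ltj) /all_iotaP /(_ k ltk).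
    rewrite /valid_at tijk orFb => /and3P[-> -> /all_iotaP W]; split=> // i' j' k' t'.
    have [lti' ltj' ltk'] := bnd _ _ _ t'.
    by move: (W i' lti') => /all_iotaP /(_ j' ltj') /all_iotaP /(_ k' ltk'); rewrite t'.
  split=> [i j k tijk|i j k i' j' k' tijk t' ne].
    by have [? ? _] := V _ _ _ tijk; have [] := bnd _ _ _ tijk.
  have [_ _ /(_ _ _ _ t')] := V _ _ _ tijk.
  by case/orP=> // /and3P[/eqP Ei /eqP Ej /eqP Ek]; rewrite Ei Ej Ek eqxx in ne.
apply/all_iotaP => i _; apply/all_iotaP => j _; apply/all_iotaP => k _.
rewrite /valid_at; case tijk: (t i j k); last by [].
have [-> -> _] := tin _ _ _ tijk; rewrite orFb !andTb.
apply/all_iotaP => i' _; apply/all_iotaP => j' _; apply/all_iotaP => k' _.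
case t': (t i' j' k') => //=; case: and3P => //= ne; apply: tfar tijk t' _.
by apply/eqP => -[Ei Ej Ek]; apply: ne; split; apply/eqP.
Qed.

Definition checks (w y : seq bool) : bool :=
  (w == delimit (encode_instance (sum_instance (cert_grid y) (cert_tiling y))) ++ y) &&
  valid (cert_grid y) (cert_tiling y).

(** Nothing is parsed: every suffix is tried as certificate, the instance is recomputed from it, and
    its encoding is compared with the input. *)
Definition verifies (w : seq bool) : bool :=
  ~~ all (fun s => ~~ checks w (drop s w)) (iota 0 (size w).+1).

Lemma testable_checks A (G : scope A) w y : computable G w -> computable G y ->
  testable G (fun a => checks (w a) (y a)).
Proof.
move=> Hw Hy.
have Hn : numeric G (fun a => cert_grid (y a)) by rewrite /cert_grid; compute_auto.
apply: testable_and.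
  apply: testable_eqseq => //; apply: (computable_cat (computable_delimit _) Hy).
  rewrite /sum_instance; apply: (computable_instance (n := fun a => cert_grid (y a))
    (r := fun a i k => \sum_(0 <= j < cert_grid (y a)) cert_tiling (y a) i j k)
    (c := fun a j k => \sum_(0 <= i < cert_grid (y a)) cert_tiling (y a) i j k)) => //.
    by rewrite /cert_tiling; compute_auto.
  by rewrite /cert_tiling; compute_auto.
by rewrite /valid /valid_at /cert_tiling /far; compute_auto.
Qed.

Lemma testable_verifies : testable input_scope verifies.
Proof.
have Hx := computable_input.
apply: testable_not; apply: (testable_all (n := fun w => (size w).+1)
  (b := fun w s => ~~ checks w (drop s w))); first by compute_auto.
by apply: testable_not; apply: testable_checks; compute_auto.
Qed.

Lemma cert_tiling_bound y i j k : cert_tiling y i j k ->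
  [/\ i < cert_grid y, j < cert_grid y & k < 2].
Proof. by case/and4P. Qed.

(** Each of the [n * 2] row sums contributes at least its delimiter. Hence the [2 n^2] bits of a
    certificate stay below the square of the input length. *)
Lemma encode_instance_size n t : n * 2 <= size (encode_instance (sum_instance n t)).
Proof.
pose f i k := \sum_(0 <= j < n) t i j k.
rewrite /encode_instance !size_cat -[row_sums _]/(\matrix_(i < n, k < 2) f i k)%R.
rewrite encode_matrix_iota.
apply: leq_trans (leq_trans (leq_addr _ _) (leq_addl _ _)).
rewrite -{1}(size_iota 0 n); elim: (iota 0 n) => [//|i s IH].
rewrite map_cons -[flatten (_ :: _)]/(_ ++ flatten _) size_cat /= mulSn; apply: leq_add IH.
by rewrite cats0 size_cat /encode_nat /delimit !size_cat /=; lia.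
Qed.

Definition tiling_cert n (t : nat -> nat -> nat -> bool) : seq bool :=
  mkseq (fun e => t (e %/ 2 %/ n) (e %/ 2 %% n) (e %% 2)) (n ^ 2 * 2).

Lemma cert_grid_tiling n t : cert_grid (tiling_cert n t) = n.
Proof.
rewrite /cert_grid size_mkseq (eq_bigr (fun i => nat_of_bool (i < n))) => [|i _].
  by rewrite sum_lt //; case: n => // n; rewrite expnS; lia.
by rewrite leq_pmul2r // leq_exp2r.
Qed.

Lemma cert_tilingK n t : nat_tiling n t -> cert_tiling (tiling_cert n t) = t.
Proof.
move=> [tin _]; apply: functional_extensionality => i.
apply: functional_extensionality => j; apply: functional_extensionality => k.
rewrite /cert_tiling cert_grid_tiling.
case: (boolP [&& i < n, j < n & k < 2]) => [/and3P[lti ltj ltk]|out]; last first.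
  apply/idP/idP => [/and4P[lti ltj ltk _]|/tin[lti ltj ltk]]; case/negP: out.
    by rewrite lti ltj.
  by rewrite ltk (ltnW lti) (ltnW ltj).
rewrite lti ltj ltk /= nth_mkseq; last first.
  have := leq_mul2r n i.+1 n; rewrite lti orbT mulSn expnS expn1; lia.
have n0 : 0 < n by lia.
have -> : ((i * n + j) * 2 + k) %/ 2 = i * n + j by rewrite divnMDl // divn_small // addn0.
have -> : ((i * n + j) * 2 + k) %% 2 = k by rewrite modnMDl modn_small.
have -> : (i * n + j) %/ n = i by rewrite divnMDl // divn_small // addn0.
by rewrite modnMDl modn_small.
Qed.

Theorem consistency_in_NP : in_NP (consistency_problem two_squares).
Proof.
exists (fun w => verifies w), 2; split.
  by exists verifies => //; apply: computable_polytime; apply: testable_verifies.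
move=> x; split.
  move=> [I -> /consistentP[t [til Er Ec]]].
  have EI : I = sum_instance (grid_size I) t.
    case: I til Er Ec => n r c /= til Er Ec.
    by congr Instance; apply/matrixP => i k; rewrite mxE.
  move: (grid_size I) til EI => n til -> {I Er Ec}.
  exists (tiling_cert n t); split.
    rewrite size_mkseq; apply: leq_trans (leq_addr _ _).
    apply: (@leq_trans ((n * 2) ^ 2)); first by rewrite expnMn leq_mul.
    by rewrite leq_exp2r // encode_instance_size.
  rewrite /verifies /pair_word; set w := _ ++ _.
  apply/allPn; exists (size (delimit (encode_instance (sum_instance n t)))).
    by rewrite mem_iota add0n ltnS /w size_cat leq_addr.
  rewrite negbK /w drop_size_cat // /checks cert_grid_tiling cert_tilingK // eqxx /=.
  by apply/validP => // i j k /(proj1 til) [? ? ?]; split=> //; apply: ltnW.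
(* The accepted suffix need not be [y] itself; [delimit_inj] still identifies the instance, and the
   tiling is read from that suffix. *)
move=> [y [_ /allPn[s _]]]; rewrite negbK => /andP[/eqP].
set y' := drop s _ => Ew V; have [-> _] := delimit_inj Ew.
exists (sum_instance (cert_grid y') (cert_tiling y')) => //.
apply/consistentP; exists (cert_tiling y'); split=> [|i k|j k]; try by rewrite mxE.
exact: (validP (@cert_tiling_bound y') V).
Qed.

Lemma size_delimit x : size (delimit x) = (size x).*2.+1.
Proof. by rewrite /delimit size_cat addn1; congr _.+1; elim: x => //= b x ->. Qed.

Lemma scanned_output (M : machine) w b t T : outputs_within M w [:: b] t -> t <= T ->
  scanned (tapes (iter T (@step M) (init_config M w)) ord0) = bit b.
Proof.
move=> [halt out] leT; rewrite -(subnK leT) iterD iter_halting //.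
by move: out; rewrite /tape_word; case: (tapes _ _) => l [[c|x]|] r //= [-> _].
Qed.

Theorem consistency_NP_hard : NP_hard (consistency_problem two_squares).
Proof.
move=> L [V [k [[f [M [k' run]] Vf] Lx]]].
(* [Y] bounds the certificate and [S] the input of the verifier. [T] exceeds the running time on
   such inputs as well as [S], so that the input fits into the window of radius [T]. *)
pose Y (x : seq bool) := size x ^ k + k; pose S (x : seq bool) := (size x).*2.+1 + Y x.
pose T x := S x ^ k' + k' + S x.
have Hx := computable_input.
have HY : numeric input_scope Y by rewrite /Y; compute_auto.
have HS : numeric input_scope S by rewrite /S; compute_auto.
have HT : numeric input_scope T by rewrite /T; compute_auto.
pose I x := cnf_instance (T x) (T x).*2.+2 (tableau M (T x) (delimit x) (Y x)).
exists (fun x => encode_instance (I x)).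
  exact: computable_polytime (computable_cnf M HT (computable_delimit Hx) HY).
move=> x; have S0 : 0 < S x by rewrite /S.
have T1 : 1 < T x.
  have : 0 < S x ^ k' by rewrite expn_gt0 S0.
  by rewrite /T; move: (S x ^ k') S0 => e; lia.
have leT : size (delimit x) + Y x <= T x by rewrite size_delimit /T /S; lia.
have final y : size y <= Y x ->
    scanned (tapes (iter (T x) (@step M) (init_config M (delimit x ++ y))) ord0)
    = bit (f (delimit x ++ y)).
  move=> ley; apply: (scanned_output (run _)).
  have les : size (delimit x ++ y) <= S x by rewrite size_cat size_delimit /S; lia.
  by rewrite /T -addnA leq_add ?leq_addr //; case: (k') => // k2; rewrite leq_exp2r.
have -> : consistency_problem two_squares (encode_instance (I x)) <->
    consistent two_squares (I x).
  by split=> [[J /encode_instance_inj <-]|conI] //; exists (I x).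
rewrite Lx (tableau_correct M T1 leT); split.
  move=> [y [ley /Vf fy]]; exists y; rewrite // final //.
  by move: fy; rewrite /pair_word => ->.
move=> [y ley]; rewrite final // => ne; exists y; split=> //; apply/Vf.
by move: ne; rewrite /pair_word; case: (f _).
Qed.

Theorem theorem3 : NP_complete (consistency_problem two_squares).
Proof. by split; [apply: consistency_in_NP | apply: consistency_NP_hard]. Qed.
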